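(* Let $K$ be an algebraically closed field of arbitrary characteristic, $n\ge 1$ and $r,s\geq 0$ integers. Consider the Schur algebra $S(n,r+(n-1)s)$ and the set $\nu=\Lambda^+(n,r+(n-1)s)$ of dominant weights ordered by the reverse dominance order $\unrhd$. Let $\{C^{\lambda}_{S,T}\mid \lambda\in\nu\}$ be any cellular basis of $S(n,r+(n-1)s)$. Then the kernel of the quotient map $S(n,r+(n-1)s)\to S(n,r,s)$ is spanned by the set of all $C^{\mu}_{S,T}$ such that $\mu=(\mu_1,\ldots,\mu_n)\in\nu$ satisfies $\sum_{i\in R^+_\mu}\mu_i>r+|R^+_\mu|s$, where $R^+_\mu=\{1\le i\le n\mid \mu_i>s\}$.
   Context: $G=\mathrm{GL}(n)$ over $K$; $c_{ij}$ are the coordinate functions of the generic matrix $C$, $d_{ij}$ the entries of $C^{-1}$, $D=\det C$. $A(n,d)$ is the space of homogeneous polynomials of degree $d$ in the $c_{ij}$, and the Schur algebra is $S(n,d)=A(n,d)^*$. $A(n,r,s)\subset K[G]$ is the subcoalgebra spanned by all $\prod c_{ij}^{a_{ij}}\prod d_{ij}^{b_{ij}}$ with $\sum a_{ij}=r$, $\sum b_{ij}=s$, and the rational Schur algebra is $S(n,r,s)=A(n,r,s)^*$. The quotient map $S(n,r+(n-1)s)\to S(n,r,s)$ is the surjective algebra map dual to the injective coalgebra map $A(n,r,s)\to A(n,r+(n-1)s)$, $a\mapsto D^s a$ (it corresponds to tensoring $S(n,r,s)$-modules with the $s$-th power of the determinant representation). $\Lambda^+(n,d)$ is the set of $\lambda\in\mathbb{Z}^n$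 with $\lambda_1\ge\cdots\ge\lambda_n\geq 0$ and $\sum\lambda_i=d$. Dominance: $\kappa\unrhd\mu$ means $\sum_{i\le k}\kappa_i\ge\sum_{i\le k}\mu_i$ for all $k$ (with equality for $k=n$). ''Cellular basis'' is in the sense of Graham and Lehrer: for each $\lambda\in\nu$ there is a finite index set $M(\lambda)$ such that the $C^\lambda_{S,T}$ ($\lambda \in \nu$, $S,T\in M(\lambda)$) form a basis of $A=S(n,r+(n-1)s)$, the linear map $C^\lambda_{S,T}\mapsto C^\lambda_{T,S}$ is an anti-automorphism, and left multiplication satisfies $a\,C^\lambda_{S,T}\equiv\sum_{S'}r_a(S',S)C^\lambda_{S',T}$ modulo the span of the $C^{\kappa}_{U,V}$ with $\kappa\rhd\lambda$, with $r_a(S',S)$ independent of $T$. Thus $A[\unrhd\mu]$, the span of all $C^\kappa_{U,V}$ with $\kappa\unrhd\mu$, is a two-sided ideal. The cell module labelled by $\lambda$ is the standard (Weyl) module $\Delta(\lambda)$ of highest weight $\lambda$. *)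

(* Defs.v *)
From HB Require Import structures.
From mathcomp Require Import all_boot all_order all_algebra perm.
From mathcomp Require Import boolp classical_sets functions.

Set Implicit Arguments.
Unset Strict Implicit.
Unset Printing Implicit Defensive.

Import Order.TTheory GRing.Theory.

Local Open Scope classical_set_scope.
Local Open Scope ring_scope.

Section Span.
Variables (K : fieldType) (V : lmodType K).

Definition lin_span (X : set V) : set V :=
  [set v | exists (I : finType) (a : I -> K) (x : I -> V),
     (forall i, X (x i)) /\ v = \sum_i a i *: x i].

Definition is_subspace (X : set V) : Prop :=
  X 0 /\ forall (a : K) u v, X u -> X v -> X (a *: u + v).

Lemma lin_span_min (X U : set V) : is_subspace U -> X `<=` U -> lin_span X `<=` U.
Proof.
move=> [U0 UL] XU _ [I [a [x [xX ->]]]].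
by elim/big_rec: _ => // i v _ Uv; apply: UL => //; apply: XU.
Qed.

Lemma lin_span_incl (X : set V) : X `<=` lin_span X.
Proof.
move=> v Xv; exists unit, (fun=> 1), (fun=> v); split=> //.
by rewrite (bigD1 tt) //= big1 ?addr0 ?scale1r //; case.
Qed.

Lemma lin_span_subspace (X : set V) : is_subspace (lin_span X).
Proof.
split; first by exists void, (fun=> 0), (fun=> 0); split; [case|rewrite big1 //; case].
move=> c u v [I [a [x [xX ->]]]] [J [b [y [yX ->]]]].
exists (I + J)%type, (fun k => match k with inl i => c * a i | inr j => b j end).
exists (fun k => match k with inl i => x i | inr j => y j end).
split; first by case.
rewrite big_sumType /= scaler_sumr; congr (_ + _).
by apply: eq_bigr => i _; rewrite scalerA.
Qed.

End Span.

(* Linear subspaces of a possibly infinite-dimensional V, as K-modules. *)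
Record subspace (K : fieldType) (V : lmodType K) := Subspace {
  sub_set : set V;
  sub_setP : is_subspace sub_set }.

Section SubspaceModule.
Variables (K : fieldType) (V : lmodType K) (U : subspace V).

Record subsp := Subsp { subsp_val :> V; _ : subsp_val \in sub_set U }.

HB.instance Definition _ := [isSub for subsp_val].
HB.instance Definition _ := [Choice of subsp by <:].

Fact sub_closed : subsemimod_closed [in sub_set U].
Proof.
have [U0 UL] := sub_setP U.
split; first split.
- exact/mem_set.
- move=> u v /set_mem Uu /set_mem Uv; apply/mem_set.
  by rewrite -[u]scale1r; apply: UL.
- move=> a u /set_mem Uu; apply/mem_set.
  by rewrite -[_ *: _]addr0; apply: UL.
Qed.

HB.instance Definition _ :=
  GRing.SubChoice_isSubLmodule.Build K V [in sub_set U] subsp sub_closed.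

Lemma subspP (u : subsp) : sub_set U (subsp_val u).
Proof. by case: u => u /= /set_mem. Qed.

Lemma subsp_eqP (u v : subsp) : subsp_val u = subsp_val v -> u = v.
Proof. exact: val_inj. Qed.

Lemma subsp_valP (a : K) (u v : subsp) :
  subsp_val (a *: u + v) = a *: subsp_val u + subsp_val v.
Proof. by []. Qed.

Definition in_subsp (v : V) (Uv : sub_set U v) : subsp := Subsp (mem_set Uv).

End SubspaceModule.

Section Dual.
Variables (K : fieldType) (V : lmodType K).

Fact dual_subspace_proof :
  is_subspace [set phi : V -> K^o | linear phi].
Proof.
split; first by move=> a u v; rewrite /= scaler0 addr0.
move=> c f g Lf Lg a u v.
have Ef := Lf a u v; have Eg := Lg a u v; rewrite /= in Ef Eg.
rewrite -[LHS]/(c *: f (a *: u + v) + g (a *: u + v)) Ef Eg.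
rewrite -[RHS]/(a *: (c *: f u + g u) + (c *: f v + g v)).
by rewrite !scalerDr !scalerA [c * a]mulrC addrACA.
Qed.

Definition lin_dual := subsp (Subspace dual_subspace_proof).

HB.instance Definition _ := GRing.Lmodule.on lin_dual.
HB.instance Definition _ := SubType.on lin_dual.

Definition dual_fun (phi : lin_dual) : V -> K^o := subsp_val phi.

Definition mk_dual (f : V -> K^o) (Lf : linear f) : lin_dual :=
  @in_subsp K _ (Subspace dual_subspace_proof) f Lf.

HB.instance Definition _ (phi : lin_dual) :=
  GRing.isLinear.Build K V K^o _ (dual_fun phi) (subspP phi).

Lemma dual_eqP (phi psi : lin_dual) :
  (forall v, dual_fun phi v = dual_fun psi v) -> phi = psi.
Proof. by move=> e; apply: val_inj; apply/funext. Qed.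

End Dual.
Coercion dual_fun : lin_dual >-> Funclass.

(* A nonzero coalgebra of functions on a monoid: for f in the space, f(gh)
   must lie in the algebraic tensor square of the space.                    *)
Record subcoalg (K : fieldType) (G : monoidType) := Subcoalg {
  coalg_sub :> subspace (G -> K^o);
  coalg_comulP : forall f, sub_set coalg_sub f ->
    exists (I : finType) (f1 f2 : I -> G -> K^o),
      [/\ forall i, sub_set coalg_sub (f1 i), forall i, sub_set coalg_sub (f2 i)
        & forall g h, f (g * h)%g = \sum_i f1 i g * f2 i h];
  coalg_neq0 : exists2 f, sub_set coalg_sub f & f 1%g != 0 }.

Section DualAlgebra.
Variables (K : fieldType) (G : monoidType) (A : subcoalg K G).
Local Notation T := (subsp A).

Fact ltrans_proof (g : G) (f : T) :
  sub_set A (fun h => subsp_val f (g * h)%g).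
Proof.
have [I [f1 [f2 [_ A2 E]]]] := coalg_comulP (subspP f).
have -> : (fun h => subsp_val f (g * h)%g) = \sum_i f1 i g *: f2 i.
  by apply/funext => h; rewrite fct_sumE E.
elim/big_rec: _ => [|i x _ Ax]; first by case: (sub_setP A).
by case: (sub_setP A) => _; apply.
Qed.

Definition ltrans (g : G) (f : T) : T := in_subsp (ltrans_proof g f).

Lemma ltrans_linear g : linear (ltrans g).
Proof. by move=> a u v; apply: val_inj. Qed.

Lemma dual_act_sum (xi : lin_dual T) (f : T) (I : finType)
    (f1 : I -> G -> K) (f2 : I -> T) :
    (forall g h, subsp_val f (g * h)%g = \sum_i f1 i g * subsp_val (f2 i) h) ->
  forall g, xi (ltrans g f) = \sum_i f1 i g * xi (f2 i).
Proof.
move=> E g; have -> : ltrans g f = \sum_i f1 i g *: f2 i.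
  apply: val_inj; rewrite raddf_sum /=; apply/funext => h.
  by rewrite fct_sumE E.
by rewrite linear_sum; apply: eq_bigr => i _; rewrite linearZ.
Qed.

Fact dual_act_proof (xi : lin_dual T) (f : T) :
  sub_set A (fun g => xi (ltrans g f)).
Proof.
have [I [f1 [f2 [A1 A2 E]]]] := coalg_comulP (subspP f).
have -> : (fun g => xi (ltrans g f)) = \sum_i xi (in_subsp (A2 i)) *: f1 i.
  apply/funext => g; rewrite fct_sumE.
  rewrite (@dual_act_sum xi f I f1 (fun i => in_subsp (A2 i))) //.
  by apply: eq_bigr => i _; rewrite mulrC.
elim/big_rec: _ => [|i x _ Ax]; first by case: (sub_setP A).
by case: (sub_setP A) => _; apply.
Qed.

(* The left action of A^* on the A-comodule A: (id (x) xi) o comul.  *)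
Definition dual_act (xi : lin_dual T) (f : T) : T := in_subsp (dual_act_proof xi f).

Lemma dual_act_linear xi : linear (dual_act xi).
Proof.
move=> a u v; apply: val_inj; apply/funext => g /=.
by rewrite ltrans_linear linearP.
Qed.

Fact counit_linear : linear ((fun f => subsp_val f 1%g) : T -> K^o).
Proof. by []. Qed.
Definition dual_one : lin_dual T := mk_dual counit_linear.

Fact dual_mul_linear (xi eta : lin_dual T) : linear (fun f => xi (dual_act eta f)).
Proof. by move=> a u v /=; rewrite dual_act_linear linearP. Qed.
(* The convolution product (xi (x) eta) o comul; see dual_mulE.  *)
Definition dual_mul (xi eta : lin_dual T) : lin_dual T :=
  mk_dual (dual_mul_linear xi eta).

Lemma dual_mulE (xi eta : lin_dual T) (f : T) (I : finType) (f1 f2 : I -> T) :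
    (forall g h,
       subsp_val f (g * h)%g = \sum_i subsp_val (f1 i) g * subsp_val (f2 i) h) ->
  dual_mul xi eta f = \sum_i xi (f1 i) * eta (f2 i).
Proof.
move=> E; have -> : dual_mul xi eta f = xi (\sum_i (eta (f2 i) : K) *: f1 i).
  congr (xi _); apply: val_inj; rewrite raddf_sum /=; apply/funext => g.
  rewrite fct_sumE (@dual_act_sum eta f I (fun i => subsp_val (f1 i)) f2) //.
  by apply: eq_bigr => i _; rewrite mulrC.
by rewrite linear_sum; apply: eq_bigr => i _; rewrite linearZ /= mulrC.
Qed.

Lemma dual_act_mul xi eta f :
  dual_act (dual_mul xi eta) f = dual_act xi (dual_act eta f).
Proof.
apply: val_inj; apply/funext => g; congr (xi _).
apply: val_inj; apply/funext => h; congr (eta _).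
by apply: val_inj; apply/funext => k; rewrite /= mulgA.
Qed.

Fact dual_mulA : associative dual_mul.
Proof.
by move=> x y z; apply: dual_eqP => f; rewrite -[RHS]/(x _) -dual_act_mul.
Qed.

Fact dual_mul1 : left_id dual_one dual_mul.
Proof.
move=> x; apply: dual_eqP => f; congr (x _).
by apply: val_inj; apply/funext => h; rewrite /= mul1g.
Qed.

Fact dual_mulr1 : right_id dual_one dual_mul.
Proof.
move=> x; apply: dual_eqP => f; congr (x _).
by apply: val_inj; apply/funext => h; rewrite /= mulg1.
Qed.

Fact dual_mulDl : left_distributive dual_mul +%R.
Proof. by move=> x y z; apply: dual_eqP. Qed.

Fact dual_mulDr : right_distributive dual_mul +%R.
Proof.
move=> x y z; apply: dual_eqP => f.
rewrite -[RHS]/(x _ + x _) -linearD; congr (x _).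
by apply: val_inj; apply/funext.
Qed.

Fact dual_one_neq0 : dual_one != 0.
Proof.
have [f Af f1] := coalg_neq0 A; apply: contra f1 => /eqP E.
by rewrite -[f 1%g]/(dual_one (in_subsp Af)) E.
Qed.

Definition dualalg := lin_dual T.
Identity Coercion dual_of_dualalg : dualalg >-> lin_dual.
HB.instance Definition _ := GRing.Lmodule.on dualalg.
HB.instance Definition _ := GRing.Zmodule_isNzRing.Build dualalg
  dual_mulA dual_mul1 dual_mulr1 dual_mulDl dual_mulDr dual_one_neq0.

Fact dual_scalerAl (a : K) (x y : dualalg) : a *: (x * y) = (a *: x) * y.
Proof. by apply: dual_eqP. Qed.
HB.instance Definition _ :=
  GRing.Lmodule_isLalgebra.Build K dualalg dual_scalerAl.

Fact dual_scalerAr (a : K) (x y : dualalg) : a *: (x * y) = x * (a *: y).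
Proof.
apply: dual_eqP => f; rewrite -[LHS]/(a *: x _) -linearZ; congr (x _).
by apply: val_inj; apply/funext.
Qed.
HB.instance Definition _ :=
  GRing.Lalgebra_isAlgebra.Build K dualalg dual_scalerAr.

End DualAlgebra.

Section CellularBasis.
Variables (K : fieldType) (A : algType K).
Variables (disp : Order.disp_t) (L : finPOrderType disp).

(* Graham and Lehrer's definition: products are computed modulo A(< l).  *)
Record cellular_basis := CellularBasis {
  cell_ix : L -> finType;
  cell_elt : forall l, cell_ix l -> cell_ix l -> A;
  cell_basisP : forall x : A,
    exists! c : {ffun {l : L & (cell_ix l * cell_ix l)%type} -> K},
      x = \sum_p c p *: cell_elt (tagged p).1 (tagged p).2;
  cell_star : {linear A -> A};
  cell_starE : forall l (S T : cell_ix l),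
    cell_star (cell_elt S T) = cell_elt T S;
  cell_starM : forall x y, cell_star (x * y) = cell_star y * cell_star x;
  cell_coef : A -> forall l, cell_ix l -> cell_ix l -> K;
  cell_mulP : forall a l (S T : cell_ix l),
    lin_span [set x | exists k (U V : cell_ix k),
                    (k < l)%O /\ x = cell_elt U V]
      (a * cell_elt S T
         - \sum_(S' : cell_ix l) cell_coef a S' S *: cell_elt S' T) }.

Arguments cell_elt : clear implicits.
Arguments cell_elt c {l} S T.
Arguments cell_coef : clear implicits.
Arguments cell_coef c a {l} S' S.

Variable C : cellular_basis.

Definition cell_module (l : L) := {ffun cell_ix C l -> K^o}.
HB.instance Definition _ l := GRing.Lmodule.on (cell_module l).

Definition cell_act (l : L) (a : A) (w : cell_module l) : cell_module l :=
  [ffun S' => \sum_S cell_coef C a S' S * w S].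

End CellularBasis.
Arguments cell_elt {K A disp L} c {l} S T.
Arguments cell_coef {K A disp L} c a {l} S' S.
Arguments cell_act {K A disp L C l} a w.

(* Invertible matrices over a field that need not be finite.  *)
Record GL (K : fieldType) (n : nat) := MkGL {
  GL_mx :> 'M[K]_n;
  _ : GL_mx \in unitmx }.

Section GeneralLinearGroup.
Variables (K : fieldType) (n : nat).

HB.instance Definition _ := [isSub for @GL_mx K n].
HB.instance Definition _ := [Choice of GL K n by <:].

Lemma GL_unit (g : GL K n) : (g : 'M_n) \in unitmx.
Proof. by case: g. Qed.

Fact GL_one_proof : (1%:M : 'M[K]_n) \in unitmx.
Proof. exact: unitmx1. Qed.
Fact GL_mul_proof (g h : GL K n) : (g : 'M_n) *m h \in unitmx.
Proof. by rewrite unitmx_mul !GL_unit. Qed.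
Fact GL_inv_proof (g : GL K n) : invmx g \in unitmx.
Proof. by rewrite unitmx_inv GL_unit. Qed.
Fact GL_tr_proof (g : GL K n) : (g : 'M_n)^T \in unitmx.
Proof. by rewrite unitmx_tr GL_unit. Qed.

Definition GL_one := MkGL GL_one_proof.
Definition GL_mul g h := MkGL (GL_mul_proof g h).
Definition GL_inv g := MkGL (GL_inv_proof g).
Definition GL_tr g := MkGL (GL_tr_proof g).

Fact GL_mulA : associative GL_mul.
Proof. by move=> x y z; apply: val_inj; apply: mulmxA. Qed.
Fact GL_mul1 : left_id GL_one GL_mul.
Proof. by move=> x; apply: val_inj; apply: mul1mx. Qed.
Fact GL_mulr1 : right_id GL_one GL_mul.
Proof. by move=> x; apply: val_inj; apply: mulmx1. Qed.
Fact GL_mulV : left_inverse GL_one GL_inv GL_mul.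
Proof. by move=> x; apply: val_inj; apply: mulVmx (GL_unit x). Qed.
Fact GL_mulrV : right_inverse GL_one GL_inv GL_mul.
Proof. by move=> x; apply: val_inj; apply: mulmxV (GL_unit x). Qed.

HB.instance Definition _ := isGroup.Build (GL K n)
  GL_mulA GL_mul1 GL_mulr1 GL_mulV GL_mulrV.

Lemma GL_trM (g h : GL K n) : GL_tr (g * h)%g = (GL_tr h * GL_tr g)%g.
Proof. by apply: val_inj; apply: trmx_mul. Qed.

End GeneralLinearGroup.

(* Regular functions on GL(n) are represented by actual functions; this
   represents K[GL(n)] faithfully because an algebraically closed field is
   infinite.                                                               *)
Section RegularFunctions.
Variables (K : closedFieldType) (n : nat).
Local Notation G := (GL K n).
Local Notation fct := (G -> K^o).

Definition coord (i j : 'I_n) : fct := fun g => (g : 'M_n) i j.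
Definition coordV (i j : 'I_n) : fct := fun g => (g^-1%g : 'M_n) i j.
Definition detf : fct := fun g => \det (g : 'M_n).

Definition polyA (d : nat) : set fct :=
  lin_span [set f | exists a : 'I_n -> 'I_n -> nat,
    (\sum_i \sum_j a i j)%N = d /\ f = \prod_i \prod_j coord i j ^+ a i j].

Definition ratA (r s : nat) : set fct :=
  lin_span [set f | exists a b : 'I_n -> 'I_n -> nat,
    [/\ (\sum_i \sum_j a i j)%N = r, (\sum_i \sum_j b i j)%N = s
      & f = (\prod_i \prod_j coord i j ^+ a i j)
              * (\prod_i \prod_j coordV i j ^+ b i j)]].

Lemma polyA_subspace d : is_subspace (polyA d).
Proof. exact: lin_span_subspace. Qed.

Lemma ratA_subspace r s : is_subspace (ratA r s).
Proof. exact: lin_span_subspace. Qed.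

Lemma polyA_ratA d : polyA d = ratA d 0.
Proof.
rewrite /polyA /ratA; congr lin_span; apply/seteqP; split=> f /=.
  move=> [a [sa ->]]; exists a, (fun _ _ => 0%N); split=> //.
    by rewrite big1 // => i _; rewrite big1.
  by rewrite [X in _ = _ * X]big1 ?mulr1 // => i _; rewrite big1.
move=> [a [b [sa /eqP sb ->]]]; exists a; split=> //.
rewrite [X in _ * X = _]big1 ?mulr1 // => i _; rewrite big1 // => j _.
move: sb; rewrite sum_nat_eq0 => /forallP/(_ i).
by rewrite sum_nat_eq0 => /forallP/(_ j) /eqP ->.
Qed.

Lemma ratA_ind (P : nat -> nat -> fct -> Prop) :
    (forall r s, is_subspace (P r s)) ->
    P 0 0 1 ->
    (forall r s r' s' f f', P r s f -> P r' s' f' ->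
       P (r + r')%N (s + s')%N (f * f')) ->
    (forall i j, P 1 0 (coord i j)) -> (forall i j, P 0 1 (coordV i j)) ->
  forall r s f, ratA r s f -> P r s f.
Proof.
move=> Psub P1 PM Pc Pd r s.
apply: lin_span_min => [|_ [a [b [<- <- ->]]]]; first exact: Psub.
have PX u v f k : P u v f -> P (u * k)%N (v * k)%N (f ^+ k).
  move=> Pf; elim: k => [|k IH]; first by rewrite !muln0.
  by rewrite !mulnS exprS; apply: PM.
have Pprod u v (I : finType) (F : I -> fct) (e : I -> nat) :
    (forall i, P (u * e i)%N (v * e i)%N (F i)) ->
    P (u * \sum_i e i)%N (v * \sum_i e i)%N (\prod_i F i).
  move=> PF; elim/big_rec2: _ => [|i f t _ Pf]; first by rewrite !muln0.
  by rewrite !mulnDr; apply: PM.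
rewrite -[X in P X _]addn0 -[X in P _ X]add0n; apply: PM.
  rewrite -[X in P X _]mul1n -[X in P _ X](mul0n (\sum_i \sum_j a i j)%N).
  by apply: (Pprod 1%N 0%N) => i; apply: (Pprod 1%N 0%N) => j; apply: (PX 1%N 0%N).
rewrite -[X in P _ X]mul1n -[X in P X _](mul0n (\sum_i \sum_j b i j)%N).
by apply: (Pprod 0%N 1%N) => i; apply: (Pprod 0%N 1%N) => j; apply: (PX 0%N 1%N).
Qed.

Lemma ratA_mul r s r' s' f f' :
  ratA r s f -> ratA r' s' f' -> ratA (r + r') (s + s') (f * f').
Proof.
have LW (W : set fct) (w : fct) : is_subspace W -> is_subspace [set u | W (u * w)].
  move=> [W0 WL]; split; first by rewrite /= mul0r.
  move=> c u v Wu Wv; have := WL c _ _ Wu Wv; rewrite /= => {Wu Wv}.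
  by congr W; apply/funext => g; rewrite -[RHS]/((c * u g + v g) * w g) mulrDl -mulrA.
have LW' (W : set fct) (w : fct) : is_subspace W -> is_subspace [set u | W (w * u)].
  move=> HW; have := LW W w HW; congr is_subspace; apply/funext => u /=.
  by congr W; apply: mulrC.
move=> Af Af'; move: f Af.
apply: (@lin_span_min _ _ _ [set u | ratA (r + r') (s + s') (u * f')]).
  exact/LW/lin_span_subspace.
move=> _ [a [b [sa sb ->]]] /=; move: f' Af'.
apply: (@lin_span_min _ _ _ [set u | ratA (r + r') (s + s') (_ * u)]).
  exact/LW'/lin_span_subspace.
move=> _ [a' [b' [sa' sb' ->]]] /=; apply: lin_span_incl.
exists (fun i j => a i j + a' i j)%N, (fun i j => b i j + b' i j)%N; split.
- rewrite -sa -sa' -big_split; apply: eq_bigr => i _; exact: big_split.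
- rewrite -sb -sb' -big_split; apply: eq_bigr => i _; exact: big_split.
- rewrite mulrACA -2!big_split /=; congr (@GRing.mul _ _ _);
  apply: eq_bigr => i _; rewrite -big_split /=;
  by apply: eq_bigr => j _; rewrite exprD.
Qed.

Lemma ratA1 : ratA 0 0 1.
Proof.
apply: lin_span_incl; exists (fun _ _ => 0%N), (fun _ _ => 0%N).
split; try by rewrite big1 // => i _; rewrite big1.
by rewrite !big1 ?mulr1 // => i _; rewrite big1.
Qed.

Fact delta_sum (i j : 'I_n) :
  (\sum_k \sum_l ((k == i) && (l == j) : nat))%N = 1%N.
Proof.
rewrite (bigD1 i) //= [X in (_ + X)%N]big1 => [|k /negPf ki]; last first.
  by rewrite big1 // => l _; rewrite ki.
by rewrite addn0 (bigD1 j) //= !eqxx big1 // => l /negPf ->; rewrite andbF.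
Qed.

Fact delta_prod (F : 'I_n -> 'I_n -> fct) (i j : 'I_n) :
  \prod_k \prod_l F k l ^+ ((k == i) && (l == j) : nat) = F i j.
Proof.
rewrite (bigD1 i) //= [X in (_ * X)]big1 => [|k /negPf ki]; last first.
  by rewrite big1 // => l _; rewrite ki.
by rewrite mulr1 (bigD1 j) //= !eqxx big1 ?mulr1 // => l /negPf ->; rewrite andbF.
Qed.

Lemma ratA_coord i j : ratA 1 0 (coord i j).
Proof.
apply: lin_span_incl; exists (fun k l => (k == i) && (l == j) : nat), (fun _ _ => 0%N).
split; rewrite ?delta_sum //; first by rewrite big1 // => k _; rewrite big1.
by rewrite delta_prod [X in _ * X]big1 ?mulr1 // => k _; rewrite big1.
Qed.

Lemma ratA_coordV i j : ratA 0 1 (coordV i j).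
Proof.
apply: lin_span_incl; exists (fun _ _ => 0%N), (fun k l => (k == i) && (l == j) : nat).
split; rewrite ?delta_sum //; first by rewrite big1 // => k _; rewrite big1.
by rewrite delta_prod [X in X * _]big1 ?mul1r // => k _; rewrite big1.
Qed.

Lemma ratA_exp r s f k : ratA r s f -> ratA (r * k) (s * k) (f ^+ k).
Proof.
move=> Af; elim: k => [|k IH]; first by rewrite !muln0; apply: ratA1.
by rewrite !mulnS exprS; apply: ratA_mul.
Qed.

Lemma ratA_prod (I : finType) (F : I -> fct) :
  (forall i, ratA 1 0 (F i)) -> ratA #|I| 0 (\prod_i F i).
Proof.
move=> AF; rewrite -sum1_card.
elim/big_rec2: _ => [|i f t _ Af]; first exact: ratA1.
exact: (ratA_mul (AF i) Af).
Qed.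

Lemma ratA_comul r s f : ratA r s f ->
  exists (I : finType) (f1 f2 : I -> fct),
    [/\ forall i, ratA r s (f1 i), forall i, ratA r s (f2 i)
      & forall g h, f (g * h)%g = \sum_i f1 i g * f2 i h].
Proof.
move: r s f; apply: ratA_ind => [r s||r s r' s' f f'|i j|i j].
- have [A0 AL] := ratA_subspace r s; split.
    exists void, (fun=> 0), (fun=> 0); split; [case|case|].
    by move=> g h; rewrite big1 // => -[].
  move=> c u v [I [u1 [u2 [A1 A2 Eu]]]] [J [v1 [v2 [B1 B2 Ev]]]].
  exists (I + J)%type.
  exists (fun k => match k with inl i => c *: u1 i | inr j => v1 j end).
  exists (fun k => match k with inl i => u2 i | inr j => v2 j end).
  split; [case=> // i | by case |].
    by rewrite -[_ *: _]addr0; apply: AL.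
  move=> g h; rewrite big_sumType /= -[LHS]/(c *: u (g * h)%g + v (g * h)%g).
  by rewrite Eu Ev scaler_sumr; congr (_ + _); apply: eq_bigr => i _; rewrite scalerAl.
- exists unit, (fun=> 1), (fun=> 1); split; try by move=> _; apply: ratA1.
  by move=> g h; rewrite (bigD1 tt) //= big1 ?addr0; [rewrite -[RHS]/(1 * 1) mulr1|case].
- move=> [I [u1 [u2 [A1 A2 Eu]]]] [J [v1 [v2 [B1 B2 Ev]]]].
  exists (I * J)%type, (fun k => u1 k.1 * v1 k.2), (fun k => u2 k.1 * v2 k.2).
  split; try by move=> k; apply: ratA_mul.
  move=> g h; rewrite -[LHS]/(f (g * h)%g * f' (g * h)%g) Eu Ev.
  rewrite big_distrlr /= pair_big /=; apply: eq_bigr => k _.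
  by rewrite -[RHS]/(_ g * _ g * (_ h * _ h)) mulrACA.
- exists 'I_n, (coord i), (coord^~ j).
  split; [move=> k; exact: ratA_coord | move=> k; exact: ratA_coord |].
  by move=> g h; rewrite /coord mxE.
- exists 'I_n, (coordV^~ j), (coordV i).
  split; [move=> k; exact: ratA_coordV | move=> k; exact: ratA_coordV |].
  by move=> g h; rewrite /coordV invgM mxE; apply: eq_bigr => k _; rewrite mulrC.
Qed.

Lemma ratA_tr r s f : ratA r s f -> ratA r s (f \o @GL_tr K n).
Proof.
move: r s f; apply: ratA_ind => [r s||r s r' s' f f'|i j|i j].
- have [A0 AL] := ratA_subspace r s.
  by split=> [|c u v]; [apply: A0|apply: AL].
- exact: ratA1.
- exact: ratA_mul.
- have -> : coord i j \o @GL_tr K n = coord j i.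
    by apply/funext => g; rewrite /coord /= mxE.
  exact: ratA_coord.
- have -> : coordV i j \o @GL_tr K n = coordV j i.
    apply/funext => g; rewrite /coordV /=.
    by rewrite -[LHS]/(invmx (GL_mx g)^T i j) -trmx_inv mxE.
  exact: ratA_coordV.
Qed.

Lemma det_coordV i j : ratA n.-1 0 (detf * coordV i j).
Proof.
have -> : detf * coordV i j =
    (-1) ^+ (j + i) *: \sum_(p : 'S_n.-1)
      (-1) ^+ p *: \prod_k coord (lift j k) (lift i (p k)).
  apply/funext => g; rewrite -[LHS]/(\det (g : 'M_n) * (invmx g) i j).
  rewrite /invmx GL_unit mxE mulrA mulfV ?mul1r; last first.
    by rewrite -unitfE -unitmxE GL_unit.
  rewrite mxE -[RHS]/((-1) ^+ (j + i) * (\sum_(p : 'S_n.-1) _ : fct) g).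
  congr (_ * _); rewrite fct_sumE; apply: eq_bigr => p _.
  rewrite -[RHS]/((-1) ^+ p * (\prod_k _ : fct) g); congr (_ * _).
  by rewrite fct_prodE; apply: eq_bigr => k _; rewrite !mxE.
have [A0 AL] := ratA_subspace n.-1 0.
have AZ c f : ratA n.-1 0 f -> ratA n.-1 0 (c *: f).
  by move=> Af; rewrite -[_ *: _]addr0; apply: AL.
apply: AZ; elim/big_rec: _ => // p f _ Af; apply: AL => //.
by rewrite -[X in ratA X]card_ord; apply: ratA_prod => k; apply: ratA_coord.
Qed.

Lemma ratA_det r s f : ratA r s f -> polyA (r + n.-1 * s) (detf ^+ s * f).
Proof.
rewrite polyA_ratA; move: r s f; apply: ratA_ind => [r s||r s r' s' f f'|i j|i j].
- have [A0 AL] := ratA_subspace (r + n.-1 * s) 0.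
  split=> [|c u v /= Au Av]; first by rewrite /= mulr0; apply: A0.
  rewrite mulrDr -[X in _ (X + _)]/(detf ^+ s * (c *: u)).
  have -> : detf ^+ s * (c *: u) = c *: (detf ^+ s * u).
    by apply/funext => g; rewrite -[LHS]/(_ * (c * _)) mulrCA.
  exact: AL.
- by rewrite muln0 expr0 mulr1; apply: ratA1.
- move=> Af Af'; rewrite mulnDr addnACA exprD mulrACA.
  exact: (ratA_mul Af Af').
- by rewrite muln0 addn0 expr0 mul1r; apply: ratA_coord.
- by rewrite muln1 add0n expr1; apply: det_coordV.
Qed.

End RegularFunctions.

Section SchurAlgebras.
Variables (K : closedFieldType) (n : nat).
Hypothesis n_gt0 : (0 < n)%N.
Local Notation G := (GL K n).
Local Notation fct := (G -> K^o).

Fact ratA_neq0 r s : exists2 f : fct, ratA r s f & f 1%g != 0.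
Proof.
pose i0 := Ordinal n_gt0.
exists (coord i0 i0 ^+ r * coordV i0 i0 ^+ s).
  have := ratA_mul (ratA_exp r (ratA_coord K i0 i0))
                   (ratA_exp s (ratA_coordV K i0 i0)).
  by rewrite !mul1n !mul0n addn0 add0n.
have EX (f : fct) k : (f ^+ k) 1%g = f 1%g ^+ k.
  by elim: k => // k IH; rewrite !exprS -IH.
rewrite -[X in X != _]/((coord i0 i0 ^+ r) 1%g * (coordV i0 i0 ^+ s) 1%g).
by rewrite !EX /coord /coordV invg1 mxE eqxx !expr1n mulr1 oner_eq0.
Qed.

Fact polyA_comul d f : polyA d f ->
  exists (I : finType) (f1 f2 : I -> fct),
    [/\ forall i, polyA d (f1 i), forall i, polyA d (f2 i)
      & forall g h, f (g * h)%g = \sum_i f1 i g * f2 i h].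
Proof. by rewrite polyA_ratA; apply: ratA_comul. Qed.

Fact polyA_neq0 d : exists2 f : fct, polyA d f & f 1%g != 0.
Proof. by rewrite polyA_ratA; apply: ratA_neq0. Qed.

Definition poly_coalg (d : nat) : subcoalg K G :=
  Subcoalg (coalg_sub := Subspace (@polyA_subspace K n d))
    (@polyA_comul d) (@polyA_neq0 d).

Definition rat_coalg (r s : nat) : subcoalg K G :=
  Subcoalg (coalg_sub := Subspace (@ratA_subspace K n r s))
    (@ratA_comul K n r s) (@ratA_neq0 r s).

Local Notation schur d := (dualalg (poly_coalg d)).
Local Notation rat_schur r s := (dualalg (rat_coalg r s)).

Section Quotient.
Variables r s : nat.
Local Notation d := (r + n.-1 * s)%N.

Definition mul_det (f : subsp (rat_coalg r s)) : subsp (poly_coalg d) :=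
  @in_subsp K _ (poly_coalg d) _ (ratA_det (subspP f)).

Lemma mul_detE f : subsp_val (mul_det f) = @detf K n ^+ s * subsp_val f.
Proof. by []. Qed.

Lemma mul_det_linear : linear mul_det.
Proof.
move=> c u v; apply: subsp_eqP; rewrite subsp_valP !mul_detE subsp_valP.
rewrite mulrDr; congr (_ + _); apply/funext => g.
exact: mulrCA.
Qed.

Fact schur_quot_linear (x : schur d) : linear (fun f => x (mul_det f)).
Proof. by move=> c u v; rewrite mul_det_linear linearP. Qed.

(* Dual to the injection A(n,r,s) -> A(n,r+(n-1)s), f |-> D^s f.  *)
Definition schur_quot (x : schur d) : rat_schur r s :=
  mk_dual (schur_quot_linear x).

Fact schur_quotP : linear schur_quot.
Proof. by move=> c x y; apply: dual_eqP. Qed.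

Fact detf_X1 k : (@detf K n ^+ k) 1%g = 1.
Proof.
elim: k => // k IH; rewrite exprS -[LHS]/(@detf K n 1%g * (@detf K n ^+ k) 1%g).
by rewrite IH /detf det1 mulr1.
Qed.

Fact detf_XM k g h :
  (@detf K n ^+ k) (g * h)%g = (@detf K n ^+ k) g * (@detf K n ^+ k) h.
Proof.
elim: k => [|k IH]; first by rewrite -[RHS]/(1 * 1) mulr1.
rewrite exprS -[LHS]/(@detf K n (g * h)%g * (@detf K n ^+ k) (g * h)%g) IH.
by rewrite /detf det_mulmx mulrACA.
Qed.

Fact schur_quot1 : schur_quot 1 = 1.
Proof.
apply: dual_eqP => f.
rewrite -[RHS]/(subsp_val f 1%g) -[LHS]/(subsp_val (mul_det f) 1%g) mul_detE.
by rewrite -[LHS]/((@detf K n ^+ s) 1%g * subsp_val f 1%g) detf_X1 mul1r.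
Qed.

Fact schur_quotM (x y : schur d) :
  schur_quot (x * y) = schur_quot x * schur_quot y.
Proof.
apply: dual_eqP => f; rewrite -[LHS]/(x (dual_act y (mul_det f))).
rewrite -[RHS]/(x (mul_det (dual_act (schur_quot y) f))); congr (x _).
apply: subsp_eqP; apply/funext => g; rewrite mul_detE.
rewrite -[LHS]/(y (ltrans g (mul_det f))).
rewrite -[RHS]/((@detf K n ^+ s) g * y (mul_det (ltrans g f))).
have -> : ltrans g (mul_det f) =
    ((@detf K n ^+ s) g : K) *: mul_det (ltrans g f).
  apply: subsp_eqP; apply/funext => h.
  rewrite -[LHS]/((@detf K n ^+ s) (g * h)%g * subsp_val f (g * h)%g).
  by rewrite detf_XM -mulrA.
by rewrite linearZ.
Qed.

HB.instance Definition _ :=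
  GRing.isLinear.Build K (schur d) (rat_schur r s) _ schur_quot schur_quotP.
HB.instance Definition _ :=
  GRing.isMonoidMorphism.Build (schur d) (rat_schur r s) schur_quot
    (conj schur_quot1 schur_quotM).

End Quotient.
End SchurAlgebras.
Arguments schur_quot {K n} n_gt0 r s x.

(* Lambda^+(n,d): the sum condition bounds every part by d, whence the
   encoding by {ffun 'I_n -> 'I_d.+1}.                                 *)
Section DominantWeights.
Variables n d : nat.

Definition is_dominant (w : {ffun 'I_n -> 'I_d.+1}) : bool :=
  [forall i : 'I_n, forall j : 'I_n, (i <= j)%N ==> (w j <= w i)%N]
    && (\sum_i w i == d :> nat)%N.

Record dom_weight := DomWeight {
  dw_ffun : {ffun 'I_n -> 'I_d.+1};
  _ : is_dominant dw_ffun }.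

HB.instance Definition _ := [isSub for dw_ffun].
HB.instance Definition _ := [Finite of dom_weight by <:].

Definition dw_fun (w : dom_weight) (i : 'I_n) : nat := dw_ffun w i.

Definition dominates (k l : dom_weight) : bool :=
  [forall j : 'I_n,
    (\sum_(i < n | i <= j) dw_fun l i <= \sum_(i < n | i <= j) dw_fun k i)%N].

Fact dominates_refl : reflexive dominates.
Proof. by move=> k; apply/forallP => j. Qed.

Fact dominates_trans : transitive dominates.
Proof.
move=> k l m /forallP lk /forallP km; apply/forallP => j.
exact: leq_trans (km j) (lk j).
Qed.

Fact dominates_anti : antisymmetric dominates.
Proof.
move=> k l /andP[/forallP kl /forallP lk].
have E (j : 'I_n) :
    (\sum_(i < n | i <= j) dw_fun k i = \sum_(i < n | i <= j) dw_fun l i)%N.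
  by apply/eqP; rewrite eqn_leq kl lk.
apply: val_inj; apply/ffunP => j; apply: val_inj => /=.
have Elt : (\sum_(i < n | i < j) dw_fun k i = \sum_(i < n | i < j) dw_fun l i)%N.
  case: j => -[|j] jn /=; first by rewrite !big_pred0.
  exact: (E (Ordinal (ltnW jn))).
have step (w : dom_weight) : (\sum_(i < n | i <= j) dw_fun w i
    = dw_fun w j + \sum_(i < n | i < j) dw_fun w i)%N.
  rewrite (bigD1 j) //=; congr (_ + _)%N; apply: eq_bigl => i.
  by rewrite andbC -ltn_neqAle.
by have := E j; rewrite !step Elt => /addIn.
Qed.

Fact revdom_display : Order.disp_t. Proof. exact: Order.Disp tt tt. Qed.

(* The reverse dominance order: k <= l when k dominates l, so that
   k < l means that k strictly dominates l.                         *)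
HB.instance Definition _ := Order.Le_isPOrder.Build revdom_display dom_weight
  dominates_refl dominates_anti dominates_trans.

End DominantWeights.
Coercion dw_fun : dom_weight >-> Funclass.

Lemma dom_weight_leE n d (k l : dom_weight n d) :
  (k <= l)%O = [forall j : 'I_n,
    (\sum_(i < n | i <= j) l i <= \sum_(i < n | i <= j) k i)%N].
Proof. by []. Qed.

Section WeylModules.
Variables (K : closedFieldType) (n : nat) (n_gt0 : (0 < n)%N) (d : nat).
Local Notation A := (poly_coalg K n_gt0 d).
Local Notation schur := (dualalg A).

Fact polyA_tr f : polyA d f -> polyA d (f \o @GL_tr K n).
Proof. by rewrite polyA_ratA; apply: ratA_tr. Qed.

Definition polyA_transp (f : subsp A) : subsp A :=
  @in_subsp K _ A _ (polyA_tr (subspP f)).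

Fact schur_transp_linear (x : schur) : linear (fun f => x (polyA_transp f)).
Proof.
move=> c u v; rewrite -linearP; congr (x _).
by apply: subsp_eqP; apply/funext.
Qed.
Definition schur_transp (x : schur) : schur := mk_dual (schur_transp_linear x).

Lemma schur_transpM x y :
  schur_transp (x * y) = schur_transp y * schur_transp x.
Proof.
apply: dual_eqP => f.
have [I [f1 [f2 [A1 A2 E]]]] := coalg_comulP (subspP (polyA_transp f)).
pose F1 i : subsp A := in_subsp (A1 i); pose F2 i : subsp A := in_subsp (A2 i).
rewrite -[LHS]/(dual_mul x y (polyA_transp f)) (@dual_mulE _ _ _ _ _ _ I F1 F2) //.
rewrite -[RHS]/(dual_mul (schur_transp y) (schur_transp x) f).
rewrite (@dual_mulE _ _ _ _ _ _ I (polyA_transp \o F2) (polyA_transp \o F1)).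
  have trK (u : subsp A) : polyA_transp (polyA_transp u) = u.
    apply: subsp_eqP; apply/funext => g /=; congr (subsp_val u _).
    by apply: val_inj; apply: trmxK.
  apply: eq_bigr => i _; rewrite mulrC.
  by rewrite -{1}[F1 i]trK -{1}[F2 i]trK.
move=> g h.
have -> : subsp_val f (g * h)%g = subsp_val (polyA_transp f) (GL_tr h * GL_tr g)%g.
  rewrite -GL_trM /=; congr (subsp_val f _).
  by apply: val_inj; rewrite /= trmxK.
by rewrite E; apply: eq_bigr => i _; rewrite mulrC.
Qed.

Variable l : dom_weight n d.

Definition is_induced (f : subsp A) : Prop :=
  forall b g : GL K n, is_trig_mx (b : 'M_n) ->
    subsp_val f (b * g)%g = (\prod_i (b : 'M_n) i i ^+ l i) * subsp_val f g.

Fact is_induced_subspace : is_subspace [set f | is_induced f].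
Proof.
split=> [b g _|c u v Iu Iv b g Tb]; first by rewrite -[RHS]/(_ * 0) mulr0.
rewrite !subsp_valP -[LHS]/(c * _ + _) Iu // Iv //.
by rewrite mulrCA -mulrDr.
Qed.

(* The induced module of highest weight l: functions f with f(bg) = l(b) f(g)
   for b in the negative (lower triangular) Borel subgroup, under right
   translation. For l in Lambda^+(n,d) they all lie in A(n,d).               *)
Definition nabla := subsp (Subspace is_induced_subspace).

Fact nabla_act_proof (x : schur) (f : nabla) :
  is_induced (dual_act x (subsp_val f)).
Proof.
move=> b g Tb; set lb : K := \prod_i _.
rewrite -[LHS]/(x (ltrans (b * g)%g (subsp_val f))).
rewrite -[RHS]/(lb *: x (ltrans g (subsp_val f))) -linearZ; congr (x _).
apply: subsp_eqP; apply/funext => h.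
rewrite -[LHS]/(subsp_val (subsp_val f) (b * g * h)%g) -mulgA.
exact: (subspP f b (g * h)%g Tb).
Qed.

Definition nabla_act (x : schur) (f : nabla) : nabla :=
  @in_subsp K _ (Subspace is_induced_subspace) _ (nabla_act_proof x f).

Lemma nabla_act_linear x : linear (nabla_act x).
Proof. by move=> c u v; apply: subsp_eqP; apply: dual_act_linear. Qed.

(* The Weyl module is the contravariant dual of nabla: the linear dual, with
   action twisted by the transposition anti-automorphism.                   *)
Definition weyl := lin_dual nabla.
HB.instance Definition _ := GRing.Lmodule.on weyl.
Identity Coercion dual_of_weyl : weyl >-> lin_dual.

Fact weyl_act_linear (x : schur) (phi : weyl) :
  linear (fun f => phi (nabla_act (schur_transp x) f)).
Proof. by move=> c u v; rewrite nabla_act_linear linearP. Qed.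

Definition weyl_act (x : schur) (phi : weyl) : weyl :=
  mk_dual (weyl_act_linear x phi).

Lemma weyl_act_mul x y phi :
  weyl_act (x * y) phi = weyl_act x (weyl_act y phi).
Proof.
apply: dual_eqP => f; rewrite -[LHS]/(phi _) -[RHS]/(phi _); congr (phi _).
apply: subsp_eqP; rewrite -[LHS]/(dual_act _ (subsp_val f)) schur_transpM.
exact: dual_act_mul.
Qed.

End WeylModules.

Definition cell_module_iso_weyl (K : closedFieldType) (n : nat)
    (n_gt0 : (0 < n)%N) (d : nat) (l : dom_weight n d)
    (C : cellular_basis (dualalg (poly_coalg K n_gt0 d)) (dom_weight n d)) :
    Prop :=
  exists phi : {linear cell_module C l -> weyl K n_gt0 l},
    bijective phi /\
    forall a w, phi (cell_act a w) = weyl_act a (phi w).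

Definition Rplus (n d s : nat) (mu : dom_weight n d) : {set 'I_n} :=
  [set i | (s < mu i)%N]%SET.

(* Main.v *)
Require Import Defs.
From HB Require Import structures.
From mathcomp Require Import all_boot all_order all_algebra perm.
From mathcomp Require Import boolp classical_sets functions zify ring.

(** Write d = r + (n-1)s. The dual of the quotient map embeds A(n,r,s) in A(n,d)
    as the functions det^s h, so its kernel consists of the x that vanish on
    these. Call sum_i max(mu_i - s, 0) the excess of a weight mu; the condition
    on mu in the theorem says that its excess is larger than r. Call a function
    in A(n,d) truncated if no dominant weight of excess larger than r occurs in
    the sub-bimodule that it generates. Both the image of A(n,r,s) and the common
    zeros of the cells of excess larger than r turn out to be the truncated
    functions. As A(n,d) is finite-dimensional, a subspace of its dual is
    determined by its common zeros, and the theorem follows.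

    Multiples of det^s are truncated ([det_multiple_killed]): restrict a
    translate of det^s h to a suitable one-parameter subgroup of the torus and
    compare degrees.

    Truncated functions are multiples of det^s ([truncated_det_multiple]). Let
    lambda be the highest weight in the bimodule generated by f. The components
    of f at weight lambda lie on either side in an induced module, which is
    spanned by bideterminants ([induced_bidet_span]), so that subtracting
    bideterminants of shape lambda from f removes lambda ([subtract_top]).
    Those bideterminants are products of minors along the columns of lambda.
    Dividing the first s of these minors by det and applying Jacobi's
    complementary minor identity shows that they are multiples of det^s as
    soon as lambda has excess at most r ([bidet_det_multiple]).

    That bideterminants span the induced module is proved with least monomials.
    An element f of the induced module is invariant under adding a row to a
    later one, and this forces the exponents of its least monomial to satisfy a
    ballot condition ([ballot]). Such exponents are those of the diagonal
    monomial of a bideterminant with strictly increasing columns, which is the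
    least monomial of that bideterminant, and a multiple of it can be subtracted.

    On the side of the cells, let mu have excess larger than r. Acting on a
    truncated f by the elements C_(S,T) of the cell mu with T fixed is, by
    induction along the dominance order, a homomorphism from the Weyl module of
    mu to the truncated functions. It kills the generating vector of weight mu,
    hence is zero ([cell_truncated]). Conversely, let k be a weight of excess
    larger than r. Its idempotent acts by zero on the Weyl modules of excess at
    most r, since the corresponding induced modules consist of multiples of
    det^s. It therefore lies in the ideal spanned by the cells of excess larger
    than r ([xi_large]), and a function that is killed by these cells is
    truncated. *)

Set Implicit Arguments.
Unset Strict Implicit.
Unset Printing Implicit Defensive.
Import Order.TTheory GRing.Theory.
Local Open Scope ring_scope.

(** * Numerals as a monomial order *)

Section Digits.
Variables (I : finType) (pos : I -> nat) (N : nat).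
Hypothesis pos_inj : injective pos.
Hypothesis N_gt0 : (0 < N)%N.
Implicit Types (a b : I -> nat) (p : nat).

(** Exponents are read as the digits of an integer in base N, so that the
    lexicographic order on monomials becomes the order of the integers, and
    the weight of a monomial is additive. Only the places from p upwards are
    counted. *)
Definition digit_sum p a := (\sum_(i | p <= pos i) a i * N ^ pos i)%N.

Lemma digit_sum_step a i :
  digit_sum (pos i) a = (a i * N ^ pos i + digit_sum (pos i).+1 a)%N.
Proof.
rewrite /digit_sum (bigD1 i) //=; congr addn; apply: eq_bigl => k.
by rewrite [RHS]ltn_neqAle andbC eq_sym (inj_eq pos_inj).
Qed.

Lemma digit_sum_dvd p a : (N ^ p %| digit_sum p a)%N.
Proof. by apply: dvdn_sum => i pi; apply: dvdn_mull; apply: dvdn_exp2l. Qed.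

Lemma low_digits_lt p a : (forall i, a i < N)%N ->
  (\sum_(i | pos i < p) a i * N ^ pos i < N ^ p)%N.
Proof.
move=> aN; elim: p => [|p IH]; first by rewrite big_pred0.
rewrite (bigID (fun i => pos i == p)) /= addnC.
rewrite (eq_bigl (fun i => pos i < p)%N); last first.
  by move=> i; rewrite ltnS [RHS]ltn_neqAle andbC.
have top : (\sum_(i | (pos i < p.+1) && (pos i == p)) a i * N ^ pos i
            <= N.-1 * N ^ p)%N.
  case: (pickP (fun i => pos i == p)) => [i /eqP ip|none]; last first.
    by rewrite big_pred0 // => i; rewrite none andbF.
  rewrite (big_pred1 i) => [|k]; last first.
    by rewrite -ip (inj_eq pos_inj) andb_idl //= => /eqP ->; rewrite ltnSn.
  by rewrite ip leq_mul2r -ltnS (prednK N_gt0) aN orbT.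
rewrite expnS -[X in (_ < X * _)%N](prednK N_gt0) mulSn.
by rewrite -addSn leq_add.
Qed.

Lemma digit_sum_split p a :
  digit_sum 0 a = (digit_sum p a + \sum_(i | pos i < p) a i * N ^ pos i)%N.
Proof.
rewrite /digit_sum (bigID (fun i => p <= pos i)%N) /=; congr addn.
by apply: eq_bigl => i; rewrite ltnNge.
Qed.

(** Dropping the places below p amounts to dividing by N ^ p. *)
Lemma digit_sum_mono p a b : (forall i, a i < N)%N -> (forall i, b i < N)%N ->
  (digit_sum 0 a <= digit_sum 0 b)%N -> (digit_sum p a <= digit_sum p b)%N.
Proof.
move=> aN bN; rewrite !(digit_sum_split p).
have /dvdnP[A ->] := digit_sum_dvd p a; have /dvdnP[B ->] := digit_sum_dvd p b.
have := low_digits_lt p bN; set lb := bigop _ _ _; set la := bigop _ _ _.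
move=> lbN leab; rewrite leq_mul2r; apply/orP; right.
rewrite leqNgt; apply/negP => BA.
have : (B.+1 * N ^ p <= A * N ^ p)%N by rewrite leq_mul2r BA orbT.
by rewrite mulSn; lia.
Qed.

Lemma digit_le a b i : (forall i, a i < N)%N -> (forall i, b i < N)%N ->
  (digit_sum 0 a <= digit_sum 0 b)%N ->
  digit_sum (pos i).+1 a = digit_sum (pos i).+1 b -> (a i <= b i)%N.
Proof.
move=> aN bN /(digit_sum_mono (pos i) aN bN) leab eqhi; move: leab.
by rewrite !digit_sum_step eqhi leq_add2r leq_pmul2r // expn_gt0 N_gt0.
Qed.

Lemma digit_sum_inj p a b : (forall i, a i < N)%N -> (forall i, b i < N)%N ->
  digit_sum p a = digit_sum p b -> forall i, (p <= pos i)%N -> a i = b i.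
Proof.
move=> aN bN ab i pi.
pose trunc c k := (if (p <= pos k)%N then c k else 0)%N.
have truncE c q : (p <= q)%N -> digit_sum q (trunc c) = digit_sum q c.
  by move=> pq; apply: eq_bigr => k qk; rewrite /trunc (leq_trans pq qk).
have trunc0 c : digit_sum 0 (trunc c) = digit_sum p c.
  rewrite (digit_sum_split p) truncE // [X in (_ + X)%N]big1 ?addn0 // => k.
  by rewrite ltnNge /trunc => /negPf ->.
have tN c : (forall k, c k < N)%N -> forall k, (trunc c k < N)%N.
  by move=> cN k; rewrite /trunc; case: ifP.
have same q : (p <= q)%N -> digit_sum q a = digit_sum q b.
  move=> pq; rewrite -(truncE a) // -(truncE b) //; apply/eqP; rewrite eqn_leq.
  by apply/andP; split; apply: digit_sum_mono; rewrite ?trunc0 ?ab //; apply: tN.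
have := same _ pi; rewrite !digit_sum_step same ?(leq_trans pi) // => /addIn/eqP.
by rewrite eqn_pmul2r ?expn_gt0 ?N_gt0 // => /eqP.
Qed.

End Digits.

(** * Polynomial functions over an infinite field *)

Section InfiniteField.
Variable K : closedFieldType.

(** If p vanished everywhere, 1 + p X would be constant at 1: over an
    algebraically closed field this forces it to be a constant polynomial. *)
Lemma poly_eq0_all (p : {poly K}) : (forall z, p.[z] = 0) -> p = 0.
Proof.
move=> p0; apply: contraTeq isT => pN0.
have : size (p * 'X + 1) != 1%N.
  by rewrite size_MXaddC (negPf pN0) /= eqSS size_poly_eq0.
move/closed_rootP => [z /rootP].
by rewrite !hornerE p0 mul0r add0r => /eqP; rewrite oner_eq0.
Qed.

Lemma poly_eq0_all_eq (p q : {poly K}) : (forall z, p.[z] = q.[z]) -> p = q.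
Proof.
move=> pq; apply/eqP; rewrite -subr_eq0; apply/eqP/poly_eq0_all => z.
by rewrite hornerD hornerN pq subrr.
Qed.

Lemma poly_eq0_open (p q : {poly K}) : q != 0 ->
  (forall z, q.[z] != 0 -> p.[z] = 0) -> p = 0.
Proof.
move=> q0 pq; apply/eqP; have: p * q == 0.
  apply/eqP/poly_eq0_all => z; rewrite hornerM.
  by case: (eqVneq q.[z] 0) => [->|/pq ->]; rewrite ?mulr0 ?mul0r.
by rewrite mulf_eq0 (negPf q0) orbF.
Qed.

(** On the line x + z the matrix is invertible except at the finitely many
    roots of a characteristic polynomial, and a polynomial in z that vanishes
    at all other points is zero at z = 0 as well. *)
Lemma unitmx_dense n (F : 'M[K]_n -> K) (q : {poly K}) (x : 'M[K]_n) :
  (forall z, F (x + z%:M) = q.[z]) -> (forall y, y \in unitmx -> F y = 0) ->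
  F x = 0.
Proof.
move=> Fq F0; suff q0 : q = 0 by rewrite -[x]addr0 -(raddf0 (@scalar_mx K n)) Fq q0 horner0.
apply: (@poly_eq0_open _ (char_poly (- x))); first exact/monic_neq0/char_poly_monic.
move=> z; rewrite -Fq /char_poly => dz; apply: F0; rewrite unitmxE unitfE.
apply: contraNneq dz => d0; rewrite -horner_evalE -det_map_mx -[X in _ == X]d0.
apply/eqP; congr (\det _); apply/matrixP => i j.
rewrite !mxE /= horner_evalE hornerD hornerMn hornerX hornerN hornerC.
by rewrite opprK addrC.
Qed.

End InfiniteField.

Section PolynomialFunctions.
Variables (I : finType) (D : nat).
Local Notation expo := {ffun I -> 'I_D.+1}.

Definition expo_nat (a : expo) : I -> nat := fun i => a i.

Lemma expo_nat_lt a i : (expo_nat a i < D.+2)%N.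
Proof. exact: leqW (ltn_ord (a i)). Qed.

(** Polynomials are kept as families of coefficients over a finite set of
    exponents, to be compared with functions on the group. *)
Definition pev (R : comNzRingType) (c : expo -> R) (x : I -> R) : R :=
  \sum_a c a * \prod_i x i ^+ a i.

Lemma eq_pev (R : comNzRingType) (c : expo -> R) x y :
  x =1 y -> pev c x = pev c y.
Proof.
by move=> xy; apply: eq_bigr => a _; congr (_ * _); apply: eq_bigr => i _; rewrite xy.
Qed.

Lemma pev_horner (K : comNzRingType) (c : expo -> K) (x : I -> {poly K}) z :
  (pev (fun a => (c a)%:P) x).[z] = pev c (fun i => (x i).[z]).
Proof.
rewrite /pev horner_sum; apply: eq_bigr => a _; rewrite hornerM hornerC.
by rewrite horner_prod; congr (_ * _); apply: eq_bigr => i _; rewrite horner_exp.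
Qed.

(** Kronecker substitution: with a base larger than every exponent, distinct
    monomials go to distinct powers of the single variable z. *)
Lemma kronecker_independent (K : closedFieldType) (pos : I -> nat) (c : expo -> K) :
  injective pos ->
  (forall z, z != 0 -> pev c (fun i => z ^+ (D.+2 ^ pos i)) = 0) ->
  forall a, c a = 0.
Proof.
move=> pinj c0 a; pose P := pev (fun a => (c a)%:P) (fun i => 'X^(D.+2 ^ pos i)).
have P0 : P = 0.
  apply: (@poly_eq0_open K P 'X); first by rewrite polyX_eq0.
  move=> z; rewrite hornerX => /c0 <-; rewrite pev_horner; apply: eq_pev => i.
  by rewrite hornerXn.
have PE : P = \sum_(b : expo) (c b)%:P * 'X^(digit_sum pos D.+2 0 (expo_nat b)).
  apply: eq_bigr => b _; congr (_ * _); rewrite /digit_sum -prodrXr.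
  by apply: eq_bigr => i _; rewrite -exprM mulnC.
have := congr1 (fun p : {poly K} => p`_(digit_sum pos D.+2 0 (expo_nat a))) P0.
rewrite PE coef0 coef_sum (bigD1 a) //= big1 ?addr0 => [|b ba].
  by rewrite coefCM coefXn eqxx mulr1.
rewrite coefCM coefXn; case: eqP => [ab|_]; last by rewrite mulr0.
case/eqP: ba; apply/ffunP => i; apply: val_inj => /=; apply/esym.
exact: (digit_sum_inj pinj _ (expo_nat_lt a) (expo_nat_lt b) ab).
Qed.

End PolynomialFunctions.

(** * Least monomials of invariants of row operations *)

Section Top.
Variable R : comNzRingType.
(** A degree bound e together with the coefficient in degree e, which may
    vanish: unlike a leading coefficient, it is multiplicative for every
    choice of bounds. *)
Definition top_coef (e : nat) (x : R) (p : {poly R}) := (size p <= e.+1)%N /\ p`_e = x.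

Lemma top_coefC x : top_coef 0 x x%:P.
Proof. by split; [exact: size_polyC_leq1 | rewrite coefC]. Qed.

Lemma top_coefM e x p f y q :
  top_coef e x p -> top_coef f y q -> top_coef (e + f)%N (x * y) (p * q).
Proof.
move=> [sp px] [sq qy]; split.
  apply: leq_trans (size_polyMleq _ _) _; move: sp sq.
  move: (size p) (size q) => a b ? ?; lia.
have eE : (e < (e + f).+1)%N by lia.
rewrite coefM (bigD1 (Ordinal eE)) //= px addKn qy big1 ?addr0 // => k /eqP ke.
have {}ke : k <> e :> nat by move=> E; apply: ke; apply: val_inj.
have [kl|lk|//] := ssrnat.ltngtP k e.
  rewrite [q`__]nth_default ?mulr0 //.
    by move: sq; move: (size q) => z ?; lia.
by rewrite [p`__]nth_default ?mul0r // (leq_trans sp).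
Qed.

Lemma top_coefX e x p k : top_coef e x p -> top_coef (e * k)%N (x ^+ k) (p ^+ k).
Proof.
move=> px; elim: k => [|k IH]; first by rewrite muln0 !expr0; apply: top_coefC.
by rewrite mulnS !exprS; apply: top_coefM.
Qed.

Lemma top_coef_prod (I : finType) (P : pred I) (e : I -> nat) (x : I -> R) p :
  (forall i, P i -> top_coef (e i) (x i) (p i)) ->
  top_coef (\sum_(i | P i) e i)%N (\prod_(i | P i) x i) (\prod_(i | P i) p i).
Proof.
move=> px; elim/big_rec3: _ => [|i e' x' p' Pi h]; first exact: top_coefC.
by apply: top_coefM => //; apply: px.
Qed.

Lemma top_coef_lin (x y : R) : top_coef 1 y (x%:P + y *: 'X).
Proof.
split; last by rewrite coefD coefC coefZ coefX mulr1 add0r.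
rewrite (leq_trans (size_polyD _ _)) // geq_max.
rewrite (leq_trans (size_polyC_leq1 _)) //.
by rewrite (leq_trans (size_scale_leq _ _)) ?size_polyX.
Qed.
End Top.

Section Ballot.
Variables (K : closedFieldType) (n D : nat).
Local Notation P := ('I_n * 'I_n)%type.
Local Notation expo := {ffun P -> 'I_D.+1}.

(** The order of the variables: the last column is the heaviest and within a
    column the first row is the heaviest. The monomial of least weight in a
    minor with increasing column indices is then the one on its diagonal. *)
Definition col_pos (p : P) : nat := p.2 * n + (n.-1 - p.1).

Lemma col_pos_inj : injective col_pos.
Proof.
move=> [i j] [k l]; rewrite /col_pos /= => E.
have := ltn_ord i; have := ltn_ord k => kn iln.
have jl : j = l :> nat by nia.
by congr pair; apply: val_inj => //=; nia.
Qed.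

Local Notation dsum p a := (digit_sum col_pos D.+2 p (expo_nat a)).

Variables (c : expo -> K) (lam : 'I_n -> nat).
Hypothesis row_hom : forall a, c a != 0 -> forall i, (\sum_m a (i, m))%N = lam i.

Definition row_add (i i' : 'I_n) (t : K) (x : P -> K) : P -> K :=
  fun p => if p.1 == i' then x p + t * x (i, p.2) else x p.

Hypothesis row_inv : forall i i' : 'I_n, i' = i.+1 :> nat ->
  forall t x, pev c (row_add i i' t x) = pev c x.

Variable a0 : expo.
Hypothesis a0c : c a0 != 0.
Hypothesis a0min : forall a, c a != 0 -> (dsum 0 a0 <= dsum 0 a)%N.

Variables (i i' j : 'I_n).
Hypothesis ii' : i' = i.+1 :> nat.

(** The argument treats one pair of adjacent rows i, i' = i+1 and one column j
    at a time; the positions heavier than (i,j) are those of the columns after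
    j and those of column j above row i. *)
Definition heavier (p : P) := (col_pos (i, j) < col_pos p)%N.
Definition agree (a : expo) := [forall p, heavier p ==> (a p == a0 p)].
Definition lead_coefs (a : expo) := if agree a then c a else 0.

Lemma heavier_row (k m : 'I_n) : k = i \/ k = i' -> heavier (k, m) = (j < m)%N.
Proof.
rewrite /heavier /col_pos /=; have := ltn_ord i'; have := ltn_ord k.
have := ltn_ord j; have := ltn_ord m => ? ? ? ? /=.
by case=> ->; apply/idP/idP; nia.
Qed.

Lemma agreeP (a : expo) : reflect (forall p, heavier p -> a p = a0 p) (agree a).
Proof.
apply: (iffP forallP) => H p; first by move=> fp; apply/eqP; move: (H p); rewrite fp.
by apply/implyP => /H ->.
Qed.

Lemma hi_min (a : expo) : c a != 0 ->
  (dsum (col_pos (i, j)).+1 a0 <= dsum (col_pos (i, j)).+1 a)%N.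
Proof.
by move/a0min; apply: digit_sum_mono; [exact: col_pos_inj | | exact: expo_nat_lt ..].
Qed.

Lemma hi_agree (a : expo) :
  (dsum (col_pos (i, j)).+1 a == dsum (col_pos (i, j)).+1 a0) = agree a.
Proof.
apply/eqP/agreeP => [E p fp|E].
  apply: val_inj; apply: (digit_sum_inj col_pos_inj _ _ _ E) => //; exact: expo_nat_lt.
by apply: eq_bigr => p fp; rewrite /expo_nat E.
Qed.

(** Substituting powers of X for the heavier variables makes the monomials
    that agree with the least one a0 on these variables appear with the least
    power of X. The factors w, which are 1 at X = 0, do not disturb this
    lowest term. *)
Lemma heavier_coef (x : P -> K) (w : P -> {poly K}) : (forall p, (w p).[0] = 1) ->
  (pev (fun a => (c a)%:P)
    (fun p => if heavier p then 'X^(D.+2 ^ col_pos p) * w p else (x p)%:P))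
    `_(dsum (col_pos (i, j)).+1 a0)
  = \sum_(a | agree a) c a * \prod_(p | ~~ heavier p) x p ^+ a p.
Proof.
move=> w1; rewrite /pev coef_sum [RHS]big_mkcond /=; apply: eq_bigr => a _.
have -> : \prod_p (if heavier p then 'X^(D.+2 ^ col_pos p) * w p else (x p)%:P) ^+ a p
   = 'X^(dsum (col_pos (i, j)).+1 a) * ((\prod_(p | heavier p) w p ^+ a p)
       * (\prod_(p | ~~ heavier p) x p ^+ a p)%:P).
  rewrite (bigID heavier) /= mulrA; congr (_ * _).
    rewrite /digit_sum -prodrXr -big_split /=; apply: eq_bigr => p fp.
    by rewrite fp exprMn -exprM mulnC.
  rewrite rmorph_prod; apply: eq_bigr => p /negPf ->.
  by rewrite rmorphXn.
rewrite coefCM -hi_agree; case: (eqVneq (c a) 0) => [->|ca]; first by rewrite !mul0r if_same.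
rewrite coefXnM; have := hi_min ca; case: ssrnat.ltngtP => // [h _|-> _].
  by rewrite mulr0.
rewrite subnn coefMC; congr (_ * _); rewrite -[RHS]mul1r; congr (_ * _).
by rewrite -horner_coef0 horner_prod big1 // => p _; rewrite horner_exp w1 expr1n.
Qed.

Definition lead_row_add t (x : P -> K) : P -> K :=
  fun p => if (p.1 == i') && (p.2 <= j)%N then x p + t * x (i, p.2) else x p.

Lemma lead_pev x : pev lead_coefs x = (\prod_(p | heavier p) x p ^+ a0 p)
  * \sum_(a | agree a) c a * \prod_(p | ~~ heavier p) x p ^+ a p.
Proof.
rewrite /pev mulr_sumr [RHS]big_mkcond /=; apply: eq_bigr => a _.
rewrite /lead_coefs; case: ifP => [/agreeP aa|_]; last by rewrite mul0r.
rewrite (bigID heavier) /= mulrCA; congr (_ * _).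
by rewrite (eq_bigr (fun p => x p ^+ a0 p)) // => p /aa ->.
Qed.

(** The lowest part inherits the invariance, for the row operation restricted
    to the columns up to j: in a later column the entry of row i is scaled by
    a higher power of X than that of row i', so that adding it changes nothing
    in the lowest term. *)
Lemma lead_inv t x : pev lead_coefs (lead_row_add t x) = pev lead_coefs x.
Proof.
rewrite !lead_pev; congr (_ * _).
  apply: eq_bigr => -[k m]; rewrite /lead_row_add /=; case: andP => //= -[/eqP -> mj].
  by rewrite heavier_row ?ltnNge ?mj //; right.
rewrite -(@heavier_coef x (fun=> 1)) => [|p]; last by rewrite hornerE.
pose w (p : P) : {poly K} := if p.1 == i' then
   1 + t *: 'X^(D.+2 ^ col_pos (i, p.2) - D.+2 ^ col_pos p) else 1.
have lt_pos m : (D.+2 ^ col_pos (i', m) < D.+2 ^ col_pos (i, m))%N.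
  by rewrite ltn_exp2l // /col_pos /= ltn_add2l; have := ltn_ord i'; lia.
rewrite -(@heavier_coef (lead_row_add t x) w) => [|p]; last first.
  rewrite /w; case: eqP => p1; rewrite !hornerE // expr0n.
  case: p p1 => k m /= ->; rewrite subn_eq0 leqNgt lt_pos /=.
  by rewrite mulr0 addr0.
congr (nth _ (polyseq _) _); apply: poly_eq0_all_eq => z; rewrite !pev_horner.
set y := fun p => (if heavier p then 'X^(D.+2 ^ col_pos p) * 1 else (x p)%:P).[z].
rewrite -[RHS](row_inv ii' t); apply: eq_pev => -[k m].
rewrite /row_add /y /lead_row_add /w /=; case: (eqVneq k i') => [->|_] /=; last first.
  by case: ifP => //; rewrite ?mulr1.
rewrite !heavier_row; [|by left|by right].
case: ltnP => jm; rewrite ?hornerC // !hornerE.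
rewrite -[X in _ = _ + X]/(t * _ * 1) mulr1 mulrDr mulr1 mulrCA -exprD.
by rewrite subnKC // ltnW.
Qed.


Lemma lead_coefs_hom (k : 'I_n) a : k = i \/ k = i' -> lead_coefs a != 0 ->
  (\sum_(m : 'I_n | (m <= j)%N) a (k, m) = \sum_(m : 'I_n | (m <= j)%N) a0 (k, m))%N.
Proof.
rewrite /lead_coefs => ki; case: ifP => [/agreeP aa ca|_]; last by rewrite eqxx.
have := row_hom a0c k; rewrite -(row_hom ca k).
rewrite (bigID (fun m : 'I_n => m <= j)%N) [RHS](bigID (fun m : 'I_n => m <= j)%N) /=.
suff -> : (\sum_(m : 'I_n | ~~ (m <= j)%N) a (k, m)
    = \sum_(m : 'I_n | ~~ (m <= j)%N) a0 (k, m))%N by move/addIn.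
by apply: eq_bigr => m mj; rewrite aa // heavier_row // ltnNge.
Qed.

Lemma lead_coefs_ge a : lead_coefs a != 0 -> (a0 (i, j) <= a (i, j))%N.
Proof.
rewrite /lead_coefs; case: ifP => [aa ca|_]; last by rewrite eqxx.
apply: (@digit_le _ col_pos D.+2 col_pos_inj isT (expo_nat a0) (expo_nat a)).
- exact: expo_nat_lt.
- exact: expo_nat_lt.
- exact: a0min.
- by apply/esym/eqP; rewrite hi_agree.
Qed.

Definition two_rows (R : Type) (u v : 'I_n -> R) (x : P -> R) : P -> R :=
  fun p => if (p.2 <= j)%N then
    if p.1 == i then u p.2 else if p.1 == i' then v p.2 else x p else x p.

Lemma i_neq : (i' == i) = false.
Proof. by apply: contraTF isT => /eqP E; move: ii'; rewrite E => /eqP; rewrite ltn_eqF. Qed.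

Local Notation h := (pev lead_coefs).

Lemma two_rows_add t u v x :
  h (two_rows u (fun m => v m + t * u m) x) = h (two_rows u v x).
Proof.
rewrite -[RHS](lead_inv t); apply: eq_pev => -[k m]; rewrite /lead_row_add /two_rows /=.
case: (eqVneq k i') => [->|_] /=; rewrite ?i_neq; last by [].
by case: leqP => //; rewrite eqxx.
Qed.

Lemma two_rows_scale s u v x :
  h (two_rows u (fun m => s * v m) x)
  = s ^+ (\sum_(m : 'I_n | (m <= j)%N) a0 (i', m)) * h (two_rows u v x).
Proof.
rewrite /pev mulr_sumr; apply: eq_bigr => a _.
case: (eqVneq (lead_coefs a) 0) => [->|ca]; first by rewrite !mul0r mulr0.
rewrite mulrCA; congr (_ * _); rewrite -(lead_coefs_hom (or_intror erefl) ca).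
rewrite -prodrXr.
pose row (p : P) := (p.1 == i') && (p.2 <= j)%N.
rewrite (bigID row) [in RHS](bigID row) /= mulrA; congr (_ * _); last first.
  apply: eq_bigr => -[k m]; rewrite /row /two_rows /=.
  by case: eqP => //= ->; rewrite i_neq; case: leqP.
have E (F : P -> K) : \prod_(p | row p) F p = \prod_(m : 'I_n | (m <= j)%N) F (i', m).
  transitivity (\prod_(k | k == i') \prod_(m : 'I_n | (m <= j)%N) F (k, m)).
    by rewrite pair_big /=; apply: eq_big => -[].
  by rewrite big_pred1_eq.
rewrite !E -big_split /=; apply: eq_bigr => m mj.
by rewrite /two_rows /= mj i_neq eqxx exprMn.
Qed.

(** Here s v = w - u, and subtracting the row w from the next row changes
    nothing. This plays the role of the reflection that exchanges the two
    rows. *)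
Lemma two_rows_swap s u v x : let w := fun m => u m + s * v m in
  s ^+ (\sum_(m : 'I_n | (m <= j)%N) a0 (i', m)) * h (two_rows w v x)
  = (-1) ^+ (\sum_(m : 'I_n | (m <= j)%N) a0 (i', m)) * h (two_rows w u x).
Proof.
move=> w; rewrite -!two_rows_scale -[LHS](two_rows_add (-1)).
by apply: eq_pev => p; rewrite /two_rows; do 3!case: ifP => // _; rewrite /w; ring.
Qed.

Lemma two_rows_nonzero : exists u v x, u j = 0 /\ h (two_rows v u x) != 0.
Proof.
have [z [z0 hz]] : exists z, z != 0 /\ h (fun p => z ^+ (D.+2 ^ col_pos p)) != 0.
  apply: contrapT => no; move/eqP: a0c; apply.
  have <- : lead_coefs a0 = c a0 by rewrite /lead_coefs (introT (agreeP _)).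
  apply: (kronecker_independent col_pos_inj) => z z0; apply: contrapT => hz.
  by apply: no; exists z; split=> //; apply/eqP.
set x := fun p => _ in hz.
have x0 p : x p != 0 by rewrite expf_neq0.
exists (fun m => x (i', m) + - (x (i', j) / x (i, j)) * x (i, m)), (fun m => x (i, m)), x.
split; first by rewrite mulNr divfK // subrr.
rewrite two_rows_add; congr (_ != _): hz; apply: eq_pev => -[k m].
rewrite /two_rows /=; case: leqP => //= _.
by case: eqP => [->//|_]; case: eqP => [->|].
Qed.

(** Ballot condition for the least monomial of a polynomial invariant under
    adding a row to the next one. Let alpha, beta be the degrees of its lowest
    part h in rows i and i' (columns up to j). With u j = 0, every monomial of
    h(u + s v, v) is divisible by s ^ a0(i,j), so that the previous identity
    makes h(u + s v, u), which has degree alpha in s with top coefficient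
    h(v,u) <> 0, divisible by s ^ (beta + a0(i,j)). Therefore beta + a0(i,j)
    <= alpha. *)
Lemma ballot :
  (\sum_(m : 'I_n | (m <= j)%N) a0 (i', m) <= \sum_(m : 'I_n | (m < j)%N) a0 (i, m))%N.
Proof.
set beta := bigop _ _ _.
have [u [v [x [uj huv]]]] := two_rows_nonzero.
pose X m : {poly K} := (u m)%:P + v m *: 'X.
pose C m : {poly K} := (u m)%:P; pose V m : {poly K} := (v m)%:P.
pose pc := fun a => (lead_coefs a)%:P.
pose y := fun p => (x p)%:P.
have E : 'X^beta * pev pc (two_rows X V y) = (-1) ^+ beta * pev pc (two_rows X C y).
  apply: poly_eq0_all_eq => z; rewrite !hornerM !horner_exp !hornerE !pev_horner.
  have := two_rows_swap z u v x.
  have hE f g f' g' : (forall m, (f m).[z] = f' m) -> (forall m, (g m).[z] = g' m) ->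
      h (fun p => (two_rows f g y p).[z]) = h (two_rows f' g' x).
    move=> ff gg; apply: eq_pev => p; rewrite /two_rows -ff -gg /y.
    by case: ifP => _; [case: ifP => _; [|case: ifP => _]|]; rewrite ?hornerC.
  have XE m : (X m).[z] = u m + z * v m by rewrite !hornerE mulrC.
  by rewrite (hE _ _ _ _ XE (fun m => hornerC (v m) z))
             (hE _ _ _ _ XE (fun m => hornerC (u m) z)).
have [q Eq] : exists q, pev pc (two_rows X V y) = 'X^(a0 (i, j)) * q.
  rewrite /pev; elim/big_rec: _ => [|a p _ [q ->]]; first by exists 0; rewrite mulr0.
  case: (eqVneq (lead_coefs a) 0) => [a0'|/lead_coefs_ge aij].
    by exists q; rewrite /pc a0' mul0r add0r.
  rewrite (bigD1 (i, j)) //= {1}/two_rows /= leqnn eqxx /X uj add0r exprZn.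
  have -> : 'X^(a (i, j)) = 'X^(a0 (i, j)) * 'X^(a (i, j) - a0 (i, j)) :> {poly K}.
    by rewrite -exprD subnKC.
  set T := bigop _ _ _.
  exists (pc a * (v j ^+ a (i, j) *: 'X^(a (i, j) - a0 (i, j))) * T + q).
  by rewrite mulrDr; congr (_ + _); rewrite -!mul_polyC; ring.
pose alpha := (\sum_(m : 'I_n | (m <= j)%N) a0 (i, m))%N.
have top : (pev pc (two_rows X C y))`_alpha = h (two_rows v u x).
  rewrite /pev coef_sum; apply: eq_bigr => a _; rewrite coefCM.
  case: (eqVneq (lead_coefs a) 0) => [->|ca]; first by rewrite !mul0r.
  congr (_ * _); rewrite /alpha -(lead_coefs_hom (or_introl erefl) ca).
  pose e (p : P) := ((p.1 == i) && (p.2 <= j)%N : nat).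
  have -> : (\sum_(m : 'I_n | (m <= j)%N) a (i, m))%N = (\sum_p e p * a p)%N.
    transitivity (\sum_(k | k == i) \sum_(m : 'I_n | (m <= j)%N) a (k, m))%N.
      by rewrite big_pred1_eq.
    rewrite pair_big big_mkcond /=; apply: eq_bigr => -[k m] _ /=; rewrite /e /=.
    by case: eqP => [->|_]; case: leqP; rewrite ?mul1n.
  suff H : forall p, top_coef (e p) (two_rows v u x p) (two_rows X C y p).
    have [_ ->] := top_coef_prod (fun p _ => top_coefX (a p) (H p)) (P := xpredT).
    by [].
  case=> k m; rewrite /e /two_rows /=; case: leqP => /= _; rewrite ?andbF ?andbT.
    case: eqP => _; first exact: top_coef_lin.
    by case: eqP => _; apply: top_coefC.
  exact: top_coefC.
have : (beta + a0 (i, j) <= alpha)%N.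
  rewrite leqNgt; apply/negP => lt; move/eqP: huv; apply; rewrite -top.
  have -> : pev pc (two_rows X C y) = (-1) ^+ beta * ('X^beta * ('X^(a0 (i, j)) * q)).
    by rewrite -Eq E mulrA -exprD -signr_odd oddD addbb mul1r.
  by rewrite !(mulrCA ((-1) ^+ beta)) mulrA -exprD coefXnM lt.
rewrite /alpha (bigD1 j) //= addnC leq_add2l.
by congr (_ <= _)%N; apply: eq_bigl => m; rewrite andbC ltn_neqAle.
Qed.

End Ballot.

(** * Minors *)

Section Minors.
Variables (R : comNzRingType) (n : nat).
Implicit Types (k : nat) (P Q : 'I_n -> 'I_n) (s t : 'S_n) (g h : 'M[R]_n).

Definition fixes_above k s := [forall j : 'I_n, (k <= j)%N ==> (s j == j)].

Lemma fixes_aboveP k s :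
  reflect (forall j : 'I_n, (k <= j)%N -> s j = j) (fixes_above k s).
Proof.
apply: (iffP forallP) => H j; first by move=> kj; apply/eqP; move: (H j); rewrite kj.
by apply/implyP => /H ->.
Qed.

Lemma fixes_above_lt k s (j : 'I_n) : fixes_above k s -> (s j < k)%N = (j < k)%N.
Proof.
move/fixes_aboveP => sk; case: (ltnP j k) => [jk|kj]; last first.
  by rewrite sk // ltnNge kj.
rewrite ltnNge; apply/negP => ksj; have := sk _ ksj => /perm_inj E.
by move: ksj; rewrite E leqNgt jk.
Qed.

Lemma fixes_aboveV k s : fixes_above k s^-1%g = fixes_above k s.
Proof.
have imp t : fixes_above k t -> fixes_above k t^-1%g.
  move=> /fixes_aboveP H; apply/fixes_aboveP => j kj.
  by apply: (@perm_inj _ t); rewrite permKV H.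
by apply/idP/idP => /imp; rewrite ?invgK.
Qed.

Lemma fixes_aboveM k s t :
  fixes_above k s -> fixes_above k t -> fixes_above k (s * t)%g.
Proof.
by move=> /fixes_aboveP sk /fixes_aboveP tk; apply/fixes_aboveP => j kj; rewrite permM sk // tk.
Qed.

Lemma fixes_above1 k : fixes_above k 1%g.
Proof. by apply/fixes_aboveP => j _; rewrite perm1. Qed.

(** The minor on the rows P 0 .. P (k-1) and the columns Q 0 .. Q (k-1). Index
    maps are total and k is a bound, so that minors of all sizes share one
    type of indices. *)
Definition minor k P Q g : R :=
  \sum_(s : 'S_n | fixes_above k s)
    (-1) ^+ s * \prod_(j : 'I_n | (j < k)%N) g (P (s j)) (Q j).

(** Padding by an identity block turns the minor into a determinant of size n;
    the entries of the rows from k on in the first k columns are irrelevant. *)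
Lemma minor_leibniz k P Q g (A : 'M[R]_n) :
  (forall i j : 'I_n, (j < k)%N -> (i < k)%N -> A i j = g (P i) (Q j)) ->
  (forall i j : 'I_n, (k <= j)%N -> A i j = (i == j)%:R) ->
  \det A = minor k P Q g.
Proof.
move=> Ag A1; rewrite -det_tr /determinant /minor [RHS]big_mkcond /=.
apply: eq_bigr => s _; case: ifP => [sk|].
  congr (_ * _); rewrite (bigID (fun j : 'I_n => j < k)%N) /=.
  rewrite [X in _ * X]big1 ?mulr1 => [|j]; last first.
    by rewrite -leqNgt => kj; rewrite mxE A1 // (fixes_aboveP _ _ sk) // eqxx.
  by apply: eq_bigr => j jk; rewrite mxE Ag // fixes_above_lt.
move/negbT/forallPn => [j]; rewrite negb_imply => /andP[kj sj].
by rewrite (bigD1 j) //= mxE A1 // (negPf sj) mul0r mulr0.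
Qed.

Lemma minor_det k P Q g :
  minor k P Q g
  = \det (\matrix_(i, j) if (j < k)%N then g (P i) (Q j) else (i == j)%:R).
Proof.
apply/esym/minor_leibniz => i j; rewrite mxE; first by move=> ->.
by rewrite ltnNge => ->.
Qed.

Lemma minor_sq k P Q g :
  minor k P Q g = \det (\matrix_(i, j)
    if (i < k)%N && (j < k)%N then g (P i) (Q j) else (i == j)%:R).
Proof.
apply/esym/minor_leibniz => i j; rewrite mxE; first by move=> -> ->.
by rewrite [(j < k)%N]ltnNge andbC => ->.
Qed.

Lemma eq_minor k P Q P' Q' g :
  (forall j : 'I_n, (j < k)%N -> P j = P' j) ->
  (forall j : 'I_n, (j < k)%N -> Q j = Q' j) ->
  minor k P Q g = minor k P' Q' g.
Proof.
move=> PP QQ; apply: eq_bigr => s sk; congr (_ * _); apply: eq_bigr => j jk.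
by rewrite QQ // PP // fixes_above_lt.
Qed.

Lemma minor_tr k P Q g : minor k P Q g^T = minor k Q P g.
Proof.
rewrite /minor (reindex_inj (@invg_inj 'S_n)) /=; apply: eq_big => s.
  by rewrite fixes_aboveV.
rewrite fixes_aboveV => sk; rewrite odd_permV; congr (_ * _).
rewrite (reindex_inj (@perm_inj _ s)) /=; apply: eq_big => j.
  by rewrite fixes_above_lt.
by move=> _; rewrite permK mxE.
Qed.

(** Cauchy-Binet before grouping the middle indices into sets: f runs over all
    maps, extended by the identity above k. *)
Lemma minor_mul k P Q g h :
  minor k P Q (g *m h) = \sum_(f : {ffun 'I_n -> 'I_n})
    (\prod_(j : 'I_n) (if (j < k)%N then h (f j) (Q j) else (f j == j)%:R)) * minor k P f g.
Proof.
under [RHS]eq_bigr do rewrite mulr_sumr.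
rewrite [RHS]exchange_big /=; apply: eq_bigr => s sk.
under [RHS]eq_bigr do rewrite mulrCA.
rewrite -mulr_sumr; congr (_ * _); rewrite big_mkcond /=.
transitivity (\prod_(j : 'I_n) \sum_(l : 'I_n) (if (j < k)%N then g (P (s j)) l * h l (Q j) else (l == j)%:R)).
  apply: eq_bigr => j _; case: ifP => jk; first by rewrite mxE.
  by rewrite (bigD1 j) //= eqxx big1 ?addr0 // => l /negPf ->.
rewrite bigA_distr_bigA /=; apply: eq_bigr => f _.
rewrite [X in _ * X]big_mkcond -big_split /=; apply: eq_bigr => j _.
by case: ifP => _; rewrite ?mulr1 // mulrC.
Qed.

Lemma minor_repeat k P Q g (j1 j2 : 'I_n) :
  j1 != j2 -> (j1 < k)%N -> (j2 < k)%N -> Q j1 = Q j2 -> minor k P Q g = 0.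
Proof.
move=> j12 j1k j2k QQ; rewrite minor_det -det_tr.
by apply: (determinant_alternate j12) => i; rewrite !mxE j1k j2k QQ.
Qed.

Lemma minor_perm k P t g : fixes_above k t ->
  minor k P t g = (-1) ^+ t * minor k P id g.
Proof.
move=> tk; rewrite /minor mulr_sumr (reindex_inj (@mulgI 'S_n t)) /=; apply: eq_big => s.
  apply/idP/idP => [tsk|]; last exact: fixes_aboveM.
  by rewrite -[s](mulKg t) fixes_aboveM ?fixes_aboveV.
move=> _; rewrite odd_permM signr_addb -mulrA; congr (_ * (_ * _)).
rewrite [RHS](reindex_inj (@perm_inj _ t)) /=; apply: eq_big => j.
  by rewrite fixes_above_lt.
by rewrite permM.
Qed.

(** The first k rows of a lower triangular matrix have no entries beyond
    column k, so multiplying by it on the left multiplies the padded matrices. *)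
Lemma minor_lower_mul k Q g h : (k <= n)%N -> is_trig_mx h ->
  minor k id Q (h *m g) = (\prod_(j : 'I_n | (j < k)%N) h j j) * minor k id Q g.
Proof.
move=> kn /is_trig_mxP h0; rewrite !minor_sq.
pose b : 'M_n := \matrix_(i, l) if (i < k)%N && (l < k)%N then h i l else (i == l)%:R.
have -> : \prod_(j : 'I_n | (j < k)%N) h j j = \det b.
  rewrite det_trig; last first.
    apply/is_trig_mxP => i l il; rewrite mxE h0 //.
    by case: ifP => // _; rewrite -val_eqE /= ltn_eqF.
  rewrite big_mkcond; apply: eq_bigr => j _; rewrite mxE eqxx andbb.
  by case: ifP.
rewrite -det_mulmx; congr (\det _); apply/matrixP => i j; rewrite !mxE.
case: (ltnP i k) => ik /=; last first.
  rewrite (bigD1 i) //= !mxE ltnNge ik /= eqxx mul1r big1 ?addr0 // => l li.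
  by rewrite !mxE ltnNge ik /= eq_sym (negPf li) mul0r.
case: (ltnP j k) => jk.
  apply: eq_bigr => l _; rewrite !mxE ik jk andbT /=.
  case: ltnP => //= kl; rewrite h0 ?mul0r; last exact: leq_trans ik kl.
  by rewrite -val_eqE /= ltn_eqF ?mul0r // (leq_trans ik).
rewrite (bigD1 j) //= !mxE ik [(j < k)%N]ltnNge jk /= eqxx mulr1 big1 ?addr0 // => l lj.
by rewrite !mxE [(j < k)%N]ltnNge jk andbF (negPf lj) mulr0.
Qed.

End Minors.

Lemma minor_map (R S : comNzRingType) (f : {rmorphism R -> S}) n k
    (P Q : 'I_n -> 'I_n) (g : 'M[R]_n) :
  f (minor k P Q g) = minor k P Q (map_mx f g).
Proof.
rewrite rmorph_sum; apply: eq_bigr => s _; rewrite rmorphM rmorph_sign; congr (_ * _).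
by rewrite rmorph_prod; apply: eq_bigr => j _; rewrite mxE.
Qed.

Section Rearrangement.
Variables (n k N : nat) (T : 'I_n -> 'I_n).
Hypothesis N_gt1 : (1 < N)%N.
Hypothesis T_incr : forall i j : 'I_n, (i < j)%N -> (j < k)%N -> (T i < T j)%N.
Local Notation e j := (N ^ col_pos (j, T j))%N.

(** The exponents col_pos (j, T j) are strictly increasing, so the sum of the
    powers is dominated by the last one. *)
Lemma staircase_sum_lt (j : 'I_n) : (j < k)%N ->
  (\sum_(l : 'I_n | (l <= j)%N) e l < 2 * e j)%N.
Proof.
have N0 : (0 < N)%N by exact: ltnW.
case: j => j jn /=; elim: j jn => [|j IH] jn jk.
  rewrite (big_pred1 (Ordinal jn)) => [|l]; first by rewrite ltn_Pmull // expn_gt0 N0.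
  by rewrite leqn0.
pose j' := Ordinal (ltnW jn); pose j1 := Ordinal jn.
rewrite (bigD1 j1) //= (eq_bigl (fun l : 'I_n => l <= j')%N); last first.
  by move=> l; rewrite andbC -ltn_neqAle ltnS.
have := IH (ltnW jn) (ltnW jk); rewrite -/j' -/j1 => lt.
rewrite mul2n -addnn ltn_add2l (leq_trans lt) //.
apply: (@leq_trans (N * e j')); first by rewrite leq_pmul2r ?expn_gt0 ?N0.
rewrite -expnS leq_exp2l // /col_pos /=.
have := @T_incr j' j1 (ltnSn _) jk; have := ltn_ord (T j1) => ? ?.
by nia.
Qed.

(** The largest index moved by s goes to a smaller row, hence to a heavier
    position of the same column, and this single term outweighs everything
    gained elsewhere. *)
Lemma staircase_min (s : 'S_n) : fixes_above k s -> s != 1%g ->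
  (\sum_(j : 'I_n | (j < k)%N) N ^ col_pos (j, T j)
   < \sum_(j : 'I_n | (j < k)%N) N ^ col_pos (s j, T j))%N.
Proof.
move=> sk s1; have N0 : (0 < N)%N by exact: ltnW.
have [j0 sj0] : exists j, s j != j.
  apply/existsP; apply: contraNT s1 => /existsPn H; apply/eqP/permP => j.
  by rewrite perm1; apply/eqP/negPn/H.
case: (@arg_maxnP _ j0 (fun j => s j != j) val sj0) => j sj jmax.
have jk : (j < k)%N by rewrite ltnNge; apply/negP => /(fixes_aboveP _ _ sk)/eqP; apply/negP.
have sjj : (s j < j)%N.
  rewrite ltn_neqAle val_eqE sj; apply: jmax.
  by apply: contraNneq sj => /perm_inj ->.
rewrite (bigID (fun l : 'I_n => l <= j)%N) [X in (_ < X)%N](bigID (fun l : 'I_n => l <= j)%N) /=.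
rewrite -addSn leq_add //; last first.
  apply: eq_leq; apply: eq_bigr => l /andP[_ lj]; congr (_ ^ col_pos (_, _))%N.
  by apply/esym/eqP; apply: contraNT lj => /jmax.
rewrite (eq_bigl (fun l : 'I_n => l <= j)%N); last first.
  by move=> l; rewrite andb_idl // => lj; apply: leq_ltn_trans jk.
apply: leq_trans (staircase_sum_lt jk) _.
rewrite (bigD1 j) ?jk //=; apply: leq_trans (leq_addr _ _).
apply: (@leq_trans (N * e j)); first by rewrite leq_pmul2r ?expn_gt0 ?N0.
rewrite -expnS leq_exp2l // /col_pos /=; have := ltn_ord j; lia.
Qed.

End Rearrangement.

(** * Coordinates of A(n,d) and weights in the Schur algebra *)

Section PolyCoordinates.
Variables (K : closedFieldType) (n : nat) (d : nat).
Local Notation G := (GL K n).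
Local Notation fct := (G -> K^o).
Local Notation P := ('I_n * 'I_n)%type.
Local Notation expo := {ffun P -> 'I_d.+1}.

Definition entries (R : Type) (g : 'M[R]_n) : P -> R := fun p => g p.1 p.2.
Definition deg (a : expo) : nat := (\sum_p a p)%N.
Definition mono (a : expo) : fct := fun g => \prod_p (g : 'M_n) p.1 p.2 ^+ a p.

Lemma monoE a : mono a = \prod_i \prod_j @Defs.coord K n i j ^+ a (i, j).
Proof.
apply/funext => g; rewrite /mono pair_bigA /= fct_prodE; apply: eq_bigr => -[i j] _.
by elim: (nat_of_ord _) => // k IH; rewrite !exprS IH.
Qed.

Lemma mono_polyA a : deg a = d -> polyA d (mono a).
Proof.
move=> da; apply: lin_span_incl; exists (fun i j => a (i, j)); split; last exact: monoE.
by rewrite pair_bigA -[RHS]da; apply: eq_bigr => -[].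
Qed.

Lemma pev_delta (b : expo) (x : P -> K) :
  pev (fun a => (a == b)%:R) x = \prod_p x p ^+ b p.
Proof.
rewrite /pev (bigD1 b) //= eqxx mul1r [X in _ + X = _]big1 ?addr0 // => a /negPf ->.
by rewrite mul0r.
Qed.

Lemma polyA_pev (f : fct) : polyA d f -> exists c : expo -> K,
  (forall a, c a != 0 -> deg a = d) /\ forall g : G, f g = pev c (entries g).
Proof.
move: f; apply: (@lin_span_min K fct _ [set f : fct | exists c : expo -> K,
  (forall a, c a != 0 -> deg a = d) /\ forall g : G, f g = pev c (entries g)]).
  split; first by exists (fun=> 0); split=> [a|g]; rewrite ?eqxx // /pev big1 // => a; rewrite mul0r.
  move=> k u v [cu [du Eu]] [cv [dv Ev]]; exists (fun a => k * cu a + cv a); split.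
    move=> a; case: (eqVneq (cu a) 0) => [->|/du //]; rewrite mulr0 add0r; exact: dv.
  move=> g; rewrite -[LHS]/(k * u g + v g) Eu Ev /pev mulr_sumr -big_split /=.
  by apply: eq_bigr => a _; rewrite mulrDl mulrA.
move=> _ [a [da ->]].
have ad i j : (a i j <= d)%N.
  by rewrite -da (bigD1 i) //= (bigD1 j) //= -addnA leq_addr.
pose a' : expo := [ffun p => inord (a p.1 p.2)].
have a'E p : a' p = a p.1 p.2 :> nat by rewrite ffunE inordK // ltnS.
exists (fun b => (b == a')%:R); split.
  move=> b; case: (eqVneq b a') => [-> _|]; last by rewrite eqxx.
  by rewrite /deg -[RHS]da pair_bigA; apply: eq_bigr => p _; rewrite a'E.
move=> g; rewrite pev_delta.
have -> : \prod_i \prod_j @Defs.coord K n i j ^+ a i j = mono a'.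
  by rewrite monoE; apply: eq_bigr => i _; apply: eq_bigr => j _; rewrite a'E.
by [].
Qed.

Lemma GL_pev_eq0 (c : expo -> K) (x : P -> K) :
  (forall g : G, pev c (entries g) = 0) -> pev c x = 0.
Proof.
move=> c0; pose X : 'M[K]_n := \matrix_(i, j) x (i, j).
rewrite (@eq_pev _ _ _ c x (entries X)); last by case=> i j; rewrite /entries mxE.
pose q := pev (fun a => (c a)%:P) (entries (map_mx polyC X + 'X%:M)).
apply: (@unitmx_dense K n (fun y => pev c (entries y)) q).
  move=> z; rewrite /q pev_horner; apply: eq_pev => -[i j].
  rewrite /entries !mxE hornerD hornerC hornerMn hornerX.
  by [].
by move=> y yu; rewrite -(c0 (MkGL yu)).
Qed.

(** Monomials remain independent as functions on the group, because it is
    dense among all matrices. *)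
Lemma GL_independent (c : expo -> K) :
  (forall g : G, pev c (entries g) = 0) -> forall a, c a = 0.
Proof.
move=> c0; apply: (kronecker_independent (@col_pos_inj n)) => z _.
exact: GL_pev_eq0.
Qed.

End PolyCoordinates.

Section Schur.
Variables (K : closedFieldType) (n : nat) (n_gt0 : (0 < n)%N) (d : nat).
Local Notation G := (GL K n).
Local Notation P := ('I_n * 'I_n)%type.
Local Notation expo := {ffun P -> 'I_d.+1}.
Local Notation weight := {ffun 'I_n -> 'I_d.+1}.
Local Notation A := (poly_coalg K n_gt0 d).
Local Notation V := (subsp A).
Local Notation S := (dualalg A).

Definition coefs (f : V) : expo -> K := sval (cid (polyA_pev (subspP f))).

Lemma coefs_deg f a : coefs f a != 0 -> deg a = d.
Proof. by rewrite /coefs; case: cid => c [H _] /=; apply: H. Qed.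

Lemma coefsE (f : V) (g : G) : subsp_val f g = pev (coefs f) (entries g).
Proof. by rewrite /coefs; case: cid => c [_ H] /=. Qed.

Lemma coefs_uniq (f : V) (c : expo -> K) :
  (forall g : G, subsp_val f g = pev c (entries g)) -> coefs f = c.
Proof.
move=> H; apply/funext => a; apply/eqP; rewrite -subr_eq0; apply/eqP.
apply: (@GL_independent K n d (fun a => coefs f a - c a)) => g.
rewrite -[RHS](subrr (subsp_val f g)) {2}H coefsE /pev -sumrB.
by apply: eq_bigr => b _; rewrite mulrBl.
Qed.

Lemma coefs_linear a : linear ((fun f => coefs f a) : V -> K^o).
Proof.
move=> k u v; rewrite (@coefs_uniq _ (fun b => k * coefs u b + coefs v b)) // => g.
rewrite subsp_valP -[LHS]/(k * subsp_val u g + subsp_val v g) !coefsE /pev mulr_sumr.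
by rewrite -big_split /=; apply: eq_bigr => b _; rewrite mulrDl mulrA.
Qed.

Definition coef (a : expo) : S := mk_dual (coefs_linear a).

Definition deg_d : {pred expo} := [pred a | deg a == d].
Definition dexpo := {a in deg_d}.

Lemma dexpo_deg (a : dexpo) : deg (val a) = d.
Proof. exact/eqP/(valP a). Qed.

Definition monoV (a : dexpo) : V :=
  @in_subsp K _ A _ (mono_polyA K (dexpo_deg a)).

Lemma coef_mono a (b : dexpo) : coef a (monoV b) = (a == val b)%:R.
Proof.
rewrite -[LHS]/(coefs (monoV b) a).
rewrite (@coefs_uniq _ (fun a => (a == val b)%:R)) // => g.
by rewrite pev_delta.
Qed.

Lemma V_mono (f : V) : f = \sum_(a : dexpo) (coef (val a) f : K) *: monoV a.
Proof.
apply: val_inj; rewrite raddf_sum /=; apply/funext => g; rewrite fct_sumE coefsE /pev.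
rewrite (bigID (fun a : expo => deg a == d)) /= [X in _ + X]big1 ?addr0 => [|a]; last first.
  move=> ad; case: (eqVneq (coefs f a) 0) => [->|/coefs_deg /eqP]; first by rewrite mul0r.
  by rewrite (negPf ad).
exact: (big_sub deg_d (fun a => coefs f a * (mono a g : K))).
Qed.

Lemma schur_ext (x y : S) : (forall a, x (monoV a) = y (monoV a)) -> x = y.
Proof.
move=> xy; apply: dual_eqP => f; rewrite [f]V_mono !linear_sum.
by apply: eq_bigr => a _; rewrite !linearZ /= xy.
Qed.

Definition diag_expo (k : weight) : expo := [ffun p => if p.1 == p.2 then k p.1 else ord0].
(** The weight idempotents of the Schur algebra: xi k reads off the
    coefficient of the torus character k. *)
Definition xi (k : weight) : S := coef (diag_expo k).

Fact torus_proof (t : 'I_n -> K) : (forall i, t i != 0) ->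
  diag_mx (\row_i t i) \in unitmx.
Proof.
move=> t0; rewrite unitmxE det_diag unitfE; apply/prodf_neq0 => i _.
by rewrite mxE.
Qed.
Definition torus (t : 'I_n -> K) (t0 : forall i, t i != 0) : G := MkGL (torus_proof t0).

Lemma xi_torus (f : V) t (t0 : forall i, t i != 0) :
  subsp_val f (torus t0) = pev (fun k => xi k f : K) t.
Proof.
rewrite coefsE /pev.
pose undiag (a : expo) : weight := [ffun i => a (i, i)].
rewrite (bigID (fun a : expo => diag_expo (undiag a) == a)) /=.
rewrite [X in _ + X]big1 ?addr0 => [|a]; last first.
  move=> /eqP na; have [p pn] : exists p : P, (p.1 != p.2) && (a p != ord0).
    apply/existsP; apply: contra_notT na => /existsPn H; apply/ffunP => -[i j].
    rewrite !ffunE /=; case: eqP => [->//|/eqP ij].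
    by have := H (i, j); rewrite /= ij => /negPn/eqP ->.
  case/andP: pn => pd pa; rewrite (bigD1 p) //= /entries !mxE (negPf pd) mulr0n.
  by rewrite expr0n (negPf pa : (a p == 0 :> nat)%N = false) mul0r mulr0.
rewrite (reindex_onto diag_expo undiag) /= => [|a /eqP //].
have undiagK k : undiag (diag_expo k) = k.
  by apply/ffunP => i; rewrite !ffunE eqxx.
apply: eq_big => k; first by rewrite undiagK !eqxx.
move=> _; congr (_ * _).
transitivity (\prod_i \prod_j entries (torus t0) (i, j) ^+ diag_expo k (i, j)).
  by rewrite pair_bigA; apply: eq_bigr => -[].
apply: eq_bigr => i _; rewrite (bigD1 i) //= ffunE eqxx /entries !mxE eqxx mulr1n.
rewrite big1 ?mulr1 // => j ji; rewrite ffunE /= eq_sym (negPf ji).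
by rewrite expr0.
Qed.

(** A function determines its weight components by its restriction to the
    torus. *)
Lemma xi_char (f : V) (J : finType) (C : J -> K) (w : J -> weight) k :
  (forall t (t0 : forall i, t i != 0),
     subsp_val f (torus t0) = \sum_j C j * \prod_i t i ^+ w j i) ->
  xi k f = \sum_(j | w j == k) C j.
Proof.
move=> H; apply/eqP; rewrite -subr_eq0; apply/eqP.
apply: (@kronecker_independent _ d K (fun i : 'I_n => val i)
  (fun k => (xi k f : K) - \sum_(j | w j == k) C j)); first exact: val_inj.
move=> z z0; pose t := fun i : 'I_n => z ^+ (d.+2 ^ val i).
have t0 i : t i != 0 by rewrite expf_neq0.
transitivity (pev (fun k => xi k f : K) t
    - \sum_k (\sum_(j | w j == k) C j) * \prod_i t i ^+ k i).
  by rewrite /pev -sumrB; apply: eq_bigr => k' _; rewrite mulrBl.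
rewrite -(xi_torus f t0) H; apply/eqP; rewrite subr_eq0; apply/eqP.
 rewrite (partition_big w xpredT) //=; apply: eq_bigr => k' _.
by rewrite mulr_suml; apply: eq_bigr => j /eqP ->.
Qed.

Fact eps_linear (g : G) : linear ((fun f => subsp_val f g) : V -> K^o).
Proof. by []. Qed.
Definition eps (g : G) : S := mk_dual (eps_linear g).

Lemma epsE g (f : V) : eps g f = subsp_val f g. Proof. by []. Qed.

Lemma schur_mulE (x y : S) f : (x * y : S) f = x (dual_act y f).
Proof. by []. Qed.

Lemma dual_actE (y : S) (f : V) g : subsp_val (dual_act y f) g = (eps g * y : S) f.
Proof. by []. Qed.

Lemma schur_sumE (I : finType) (F : I -> S) f : (\sum_i F i : S) f = \sum_i F i f.
Proof. by elim/big_rec2: _ => [//|k u v _ <-]. Qed.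

Lemma eps_mul g h : eps g * eps h = eps (g * h)%g.
Proof. exact: dual_eqP. Qed.

Lemma eps1 : eps 1%g = 1. Proof. exact: dual_eqP. Qed.

Lemma V_ext (f f' : V) : (forall g, eps g f = eps g f') -> f = f'.
Proof. by move=> H; apply: subsp_eqP; apply/funext => g; apply: H. Qed.

(** A(n,d) is a bimodule over its dual; the left action is part of its
    definition, and the right one comes from applying x to the first factor of
    the comultiplication. *)
Lemma right_act_exists (x : S) f : exists f' : V, forall y : S, y f' = (x * y : S) f.
Proof.
have [I [f1 [f2 [A1 A2 E]]]] := coalg_comulP (subspP f).
pose F1 i : V := in_subsp (A1 i); pose F2 i : V := in_subsp (A2 i).
exists (\sum_i (x (F1 i) : K) *: F2 i) => y.
rewrite -[RHS]/(dual_mul x y f) (@dual_mulE _ _ _ _ _ _ I F1 F2) // linear_sum.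
by apply: eq_bigr => i _; rewrite linearZ.
Qed.

Definition right_act (x : S) (f : V) : V := sval (cid (right_act_exists x f)).

Lemma right_actE (x : S) (f : V) (y : S) : y (right_act x f) = (x * y : S) f.
Proof. by rewrite /right_act; case: cid. Qed.

(** An element of A(n,d) is a function on the group, so that evaluations
    suffice to test products in the dual algebra. *)
Lemma mul_eps_right_eq0 (x : S) (f : V) : (forall h, (x * eps h : S) f = 0) -> forall y : S, (x * y : S) f = 0.
Proof.
move=> H y; rewrite -right_actE; have -> : right_act x f = 0; last by rewrite linear0.
by apply: V_ext => g; rewrite right_actE H.
Qed.

Lemma mul_eps_left_eq0 (x : S) (f : V) : (forall g, (eps g * x : S) f = 0) -> forall y : S, (y * x : S) f = 0.
Proof.
move=> H y; rewrite schur_mulE; have -> : dual_act x f = 0; last by rewrite linear0.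
by apply: V_ext => g; rewrite epsE dual_actE H.
Qed.

Lemma deg_sum (a : expo) : deg a = (\sum_i \sum_j a (i, j))%N.
Proof. by rewrite pair_bigA; apply: eq_bigr => -[]. Qed.

Definition row_weight (a : expo) : weight := [ffun i => inord (\sum_j a (i, j))].
Definition col_weight (a : expo) : weight := [ffun j => inord (\sum_i a (i, j))].

Lemma row_weightE (a : dexpo) i : row_weight (val a) i = (\sum_j val a (i, j))%N :> nat.
Proof.
rewrite ffunE inordK // ltnS -[X in (_ <= X)%N](dexpo_deg a) deg_sum [X in (_ <= X)%N](bigD1 i) //=.
exact: leq_addr.
Qed.

Lemma col_weightE (a : dexpo) j : col_weight (val a) j = (\sum_i val a (i, j))%N :> nat.
Proof.
rewrite ffunE inordK // ltnS -[X in (_ <= X)%N](dexpo_deg a) deg_sum exchange_big.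
by rewrite [X in (_ <= X)%N](bigD1 j) //= leq_addr.
Qed.

Lemma torus_mul_entries t (t0 : forall i, t i != 0) (x : G) p :
  entries (torus t0 * x)%g p = t p.1 * entries x p.
Proof.
by rewrite -[LHS]/((diag_mx (\row_i t i) *m (x : 'M_n)) p.1 p.2) mul_diag_mx !mxE.
Qed.

Lemma mul_torus_entries t (t0 : forall i, t i != 0) (x : G) p :
  entries (x * torus t0)%g p = entries x p * t p.2.
Proof.
by rewrite -[LHS]/(((x : 'M_n) *m diag_mx (\row_i t i)) p.1 p.2) mul_mx_diag !mxE.
Qed.

Lemma xi_act_mono l (b : dexpo) :
  dual_act (xi l) (monoV b) = (col_weight (val b) == l)%:R *: monoV b.
Proof.
apply: V_ext => g; rewrite epsE -[LHS]/(xi l (ltrans g (monoV b))).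
rewrite (@xi_char _ unit (fun=> eps g (monoV b)) (fun=> col_weight (val b))).
  case: eqP => _; rewrite ?scale1r ?scale0r.
    by rewrite (big_pred1 tt) //; case.
  by rewrite big_pred0.
move=> t t0; rewrite (big_pred1 tt); last by case.
rewrite -[LHS]/(\prod_p entries (g * torus t0)%g p ^+ val b p).
rewrite -[eps g _]/(\prod_p entries g p ^+ val b p).
under eq_bigr do rewrite mul_torus_entries exprMn.
rewrite big_split /=; congr (_ * _).
under [RHS]eq_bigr do rewrite col_weightE -prodrXr.
rewrite exchange_big /= pair_bigA /=; by apply: eq_bigr => -[].
Qed.

(** Multiplying by torus elements on both sides of x scales the monomial b by
    its row sums on one side and its column sums on the other. *)
Lemma xi_eps_xi k l (x : G) (b : dexpo) :
  (xi k * eps x * xi l : S) (monoV b) =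
  ((row_weight (val b) == k) && (col_weight (val b) == l))%:R * eps x (monoV b).
Proof.
rewrite schur_mulE xi_act_mono; case: (col_weight (val b) == l); last first.
  by rewrite andbF scale0r linear0 mul0r.
rewrite scale1r andbT.
rewrite schur_mulE (@xi_char _ unit (fun=> eps x (monoV b)) (fun=> row_weight (val b))).
  case: eqP => _; rewrite ?mul1r ?mul0r.
    by rewrite (big_pred1 tt) //; case.
  by rewrite big_pred0.
move=> t t0; rewrite (big_pred1 tt); last by case.
rewrite -[LHS]/(\prod_p entries (torus t0 * x)%g p ^+ val b p).
rewrite -[eps x _]/(\prod_p entries x p ^+ val b p).
under eq_bigr do rewrite torus_mul_entries exprMn.
rewrite big_split /= mulrC; congr (_ * _).
under [RHS]eq_bigr do rewrite row_weightE -prodrXr.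
rewrite pair_bigA /=; by apply: eq_bigr => -[].
Qed.

Lemma sum_xi : \sum_k xi k = 1.
Proof.
apply: schur_ext => b; rewrite -eps1 epsE.
rewrite schur_sumE -[LHS]mul1r.
have t0 (i : 'I_n) : (1 : K) != 0 by exact: oner_neq0.
have -> : (1%g : G) = torus t0.
  apply: val_inj; apply/matrixP => i j; rewrite /= !mxE.
  by [].
rewrite (xi_torus (monoV b) t0) /pev mulr_sumr; apply: eq_bigr => k _.
by rewrite mul1r big1 ?mulr1 // => i _; rewrite expr1n.
Qed.

(** A numerical version of the lexicographic order on weights. It refines
    dominance and is strictly decreased by moving weight to a later index. *)
Definition Omega (k : weight) : nat := (\sum_i k i * d.+2 ^ (n.-1 - i))%N.

Lemma rev_pos_inj : injective (fun i : 'I_n => n.-1 - i)%N.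
Proof.
clear n_gt0; move=> i j /= E; apply: val_inj => /=; have := ltn_ord i; have := ltn_ord j => ? ?.
by lia.
Qed.

Lemma Omega_inj : injective Omega.
Proof.
move=> k l E; apply/ffunP => i; apply: val_inj.
exact: (@digit_sum_inj _ _ d.+2 rev_pos_inj isT 0 (expo_nat k) (expo_nat l)
  (expo_nat_lt k) (expo_nat_lt l) E i isT).
Qed.

Local Notation W i := (d.+2 ^ (n.-1 - i))%N.

Lemma W_incr (i j : 'I_n) : (i <= j)%N -> (W j <= W i ?= iff (i == j))%N.
Proof.
clear n_gt0; move=> ij; split; first by rewrite leq_exp2l // leq_sub2l.
rewrite eqn_exp2l //; apply/eqP/eqP => [E|->//]; apply: val_inj => /=.
by have := ltn_ord i; have := ltn_ord j => ? ?; lia.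
Qed.

Lemma Omega_row (b : dexpo) : Omega (row_weight (val b)) = (\sum_p val b p * W p.1)%N.
Proof.
rewrite /Omega; under eq_bigr do rewrite row_weightE big_distrl /=.
by rewrite pair_bigA; apply: eq_bigr => -[].
Qed.

Lemma Omega_col (b : dexpo) : Omega (col_weight (val b)) = (\sum_p val b p * W p.2)%N.
Proof.
rewrite /Omega; under eq_bigr do rewrite col_weightE big_distrl /=.
by rewrite exchange_big pair_bigA; apply: eq_bigr => -[].
Qed.

(** An exponent matrix supported on or above the diagonal has its row sums
    concentrated on earlier indices than its column sums. *)
Lemma upper_Omega (b : dexpo) : (forall p, val b p != ord0 -> (p.1 <= p.2)%N) ->
  (Omega (col_weight (val b)) <= Omega (row_weight (val b))
    ?= iff [forall p : P, (val b p == ord0) || (p.1 == p.2)])%N.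
Proof.
move=> up; rewrite Omega_row Omega_col; apply: leqif_sum => p _.
case: (eqVneq (val b p) ord0) => [->|bp]; first by split; rewrite ?mul0n.
have [le eq] := W_incr (up _ bp); split; first by rewrite leq_mul2l le orbT.
by rewrite eqn_mul2l (negPf bp : (val b p == 0 :> nat)%N = false).
Qed.

Lemma lower_Omega (b : dexpo) : (forall p, val b p != ord0 -> (p.2 <= p.1)%N) ->
  (Omega (row_weight (val b)) <= Omega (col_weight (val b))
    ?= iff [forall p : P, (val b p == ord0) || (p.1 == p.2)])%N.
Proof.
move=> up; rewrite Omega_row Omega_col; apply: leqif_sum => p _.
case: (eqVneq (val b p) ord0) => [->|bp]; first by split; rewrite ?mul0n.
have [le eq] := W_incr (up _ bp); split; first by rewrite leq_mul2l le orbT.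
by rewrite eqn_mul2l (negPf bp : (val b p == 0 :> nat)%N = false) [p.1 == _]eq_sym.
Qed.

Definition upper_tri (x : G) := forall i j : 'I_n, (j < i)%N -> (x : 'M_n) i j = 0.
Definition lower_tri (x : G) := forall i j : 'I_n, (i < j)%N -> (x : 'M_n) i j = 0.

Lemma eps_mono_neq0 (x : G) (b : dexpo) p :
  eps x (monoV b) != 0 -> val b p != ord0 -> entries x p != 0.
Proof.
move=> xb bp; apply: contraNneq xb => xp.
rewrite epsE -[subsp_val _ _]/(\prod_q entries x q ^+ val b q) (bigD1 p) //= xp expr0n.
by rewrite (negPf bp : (val b p == 0 :> nat)%N = false) mul0r.
Qed.

Lemma xi_upper_eq0 k l (x : G) : upper_tri x ->
  (Omega k < Omega l)%N -> xi k * eps x * xi l = 0.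
Proof.
move=> ux kl; apply: schur_ext => b; rewrite xi_eps_xi -[RHS]/(0 : K).
case: eqP => [rb|]; case: eqP => [cb|]; rewrite ?mul0r // mul1r.
apply: contraTeq kl => xb; rewrite -rb -cb -leqNgt.
have [|//] := @upper_Omega b; move=> p bp; rewrite leqNgt; apply/negP => ji.
by have := eps_mono_neq0 xb bp; rewrite /entries ux ?eqxx.
Qed.

Lemma xi_lower_eq0 k l (x : G) : lower_tri x ->
  (Omega l < Omega k)%N -> xi k * eps x * xi l = 0.
Proof.
move=> ux kl; apply: schur_ext => b; rewrite xi_eps_xi -[RHS]/(0 : K).
case: eqP => [rb|]; case: eqP => [cb|]; rewrite ?mul0r // mul1r.
apply: contraTeq kl => xb; rewrite -rb -cb -leqNgt.
have [|//] := @lower_Omega b; move=> p bp; rewrite leqNgt; apply/negP => ji.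
by have := eps_mono_neq0 xb bp; rewrite /entries ux ?eqxx.
Qed.

Lemma diag_expo_row (b : dexpo) :
  (forall p, (val b p == ord0) || (p.1 == p.2)) -> val b = diag_expo (row_weight (val b)).
Proof.
move=> H; apply/ffunP => -[i j]; apply: val_inj; rewrite [in RHS]ffunE /=.
case: eqVneq => [<-|ij]; last first.
  by have := H (i, j); rewrite /= (negPf ij) orbF => /eqP ->.
rewrite row_weightE (bigD1 i) //= big1 ?addn0 // => j' ji.
by have := H (i, j'); rewrite /= [i == _]eq_sym (negPf ji) orbF => /eqP ->.
Qed.

Lemma prod_diag_expo (x : G) l :
  \prod_p entries x p ^+ diag_expo l p = \prod_i (x : 'M_n) i i ^+ l i.
Proof.
transitivity (\prod_i \prod_j entries x (i, j) ^+ diag_expo l (i, j)).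
  by rewrite pair_bigA; apply: eq_bigr => -[].
apply: eq_bigr => i _; rewrite (bigD1 i) //= ffunE eqxx big1 ?mulr1 // => j ji.
by rewrite ffunE /= eq_sym (negPf ji) expr0.
Qed.

(** A triangular exponent matrix with equal row and column sums is diagonal. *)
Lemma xi_tri_diag l (x : G) : upper_tri x \/ lower_tri x ->
  xi l * eps x * xi l = (\prod_i (x : 'M_n) i i ^+ l i) *: xi l.
Proof.
move=> tx; apply: schur_ext => b; rewrite xi_eps_xi.
rewrite -[RHS]/(_ * coef (diag_expo l) (monoV b)) coef_mono.
case: (eqVneq (diag_expo l) (val b)) => [E|nE].
  have rowE : row_weight (val b) = l.
    apply/ffunP => i; apply: val_inj; rewrite /= row_weightE -E (bigD1 i) //= ffunE eqxx.
    by rewrite big1 ?addn0 // => j ji; rewrite ffunE /= eq_sym (negPf ji).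
  have colE : col_weight (val b) = l.
    apply/ffunP => i; apply: val_inj; rewrite /= col_weightE -E (bigD1 i) //= ffunE eqxx.
    by rewrite big1 ?addn0 // => j ji; rewrite ffunE /= (negPf ji).
  rewrite rowE colE eqxx mul1r mulr1 -prod_diag_expo.
  by rewrite -[LHS]/(\prod_q entries x q ^+ val b q) -E.
rewrite mulr0; case: eqP => [rb|]; case: eqP => [cb|]; rewrite ?mul0r // mul1r.
apply: contraNeq nE => xb; rewrite -rb; apply/eqP/esym/diag_expo_row => p; move: p.
apply/forallP; case: tx => tx.
  have [|_ <-] := @upper_Omega b; last by rewrite rb cb.
  move=> p bp; rewrite leqNgt; apply/negP => ji.
  by have := eps_mono_neq0 xb bp; rewrite /entries tx ?eqxx.
have [|_ <-] := @lower_Omega b; last by rewrite rb cb.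
move=> p bp; rewrite leqNgt; apply/negP => ji.
by have := eps_mono_neq0 xb bp; rewrite /entries tx ?eqxx.
Qed.

Lemma xi_idem k : xi k * xi k = xi k.
Proof.
have up1 : upper_tri 1%g by move=> i j ji; rewrite /= mxE -val_eqE /= gtn_eqF.
have := xi_tri_diag k (or_introl up1); rewrite eps1 mulr1 => ->.
by rewrite big1 ?scale1r // => i _; rewrite /= mxE eqxx expr1n.
Qed.

Lemma transp_xi k : schur_transp (xi k) = xi k.
Proof.
apply: dual_eqP => f; rewrite -[LHS]/(xi k (polyA_transp f)).
rewrite (@xi_char _ _ (fun l => xi l f : K) id) ?big_pred1_eq // => t t0.
rewrite -[RHS](xi_torus f t0) /=; congr (subsp_val f _).
by apply: val_inj; rewrite /= tr_diag_mx.
Qed.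

(** The weight k does not occur in the sub-bimodule generated by f. *)
Definition killed (f : V) (k : weight) := forall x y : S, (x * xi k * y : S) f = 0.

Lemma killed_eps f k :
  (forall g h, (eps g * xi k * eps h : S) f = 0) -> killed f k.
Proof.
move=> H x y; apply: mul_eps_right_eq0 => h; rewrite -mulrA.
by apply: mul_eps_left_eq0 => g; rewrite mulrA.
Qed.

Lemma killed_act f k (z : S) : killed f k -> killed (dual_act z f) k.
Proof. by move=> H x y; rewrite -schur_mulE -mulrA. Qed.

Lemma killed_lin f f' k (c : K) : killed f k -> killed f' k -> killed (c *: f + f') k.
Proof.
move=> H H' x y; have := H x y; have := H' x y; move: (x * xi k * y : S) => z zf' zf.
by rewrite linearP /= zf zf' scaler0 addr0.
Qed.

Lemma eps_xi_eps g h k (f : V) :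
  (eps g * xi k * eps h : S) f = xi k (dual_act (eps h) (ltrans g f)).
Proof. by rewrite -mulrA. Qed.

Lemma two_sided_translate g h (f : V) x :
  subsp_val (dual_act (eps h) (ltrans g f)) x = subsp_val f (g * x * h)%g.
Proof. by rewrite -mulgA. Qed.

End Schur.

(** * Bideterminants *)

(** An initial segment of the indices is recognized by its cardinality. *)
Lemma card_initial n (p : pred 'I_n) :
  (forall i j : 'I_n, (i <= j)%N -> p j -> p i) -> forall i, p i = (i < #|p|)%N.
Proof.
move=> down i; have card_lt (k : 'I_n) : #|[pred j : 'I_n | (j < k)%N]| = k.
  rewrite -sum1_card -(big_ord_widen n (fun=> 1%N) (ltnW (ltn_ord k))).
  by rewrite sum1_card card_ord.
apply/idP/idP => [pi|]; last first.
  apply: contraTT => npi; rewrite -leqNgt -[X in (_ <= X)%N]card_lt.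
  apply: subset_leq_card; apply/fintype.subsetP => j pj; rewrite inE ltnNge; apply: contra npi => ij.
  exact: down ij pj.
have: (#|[pred j : 'I_n | (j <= i)%N]| <= #|p|)%N.
  by apply: subset_leq_card; apply/fintype.subsetP => j ji; apply: down pi.
rewrite (cardD1 i) !inE leqnn add1n; apply: leq_trans; rewrite ltnS -{1}[nat_of_ord i]card_lt.
apply: subset_leq_card; apply/fintype.subsetP => j; rewrite !inE => ji; rewrite (ltnW ji) andbT.
by rewrite -val_eqE /= ltn_eqF.
Qed.

Section Bideterminants.
Variables (K : closedFieldType) (n : nat) (n_gt0 : (0 < n)%N) (d m : nat).
Variable l : dom_weight n d.
Hypothesis dm : (d <= m)%N.
Local Notation G := (GL K n).
Local Notation P := ('I_n * 'I_n)%type.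
Local Notation expo := {ffun P -> 'I_d.+1}.
Local Notation A := (poly_coalg K n_gt0 d).
Local Notation V := (subsp A).
Local Notation S := (dualalg A).

(** The heights of the columns of the Young diagram of l. Bideterminants are
    built with m columns, where m only needs to be at least d: the columns of
    height 0 contribute empty minors. *)
Definition column_height (c : nat) : nat := #|[pred i : 'I_n | (c < l i)%N]|.

Lemma dom_weight_antimono (i j : 'I_n) : (i <= j)%N -> (l j <= l i)%N.
Proof.
by move=> ij; case/andP: (valP l) => /forallP/(_ i)/forallP/(_ j)/implyP/(_ ij).
Qed.

Lemma dom_weight_sum : (\sum_i l i)%N = d.
Proof. by case/andP: (valP l) => _ /eqP. Qed.

Lemma column_heightP c (i : 'I_n) : (c < l i)%N = (i < column_height c)%N.
Proof.
apply: (card_initial (p := [pred i : 'I_n | (c < l i)%N])) => i' j ij /= cj.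
exact: leq_trans cj (dom_weight_antimono ij).
Qed.

Lemma column_height_le c : (column_height c <= n)%N.
Proof. by rewrite -[X in (_ <= X)%N]card_ord max_card. Qed.

Lemma dom_weight_le i : (l i <= m)%N.
Proof. by rewrite (leq_trans _ dm) // -ltnS ltn_ord. Qed.

Definition tableau := {ffun 'I_m -> {ffun 'I_n -> 'I_n}}.
Definition tab0 : tableau := [ffun _ => [ffun i => i]].
Implicit Types (X Y : tableau) (w : {ffun 'I_m -> 'S_n}).

(** Product of the minors taken along the columns of two tableaux of shape l. *)
Definition bidet X Y (g : 'M[K]_n) : K :=
  \prod_(c < m) minor (column_height c) (X c) (Y c) g.

Lemma bidet_tr X Y g : bidet X Y g^T = bidet Y X g.
Proof. by apply: eq_bigr => c _; apply: minor_tr. Qed.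

Definition cell (X Y : tableau) w (c : 'I_m) (j : 'I_n) : P := (X c (w c j), Y c j).

Definition tab_count X Y w (p : P) : nat :=
  (\sum_(c < m) \sum_(j : 'I_n | (j < column_height c)%N) (cell X Y w c j == p))%N.

Lemma sum_cells (F : 'I_m -> 'I_n -> nat) :
  (\sum_(c < m) \sum_(j : 'I_n | (j < column_height c)%N) F c j
   = \sum_j \sum_(c < m | (c < l j)%N) F c j)%N.
Proof.
rewrite (exchange_big_dep xpredT) //=; apply: eq_bigr => j _.
by apply: eq_bigl => c; rewrite column_heightP.
Qed.

Lemma sum_lt_ord b : (b <= m)%N -> (\sum_(c < m | (c < b)%N) 1 = b)%N.
Proof.
by move=> bm; rewrite -(big_ord_widen m (fun=> 1%N) bm) sum1_card card_ord.
Qed.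

(** Each cell of the diagram contributes one factor, and there are d cells. *)
Lemma tab_count_sum X Y w : (\sum_p tab_count X Y w p)%N = d.
Proof.
rewrite exchange_big /=; under eq_bigr do rewrite exchange_big /=.
rewrite -[RHS]dom_weight_sum sum_cells; apply: eq_bigr => j _.
rewrite -[RHS](sum_lt_ord (dom_weight_le j)); apply: eq_bigr => c _.
by rewrite (bigD1 (cell X Y w c j)) //= eqxx big1 ?addn0 // => p; rewrite eq_sym => /negPf ->.
Qed.

Lemma tab_count_le X Y w p : (tab_count X Y w p < d.+1)%N.
Proof. by rewrite ltnS -[X in (_ <= X)%N](tab_count_sum X Y w) (bigD1 p) //= leq_addr. Qed.

Definition tab_expo X Y w : expo := [ffun p => Ordinal (tab_count_le X Y w p)].

Fact tab_expo_deg X Y w : tab_expo X Y w \in @deg_d n d.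
Proof.
rewrite inE /deg; apply/eqP; rewrite -[RHS](tab_count_sum X Y w).
by apply: eq_bigr => p _; rewrite ffunE.
Qed.

Definition tab_dexpo X Y w : dexpo n d := Sub (tab_expo X Y w) (tab_expo_deg X Y w).

Definition tab_perms : {pred {ffun 'I_m -> 'S_n}} :=
  family (fun c : 'I_m => [pred s : 'S_n | fixes_above (column_height c) s]).

Definition bidetV X Y : V :=
  \sum_(w in tab_perms) (\prod_(c < m) (-1) ^+ w c : K) *: monoV K n_gt0 (tab_dexpo X Y w).

Lemma bidetVE X Y (g : G) : subsp_val (bidetV X Y) g = bidet X Y g.
Proof.
rewrite -[LHS]/(eps n_gt0 d g _) linear_sum /bidet /minor.
rewrite (bigA_distr_big_dep (fun (c : 'I_m) s => fixes_above (column_height c) s)) /=.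
apply: eq_bigr => w _; rewrite big_split /=.
rewrite -[LHS]/((\prod_(c < m) (-1) ^+ w c) * mono (tab_expo X Y w) g); congr (_ * _).
rewrite -[LHS]/(\prod_p entries g p ^+ tab_expo X Y w p).
under eq_bigr do rewrite ffunE /= /tab_count.
transitivity (\prod_(c < m) \prod_(j : 'I_n | (j < column_height c)%N)
   \prod_p entries g p ^+ (cell X Y w c j == p)).
  under eq_bigr do rewrite -prodrXr.
  rewrite exchange_big /=; apply: eq_bigr => c _.
  under eq_bigr do rewrite -prodrXr.
  by rewrite exchange_big.
apply: eq_bigr => c _; apply: eq_bigr => j _.
rewrite (bigD1 (cell X Y w c j)) //= eqxx expr1 big1 ?mulr1 // => p.
by rewrite eq_sym => /negPf ->.
Qed.

(** A lower triangular matrix multiplies a minor on the first k rows by its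
    first k diagonal entries; row i has l i cells. *)
Lemma bidetV_induced Y : is_induced l (bidetV tab0 Y).
Proof.
move=> b g tb; rewrite !bidetVE.
have E (x : 'M[K]_n) :
    bidet tab0 Y x = \prod_(c < m) minor (column_height c) id (Y c) x.
  by apply: eq_bigr => c _; apply: eq_minor => j _ //; rewrite !ffunE.
rewrite !E -[GL_mx (b * g)%g]/((b : 'M_n) *m (g : 'M_n)).
transitivity (\prod_(c < m) ((\prod_(j : 'I_n | (j < column_height c)%N) (b : 'M_n) j j)
    * minor (column_height c) id (Y c) (g : 'M_n))).
  by apply: eq_bigr => c _; apply: minor_lower_mul tb; apply: column_height_le.
rewrite big_split /=; congr (_ * _).
rewrite (exchange_big_dep xpredT) //=; apply: eq_bigr => j _.
rewrite (eq_bigl (fun c : 'I_m => c < l j)%N) => [|c]; last by rewrite column_heightP.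
by rewrite prodr_const -sum1_card sum_lt_ord // dom_weight_le.
Qed.

End Bideterminants.

Section Standard.
Variables (K : closedFieldType) (n : nat) (n_gt0 : (0 < n)%N) (d m : nat).
Variable l : dom_weight n d.
Hypothesis dm : (d <= m)%N.
Local Notation G := (GL K n).
Local Notation P := ('I_n * 'I_n)%type.
Local Notation expo := {ffun P -> 'I_d.+1}.
Local Notation A := (poly_coalg K n_gt0 d).
Local Notation V := (subsp A).
Local Notation S := (dualalg A).
Local Notation tableau := (tableau n m).
Local Notation tab0 := (tab0 n m).
Local Notation height := (column_height l).
Local Notation texpo := (@tab_expo n d m l dm).
Local Notation bidetV := (@bidetV K n n_gt0 d m l dm).

Definition wid : {ffun 'I_m -> 'S_n} := [ffun=> 1%g].
Lemma widE c : wid c = 1%g. Proof. by rewrite ffunE. Qed.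

Definition omega (a : expo) : nat := digit_sum (@col_pos n) d.+2 0 (expo_nat a).

Lemma omega_inj : injective omega.
Proof.
move=> a b E; apply/ffunP => p; apply: val_inj.
exact: (@digit_sum_inj _ _ d.+2 (@col_pos_inj n) isT 0 (expo_nat a) (expo_nat b)
  (expo_nat_lt a) (expo_nat_lt b) E p isT).
Qed.

Lemma omega_tab X Y w : omega (texpo X Y w) = (\sum_(c < m)
  \sum_(j : 'I_n | (j < height c)%N) d.+2 ^ col_pos (cell X Y w c j))%N.
Proof.
rewrite /omega /digit_sum.
transitivity (\sum_p \sum_(c < m) \sum_(j : 'I_n | (j < height c)%N)
    (cell X Y w c j == p) * d.+2 ^ col_pos p)%N.
  apply: eq_bigr => p _; rewrite /expo_nat ffunE /= /tab_count big_distrl /=.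
  by apply: eq_bigr => c _; rewrite big_distrl.
rewrite exchange_big /=; apply: eq_bigr => c _; rewrite exchange_big /=.
apply: eq_bigr => j _; rewrite (bigD1 (cell X Y w c j)) //= eqxx mul1n big1 ?addn0 // => p.
by rewrite eq_sym => /negPf ->.
Qed.

Definition column_strict (T : tableau) := forall (c : 'I_m) (i j : 'I_n),
  (i < j)%N -> (j < height c)%N -> (T c i < T c j)%N.

(** Among the monomials of a bideterminant with strictly increasing columns,
    the one on the diagonals of all minors is strictly the least. *)
Lemma omega_tab_lt T w : column_strict T -> w \in tab_perms (m := m) l ->
  w != wid ->
  (omega (texpo tab0 T wid) < omega (texpo tab0 T w))%N.
Proof.
move=> Tinc /familyP wP w1.
have [c0 wc0] : exists c, w c != 1%g.
  apply/existsP; apply: contraNT w1 => /existsPn H; apply/eqP/ffunP => c.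
  by rewrite widE; apply/eqP/negPn/H.
have cE w' c (j : 'I_n) : cell tab0 T w' c j = (w' c j, T c j).
  by rewrite /cell !ffunE.
have le c : (w c == 1%g) || (\sum_(j : 'I_n | (j < height c)%N) d.+2 ^ col_pos (j, T c j)
   < \sum_(j : 'I_n | (j < height c)%N) d.+2 ^ col_pos (w c j, T c j))%N.
  case: eqVneq => //= wc; apply: staircase_min => //; last exact: wP.
  by move=> i j; apply: Tinc.
rewrite !omega_tab (bigD1 c0) //= [X in (_ < X)%N](bigD1 c0) //=.
have E (c : 'I_m) (w' : {ffun 'I_m -> 'S_n}) : (\sum_(j : 'I_n | (j < height c)%N)
    d.+2 ^ col_pos (cell tab0 T w' c j))%N
  = (\sum_(j : 'I_n | (j < height c)%N) d.+2 ^ col_pos (w' c j, T c j))%N.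
  by apply: eq_bigr => j _; rewrite cE.
have E1 (c : 'I_m) : (\sum_(j : 'I_n | (j < height c)%N)
    d.+2 ^ col_pos (cell tab0 T wid c j))%N
  = (\sum_(j : 'I_n | (j < height c)%N) d.+2 ^ col_pos (j, T c j))%N.
  by rewrite E; apply: eq_bigr => j _; rewrite widE perm1.
rewrite E1 E -addSn leq_add //; first by have := le c0; rewrite (negPf wc0).
apply: leq_sum => c _; rewrite E1 E; case/orP: (le c) => [/eqP ->|/ltnW //].
by apply: eq_leq; apply: eq_bigr => j _; rewrite perm1.
Qed.

Lemma coef_bidet X Y a : coef K n_gt0 a (bidetV X Y)
  = \sum_(w in tab_perms (m := m) l) (\prod_(c < m) (-1) ^+ w c) * (a == texpo X Y w)%:R.
Proof.
rewrite linear_sum; apply: eq_bigr => w _.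
rewrite linearZ /=; congr (_ * _).
exact: coef_mono.
Qed.

Lemma coef_bidet_lead T : column_strict T ->
  coef K n_gt0 (texpo tab0 T wid) (bidetV tab0 T) = 1.
Proof.
move=> Tinc; have w1 : wid \in tab_perms (m := m) l.
  by apply/familyP => c; rewrite widE inE fixes_above1.
rewrite coef_bidet (bigD1 wid) //= eqxx mulr1.
rewrite big1 ?mul1r => [|c _]; last by rewrite widE odd_perm1.
rewrite big1 ?addr0 // => w /andP[wP w1'].
case: eqP => [/(congr1 omega) E|_]; last by rewrite mulr0.
by have := omega_tab_lt Tinc wP w1'; rewrite E ltnn.
Qed.

Lemma coef_bidet_ge T a : column_strict T -> coef K n_gt0 a (bidetV tab0 T) != 0 ->
  (omega (texpo tab0 T wid) <= omega a)%N.
Proof.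
move=> Tinc; rewrite coef_bidet leqNgt; apply: contraNN => lt.
rewrite big1 // => w wP; case: eqP => [E|_]; last by rewrite mulr0.
move: lt; rewrite E; case: (eqVneq w wid) => [->|w1]; first by rewrite ltnn.
by rewrite ltnNge (ltnW (omega_tab_lt Tinc wP w1)).
Qed.

(** Conversely, an exponent a with the ballot property is the least monomial
    of a bideterminant: row i of the tableau lists each j with multiplicity
    a(i,j) in increasing order, and the ballot property says that its columns
    increase strictly. *)
Section Tableau.
Variable a : expo.
Definition row_part (i : 'I_n) (t : nat) : nat := (\sum_(k : 'I_n | (k < t)%N) a (i, k))%N.
Hypothesis row_total : forall i, row_part i n = l i.
Hypothesis a_ballot : forall i i' j : 'I_n, i' = i.+1 :> nat ->
  (row_part i' j.+1 <= row_part i j)%N.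

Lemma row_partS i (t : 'I_n) : row_part i t.+1 = (row_part i t + a (i, t))%N.
Proof.
rewrite /row_part (bigD1 t) //= addnC; congr addn; apply: eq_bigl => k.
by rewrite ltnS andbC ltn_neqAle.
Qed.

Lemma row_part_mono i s t : (s <= t)%N -> (row_part i s <= row_part i t)%N.
Proof.
move=> st; rewrite [X in (_ <= X)%N](bigID (fun k : 'I_n => k < s)%N) /=.
apply: leq_trans (leq_addr _ _); apply: eq_leq; apply: eq_bigl => k.
by rewrite andbC; case: ltnP => //= ks; rewrite (leq_trans ks).
Qed.

Lemma ballot_far (i i' j : 'I_n) : (i < i')%N -> (row_part i' j.+1 <= row_part i j)%N.
Proof.
case: i' => i' lt /=; elim: i' lt => // k IH lt; rewrite ltnS leq_eqVlt.
case/orP => [/eqP ik|ik]; first by apply: a_ballot; rewrite /= ik.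
apply: leq_trans (IH (ltnW lt) ik); apply: (@leq_trans (row_part (Ordinal (ltnW lt)) j)).
  exact: a_ballot.
exact: row_part_mono.
Qed.

Definition in_cell (c : nat) (i t : 'I_n) := (row_part i t <= c < row_part i t.+1)%N.

Definition row_tableau : tableau :=
  [ffun c : 'I_m => [ffun i => odflt i [pick t | in_cell c i t]]].

Lemma row_tableauP (c : 'I_m) i : (c < l i)%N -> in_cell c i (row_tableau c i).
Proof.
move=> cl; rewrite !ffunE; case: pickP => [t //|no]; exfalso.
have H t : (t <= n)%N -> (row_part i t <= c)%N.
  elim: t => [|t IH] tn; first by rewrite /row_part big_pred0.
  have := no (Ordinal tn); rewrite /in_cell /= IH ?(ltnW tn) //= => /negbT.
  by rewrite -leqNgt.
by have := H n (leqnn n); rewrite row_total leqNgt cl.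
Qed.

Lemma in_cell_uniq c i s t : in_cell c i s -> in_cell c i t -> s = t.
Proof.
move=> /andP[s1 s2] /andP[t1 t2]; apply: val_inj; apply/eqP.
rewrite eqn_leq; apply/andP; split; rewrite leqNgt; apply/negP => lt.
  by have := leq_trans t2 (leq_trans (row_part_mono i lt) s1); rewrite ltnn.
by have := leq_trans s2 (leq_trans (row_part_mono i lt) t1); rewrite ltnn.
Qed.

Lemma row_tableau_strict : column_strict row_tableau.
Proof.
move=> c i j ij jh.
have cj : (c < l j)%N by rewrite column_heightP.
have ci : (c < l i)%N by rewrite column_heightP (ltn_trans ij).
have /andP[_ jc] := row_tableauP cj; have /andP[ic _] := row_tableauP ci.
rewrite ltnNge; apply/negP => le.
have := leq_trans jc (leq_trans (ballot_far _ ij) (leq_trans (row_part_mono i le) ic)).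
by rewrite ltnn.
Qed.

Lemma count_interval b e : (b <= e)%N -> (e <= m)%N ->
  (\sum_(c < m) ((b <= c) && (c < e)) = e - b)%N.
Proof.
move=> be em; have := sum_lt_ord em; have := sum_lt_ord (leq_trans be em).
rewrite !(big_mkcond (fun c : 'I_m => c < _)%N) /= => E1 E2.
suff E : (\sum_(c < m) ((b <= c) && (c < e)) + b = e)%N by rewrite -[in RHS]E addnK.
rewrite -[X in (_ + X = _)%N]E1 -[RHS]E2 -big_split /=; apply: eq_bigr => c _.
case: ltnP => cb; case: ltnP => ce //.
by have := leq_trans ce (leq_trans be cb); rewrite ltnn.
Qed.

Lemma row_tableau_expo : texpo tab0 row_tableau wid = a.
Proof.
apply/ffunP => -[i t]; apply: val_inj; rewrite ffunE /= /tab_count.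
transitivity (\sum_(c < m) (in_cell c i t))%N; last first.
  have mono := row_part_mono i (leqnSn t).
  have top := row_part_mono i (ltn_ord t); rewrite row_total in top.
  by rewrite count_interval ?(leq_trans top (dom_weight_le l dm i)) // row_partS addKn.
apply: eq_bigr => c _.
have cE (j : 'I_n) : cell tab0 row_tableau wid c j = (j, row_tableau c j).
  by rewrite /cell widE perm1 !ffunE.
under eq_bigr do rewrite cE xpair_eqE.
case: (ltnP i (height c)) => ih.
  rewrite (bigD1 i) //= eqxx /= big1 ?addn0 => [|j /andP[_ /negPf ->] //].
  have ic := row_tableauP (etrans (column_heightP l c i) ih); congr nat_of_bool.
  apply/eqP/idP => [<-//|]; exact: in_cell_uniq.
rewrite big1 => [|j jh]; last by case: eqP => // ji; move: jh; rewrite ji ltnNge ih.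
case: (boolP (in_cell c i t)) => // /andP[_ lt]; exfalso.
have top := row_part_mono i (ltn_ord t); rewrite row_total in top.
by move: ih; rewrite leqNgt -column_heightP (leq_trans lt top).
Qed.

End Tableau.

End Standard.

(** * Bideterminants span the induced modules *)

(** Polynomial identities on the group extend to all matrices. *)
Lemma pev_mul_dense (K : closedFieldType) n d (c : {ffun 'I_n * 'I_n -> 'I_d.+1} -> K)
    (B X : 'M[K]_n) :
  (forall g : GL K n, pev c (entries (B *m (g : 'M_n))) = pev c (entries (g : 'M_n))) ->
  pev c (entries (B *m X)) = pev c (entries X).
Proof.
move=> H; apply/eqP; rewrite -subr_eq0; apply/eqP.
pose XX : 'M[{poly K}]_n := map_mx polyC X + 'X%:M.
pose cP := fun a => (c a)%:P.
pose q := pev cP (entries (map_mx polyC B *m XX)) - pev cP (entries XX).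
apply: (@unitmx_dense K n (fun Y => pev c (entries (B *m Y)) - pev c (entries Y)) q).
  move=> z; rewrite /q hornerD hornerN !pev_horner.
  have XXz i j : (XX i j).[z] = (X + z%:M) i j.
    by rewrite !mxE hornerD hornerC hornerMn hornerX.
  congr (_ - _); apply: eq_pev => -[i j]; rewrite /entries /=; last by rewrite XXz.
  rewrite !mxE horner_sum; apply: eq_bigr => k _.
  by rewrite hornerM XXz; congr (_ * _); rewrite mxE hornerC.
by move=> Y Yu; rewrite (H (MkGL Yu)) subrr.
Qed.

Section Span.
Variables (K : closedFieldType) (n : nat) (n_gt0 : (0 < n)%N) (d m : nat).
Variable l : dom_weight n d.
Hypothesis dm : (d <= m)%N.
Local Notation G := (GL K n).
Local Notation P := ('I_n * 'I_n)%type.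
Local Notation expo := {ffun P -> 'I_d.+1}.
Local Notation A := (poly_coalg K n_gt0 d).
Local Notation V := (subsp A).
Local Notation S := (dualalg A).
Local Notation tableau := (tableau n m).
Local Notation tab0 := (tab0 n m).
Local Notation texpo := (@tab_expo n d m l dm).
Local Notation bidetV := (@bidetV K n n_gt0 d m l dm).

Lemma induced_row_sum (f : V) : is_induced l f ->
  forall a, coefs f a != 0 -> forall i, (\sum_k a (i, k))%N = l i.
Proof.
move=> If a ca i.
suff H z : z != 0 -> coefs f a * (z ^+ (\sum_k a (i, k)) - z ^+ l i) = 0.
  have : 'X^(\sum_k a (i, k)) - 'X^(l i) = 0 :> {poly K}.
    apply: (@poly_eq0_open K _ 'X); first by rewrite polyX_eq0.
    move=> z; rewrite hornerX => /H/eqP; rewrite mulf_eq0 (negPf ca) /= => /eqP.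
    by rewrite hornerD hornerN !hornerXn.
  move/eqP; rewrite subr_eq0 => /eqP/(congr1 (fun p : {poly K} => size p)).
  by rewrite !size_polyXn => -[].
move=> z0; pose t (k : 'I_n) := if k == i then z else 1.
have t0 k : t k != 0 by rewrite /t; case: ifP; rewrite ?oner_neq0.
have pt (e : 'I_n -> nat) : \prod_k t k ^+ e k = z ^+ e i.
  rewrite (bigD1 i) //= /t eqxx big1 ?mulr1 // => k /negPf ->.
  by rewrite expr1n.
have trig : is_trig_mx (torus t0 : 'M_n).
  by apply/is_trig_mxP => k q kq; rewrite /= !mxE -val_eqE /= ltn_eqF.
pose c1 b := coefs f b * z ^+ (\sum_k b (i, k)).
have E1 : coefs (ltrans (torus t0) f) = c1.
  apply: coefs_uniq => g; rewrite -[LHS]/(subsp_val f (torus t0 * g)%g) coefsE.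
  apply: eq_bigr => b _; rewrite /c1 -mulrA; congr (_ * _).
  under eq_bigr do rewrite torus_mul_entries exprMn.
  rewrite big_split /=; congr (_ * _).
  rewrite -(pt (fun k => \sum_q b (k, q))%N).
  under [RHS]eq_bigr do rewrite -prodrXr.
  by rewrite pair_bigA; apply: eq_bigr => -[].
pose c2 b := coefs f b * z ^+ l i.
have E2 : coefs (ltrans (torus t0) f) = c2.
  apply: coefs_uniq => g; rewrite -[LHS]/(subsp_val f (torus t0 * g)%g) If //.
  rewrite (eq_bigr (fun k => t k ^+ l k)) => [|k _]; last by rewrite /= !mxE eqxx.
  rewrite pt coefsE /pev mulr_sumr; apply: eq_bigr => b _; rewrite /c2.
  by rewrite mulrCA mulrA.
by have := congr1 (fun c => c a) (etrans (esym E1) E2); rewrite /c1 /c2 mulrBr => ->; rewrite subrr.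
Qed.

Lemma induced_row_inv (f : V) : is_induced l f ->
  forall i i' : 'I_n, i' = i.+1 :> nat ->
  forall t x, pev (coefs f) (row_add i i' t x) = pev (coefs f) x.
Proof.
move=> If i i' ii' t x.
pose B : 'M[K]_n := \matrix_(k, q) ((k == q)%:R + t * ((k == i') && (q == i))%:R).
have Btrig : is_trig_mx B.
  apply/is_trig_mxP => k q kq; rewrite mxE -val_eqE /= ltn_eqF // add0r.
  case: andP => [[/eqP E /eqP F]|_]; last by rewrite mulr0.
  by move: kq; rewrite E F ii' ltnNge leqnSn.
have Bdiag k : B k k = 1.
  rewrite mxE eqxx; case: andP => [[/eqP -> /eqP E]|_]; last by rewrite mulr0 addr0.
  by have := ii'; rewrite E => /eqP; rewrite ltn_eqF.
have Bu : B \in unitmx by rewrite unitmxE det_trig // big1 ?unitr1.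
have BE (X : 'M[K]_n) : entries (B *m X) =1 row_add i i' t (entries X).
  move=> [k q]; rewrite /entries /row_add /= mxE (bigD1 k) //= !mxE eqxx.
  case: (eqVneq k i') => [->|ki] /=.
    have ni : (i' == i) = false by apply: contraTF isT => /eqP E; move: ii'; rewrite E => /eqP; rewrite ltn_eqF.
    rewrite ni mulr0 addr0 mul1r (bigD1 i) ?[i == i']eq_sym ?ni //= !mxE ni !eqxx /= add0r mulr1 big1 ?addr0 // => k' /andP[ki' /negPf k'i].
    by rewrite mxE eq_sym (negPf ki') k'i andbF mulr0 addr0 mul0r.
  rewrite mulr0 addr0 mul1r big1 ?addr0 // => k' kk'.
  by rewrite mxE (negPf ki) /= mulr0 addr0 eq_sym (negPf kk') mul0r.
pose X : 'M[K]_n := \matrix_(k, q) x (k, q).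
have Xx : entries X =1 x by move=> [k q]; rewrite /entries mxE.
rewrite -(eq_pev _ Xx) -(pev_mul_dense (B := B)).
  apply: eq_pev => p; rewrite BE /row_add !Xx //.
move=> g; rewrite -coefsE -[RHS]mul1r.
have := If (MkGL Bu) g Btrig; rewrite coefsE => ->.
by rewrite big1 // => k _; rewrite /= Bdiag expr1n.
Qed.

Definition bidet_span (f : V) : Prop :=
  exists c : tableau -> K, f = \sum_Y c Y *: bidetV tab0 Y.

(** Least monomials of elements of the induced module are standard: this
    combines the ballot condition with the row sums, which are prescribed by
    the torus. *)
Lemma induced_lead (f : V) (a0 : expo) : is_induced l f -> coefs f a0 != 0 ->
  (forall a, coefs f a != 0 -> (omega a0 <= omega a)%N) ->
  exists2 T, column_strict l T & texpo tab0 T (wid n m) = a0.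
Proof.
move=> If a0c a0min.
have tot i : row_part a0 i n = l i.
  rewrite -(induced_row_sum If a0c); apply: eq_bigl => k; exact: ltn_ord.
have bal (i i' j : 'I_n) : i' = i.+1 :> nat -> (row_part a0 i' j.+1 <= row_part a0 i j)%N.
  exact: (ballot (induced_row_sum If) (induced_row_inv If) a0c a0min).
exists (row_tableau m a0); first exact: row_tableau_strict tot bal.
exact: row_tableau_expo tot.
Qed.

(** The bideterminants with first tableau the identity span the induced
    module: subtracting the one with the same least monomial moves the least
    monomial up, and there are finitely many monomials. *)
Theorem induced_bidet_span (f : V) : is_induced l f -> bidet_span f.
Proof.
pose B := (\max_(a : expo) omega a).+1.
have ltB (a : expo) : (omega a < B)%N by rewrite ltnS leq_bigmax.
suff H k : forall f : V, is_induced l f ->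
    (forall a, coefs f a != 0 -> (B - k <= omega a)%N) -> bidet_span f.
  by move=> If; apply: (H B) => // a _; rewrite subnn.
elim: k => [|k IH] {}f If fB; last first.
  case: (pickP (fun a => coefs f a != 0)) => [a1 a1c|f0]; last first.
    by apply: IH => // a; rewrite f0.
  case: (@arg_minnP _ a1 (fun a => coefs f a != 0) (@omega n d) a1c) => a0 a0c a0min.
  have [T Tinc Ta] := induced_lead If a0c a0min.
  pose f' : V := - (coefs f a0 : K) *: bidetV tab0 T + f.
  have cE a : coefs f' a = - coefs f a0 * coef K n_gt0 a (bidetV tab0 T) + coefs f a.
    exact: (coefs_linear a (- coefs f a0) (bidetV tab0 T) f).
  have [|a ca|c fc] := IH f'.
  - move=> b g tb; have E h : subsp_val f' h
        = - coefs f a0 * subsp_val (bidetV tab0 T) h + subsp_val f h by [].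
    by rewrite !E (bidetV_induced _ _ _ T _ tb) // If // mulrDr mulrCA.
  - have aa0 : a != a0.
      apply: contraNneq ca => ->; rewrite cE -{2}Ta coef_bidet_lead //.
      by rewrite mulr1 addNr.
    have : (omega a0 <= omega a)%N.
      case: (eqVneq (coefs f a) 0) => [fa|/a0min //].
      have ba : coef K n_gt0 a (bidetV tab0 T) != 0.
        by apply: contraNneq ca => E; rewrite cE E fa mulr0 addr0.
      by rewrite -Ta (coef_bidet_ge Tinc ba).
    rewrite leq_eqVlt => /orP[/eqP/omega_inj E|lt]; first by rewrite E eqxx in aa0.
    have := fB a0 a0c; lia.
  - exists (fun Y => c Y + (Y == T)%:R * coefs f a0).
    have fE : f = f' + (coefs f a0 : K) *: bidetV tab0 T.
      by rewrite /f' addrAC scaleNr addNr add0r.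
    rewrite [LHS]fE fc; under [RHS]eq_bigr do rewrite scalerDl.
    rewrite big_split /=; congr (_ + _); rewrite (bigD1 T) //= eqxx mul1r.
    by rewrite big1 ?addr0 // => Y /negPf ->; rewrite mul0r scale0r.
exists (fun=> 0); rewrite big1 => [|Y _]; last by rewrite scale0r.
rewrite [f]V_mono big1 // => a _; suff -> : coef K n_gt0 (val a) f = 0 by rewrite scale0r.
apply/eqP; apply: contraT => /fB; rewrite subn0.
by rewrite leqNgt ltB.
Qed.

(** In a spanning family of a finite-dimensional space, coefficients can be
    chosen as linear functions of the vector, by means of a generalized
    inverse. *)
Lemma bidet_coordinates : exists x : tableau -> S, forall f : V, is_induced l f ->
  f = \sum_Y (x Y f : K) *: bidetV tab0 Y.
Proof.
pose crd (f : V) : 'rV[K]_#|{: dexpo n d}| := \row_a coef K n_gt0 (val (enum_val a)) f.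
pose BM : 'M[K]_(#|{: tableau}|, #|{: dexpo n d}|) :=
  \matrix_(Y, a) coef K n_gt0 (val (enum_val a)) (bidetV tab0 (enum_val Y)).
have crd_lin (I : finType) (c : I -> K) (F : I -> V) :
    crd (\sum_i c i *: F i) = \sum_i c i *: crd (F i).
  apply/rowP => a; rewrite mxE linear_sum summxE; apply: eq_bigr => i _.
  by rewrite linearZ !mxE.
have crd_inj f f' : crd f = crd f' -> f = f'.
  move=> E; rewrite [f]V_mono [f']V_mono; apply: eq_bigr => a _; congr (_ *: _).
  by have /rowP/(_ (enum_rank a)) := E; rewrite !mxE enum_rankK.
exists (fun Y => \sum_a (pinvmx BM a (enum_rank Y) : K) *: coef K n_gt0 (val (enum_val a))).
move=> f If; apply: crd_inj; rewrite crd_lin.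
have sub : (crd f <= BM)%MS.
  have [c ->] := induced_bidet_span If; rewrite crd_lin; apply: summx_sub => Y _.
  apply: scalemx_sub; apply: (eq_row_sub (enum_rank Y)); apply/rowP => a.
  by rewrite !mxE enum_rankK.
rewrite -[LHS](mulmxKpV sub); apply/rowP => a; rewrite mxE summxE.
rewrite [RHS](reindex_onto enum_val enum_rank) /= => [|Y _]; last exact: enum_rankK.
apply: eq_big => [Y|Y _]; first by rewrite enum_valK eqxx.
rewrite !mxE; congr (_ * _).
rewrite enum_valK.
pose F a : S := (pinvmx BM a Y : K) *: coef K n_gt0 (val (enum_val a)).
rewrite -[(\sum_a _ : S) f]/((\sum_a F a : S) f) schur_sumE.
by apply: eq_bigr => b _; rewrite mxE mulrC.
Qed.

End Span.

(** * Highest weights of bideterminants *)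

Lemma extend_to_perm n k (f : 'I_n -> 'I_n) :
  (forall i j : 'I_n, (i < k)%N -> (j < k)%N -> f i = f j -> i = j) ->
  exists p : 'S_n, forall j : 'I_n, (j < k)%N -> p j = f j.
Proof.
elim: k => [|k IH] finj; first by exists 1%g.
have [i j ik jk|p pf] := IH; first by apply: finj; apply: ltnW.
case: (ltnP k n) => [kn|nk]; last by exists p => j _; rewrite pf // (leq_trans _ nk).
pose k0 := Ordinal kn; exists (tperm k0 (p^-1%g (f k0)) * p)%g => j.
rewrite ltnS leq_eqVlt permM => /orP[/eqP jk|jk].
  by rewrite (_ : j = k0) ?tpermL ?permKV //; apply: val_inj.
rewrite tpermD ?pf //; first by rewrite -val_eqE /= gtn_eqF.
rewrite -(inj_eq (@perm_inj _ p)) permKV pf //; apply/eqP => E.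
by have := finj k0 j (ltnSn _) (ltnW jk) E; move/(congr1 val) => /= kj; rewrite kj ltnn in jk.
Qed.

(** The k largest values of W are those at the first k indices; an index
    outside costs at least one unit. *)
Lemma sum_injective_le n k (W : 'I_n -> nat) (f : 'I_n -> 'I_n) :
  (forall i j : 'I_n, (i < j)%N -> (W j < W i)%N) ->
  (forall i j : 'I_n, (i < k)%N -> (j < k)%N -> f i = f j -> i = j) ->
  (\sum_(j : 'I_n | (j < k)%N) W (f j) + \sum_(j : 'I_n | (j < k)%N) (k <= f j)
   <= \sum_(j : 'I_n | (j < k)%N) W j)%N.
Proof.
move=> Wdec finj.
pose I := [set j : 'I_n | (j < k)%N]; pose J := [set f j | j in I].
have inI j : (j \in I) = (j < k)%N by rewrite inE.
have fI : {in I &, injective f} by move=> i j; rewrite !inI; apply: finj.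
have sumI (F : 'I_n -> nat) : (\sum_(j : 'I_n | (j < k)%N) F j = \sum_(j in I) F j)%N.
  by apply: eq_bigl => j; rewrite inI.
rewrite !sumI -(big_imset W fI) -(big_imset (fun j : 'I_n => nat_of_bool (k <= j)%N) fI) /= -/J.
have card_diff : #|J :\: I| = #|I :\: J|.
  have := cardsID I J; have := cardsID J I; rewrite finset.setIC card_in_imset //.
  by move=> <- /addnI.
rewrite (big_setID I) [X in (_ + X <= _)%N](big_setID I) /= [X in (_ <= X)%N](big_setID J) /=.
rewrite [I :&: J]finset.setIC [X in (_ + (X + _) <= _)%N]big1 => [|j]; last first.
  by rewrite inE inI => /andP[_ jk]; rewrite leqNgt jk.
rewrite add0n -addnA leq_add2l.
case: (set_0Vmem (J :\: I)) => [JI0|[j0 j0J]].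
  by rewrite JI0 !big_set0.
have kn : (k < n)%N.
  by move: j0J; rewrite inE inI -leqNgt => /andP[kj _]; apply: leq_ltn_trans kj (ltn_ord j0).
pose theta := W (Ordinal kn).
have up (j : 'I_n) : (j < k)%N -> (theta < W j)%N by move=> jk; apply: Wdec.
have dn (j : 'I_n) : (k <= j)%N -> (W j <= theta)%N.
  rewrite leq_eqVlt => /orP[/eqP kj|kj]; last by apply/ltnW/Wdec.
  by rewrite /theta (_ : Ordinal kn = j) //; apply: val_inj.
apply: (@leq_trans (#|J :\: I| * theta.+1)); last first.
  rewrite card_diff -sum_nat_const; apply: leq_sum => j; rewrite inE inI => /andP[_ jk].
  exact: up.
rewrite -big_split /= -sum_nat_const; apply: leq_sum => j.
rewrite inE inI -leqNgt => /andP[kj _].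
by rewrite kj addn1 ltnS dn.
Qed.

Section TopCoef.
Variable R : comNzRingType.

Lemma top_coef_lower e f (x : R) p : (e < f)%N -> top_coef e x p -> top_coef f 0 p.
Proof.
move=> ef [sp _]; split; first by apply: leq_trans sp _; apply: ltnW.
by rewrite nth_default // (leq_trans sp).
Qed.

Lemma top_coefD e (x y : R) p q :
  top_coef e x p -> top_coef e y q -> top_coef e (x + y) (p + q).
Proof.
move=> [sp <-] [sq <-]; split; last by rewrite coefD.
by rewrite (leq_trans (size_polyD _ _)) // geq_max sp sq.
Qed.

Lemma top_coef0 e : top_coef e 0 (0 : {poly R}).
Proof. by split; rewrite ?size_poly0 ?coef0. Qed.

Lemma top_coef_sum e (I : finType) (P : pred I) (x : I -> R) p :
  (forall i, P i -> top_coef e (x i) (p i)) ->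
  top_coef e (\sum_(i | P i) x i) (\sum_(i | P i) p i).
Proof.
move=> H; elim/big_rec2: _ => [|i y q Pi]; first exact: top_coef0.
by apply: top_coefD; apply: H.
Qed.

Lemma top_coefXn e : top_coef e 1 ('X^e : {poly R}).
Proof. by split; rewrite ?size_polyXn ?coefXn ?eqxx. Qed.

(** The leading term, for the torus acting in the middle, of a minor of g T h:
    the top power of X is only reached when the middle indices are the first k
    ones, in some order, and these terms add up to a product of two minors. *)
Lemma minor_top n k (W : 'I_n -> nat) (P Q : 'I_n -> 'I_n) (g h : 'M[R]_n) :
  (forall i j : 'I_n, (i < j)%N -> (W j < W i)%N) ->
  top_coef (\sum_(j : 'I_n | (j < k)%N) W j)%N (minor k P id g * minor k id Q h)
    (minor k P Q (map_mx polyC g *m (diag_mx (\row_i 'X^(W i)) *m map_mx polyC h))).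
Proof.
move=> Wdec; rewrite minor_mul.
pose permf (s : 'S_n) : {ffun 'I_n -> 'I_n} := [ffun j => s j].
pose unperm (f : {ffun 'I_n -> 'I_n}) : 'S_n := odflt 1%g [pick s | permf s == f].
pose isperm f := (permf (unperm f) == f) && fixes_above k (unperm f).
have permK s : unperm (permf s) = s.
  rewrite /unperm; case: pickP => [t /eqP ts|/(_ s)]; last by rewrite eqxx.
  by apply/permP => j; have := congr1 (fun f : {ffun _ -> _} => f j) ts; rewrite !ffunE.
pose C f := if isperm f then
  (-1) ^+ unperm f * minor k P id g * \prod_(j : 'I_n | (j < k)%N) h (f j) (Q j) else 0.
have -> : minor k P id g * minor k id Q h = \sum_f C f.
  rewrite -big_mkcond (reindex_onto permf unperm) /= => [|f /andP[/eqP //]].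
  rewrite {2}/minor mulr_sumr; apply: eq_big => s; rewrite /isperm permK ?eqxx ?andbT //.
  move=> _; rewrite mulrCA mulrA; congr (_ * _); apply: eq_bigr => j _.
  by rewrite ffunE.
apply: top_coef_sum => f _.
have mE : minor k P f (map_mx polyC g) = (minor k P f g)%:P by rewrite -minor_map.
rewrite {}mE.
have dich : (forall j : 'I_n, (k <= j)%N -> f j = j)
    \/ exists2 j : 'I_n, (k <= j)%N & f j != j.
  case: (boolP [forall j : 'I_n, (k <= j)%N ==> (f j == j)]) => [/forallP H|].
    by left=> j kj; apply/eqP; move: (H j); rewrite kj.
  by case/forallPn => j; rewrite negb_imply => /andP[kj fj]; right; exists j.
case: dich => [fabove|[j kj fj]]; last first.
  rewrite [X in X * _](_ : _ = 0) => [|]; last first.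
    by rewrite (bigD1 j) //= ltnNge kj /= (negPf fj) mul0r.
  rewrite mul0r /C /isperm.
  case: andP => [[/eqP ff /fixes_aboveP fa]|_]; last exact: top_coef0.
  by have := fa j kj; move/eqP: fj; rewrite -{1}ff ffunE => /[apply].
case: (boolP [forall i : 'I_n, forall j : 'I_n,
    [&& (i < k)%N, (j < k)%N & f i == f j] ==> (i == j)]); last first.
  case/forallPn => i /forallPn[j]; rewrite negb_imply => /andP[/and3P[ik jk /eqP fij] ij].
  rewrite (minor_repeat _ _ ij ik jk fij) polyC0 mulr0 /C /isperm.
  case: andP => [[/eqP ff _]|_]; last exact: top_coef0.
  by move: fij ij; rewrite -ff !ffunE => /perm_inj ->; rewrite eqxx.
move=> /forallP Hinj.
have finj (i j : 'I_n) : (i < k)%N -> (j < k)%N -> f i = f j -> i = j.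
  by move=> ik jk fij; apply/eqP; move/forallP/(_ j): (Hinj i); rewrite ik jk fij eqxx.
have le := sum_injective_le Wdec finj.
pose e := (\sum_(j : 'I_n | (j < k)%N) W (f j))%N.
have prodE : \prod_(j : 'I_n) (if (j < k)%N then
     (diag_mx (\row_i 'X^(W i)) *m map_mx polyC h) (f j) (Q j) else (f j == j)%:R)
   = \prod_(j : 'I_n | (j < k)%N) ('X^(W (f j)) * (h (f j) (Q j))%:P).
  rewrite [RHS]big_mkcond; apply: eq_bigr => j _; case: ltnP => jk.
    by rewrite mul_diag_mx !mxE.
  by rewrite fabove // eqxx.
have topf : top_coef e ((\prod_(j : 'I_n | (j < k)%N) h (f j) (Q j)) * minor k P f g)
    ((\prod_(j : 'I_n | (j < k)%N) ('X^(W (f j)) * (h (f j) (Q j))%:P)) * (minor k P f g)%:P).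
  rewrite -[e]addn0; apply: top_coefM; last exact: top_coefC.
  apply: top_coef_prod => j jk.
  by have := top_coefM (top_coefXn (W (f j))) (top_coefC (h (f j) (Q j))); rewrite addn0 mul1r.
rewrite prodE.
case: (boolP [forall j : 'I_n, (j < k)%N ==> (f j < k)%N]) => [/forallP fk|]; last first.
  case/forallPn => j; rewrite negb_imply -leqNgt => /andP[jk kfj].
  have -> : C f = 0.
    rewrite /C /isperm; case: andP => [[/eqP ff fa]|//].
    by move: kfj; rewrite -ff ffunE leqNgt fixes_above_lt // jk.
  apply: top_coef_lower topf; apply: leq_trans le.
  by rewrite (bigD1 j jk) [X in (_ + X)%N](bigD1 j jk) /= kfj; rewrite /e (bigD1 j jk) /=; lia.
have fI : injective f.
  move=> i j fij; case: (ltnP i k) => ik; case: (ltnP j k) => jk.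
  - exact: finj.
  - by have := implyP (fk i) ik; rewrite fij fabove // ltnNge jk.
  - by have := implyP (fk j) jk; rewrite -fij fabove // ltnNge ik.
  - by rewrite -(fabove i ik) -(fabove j jk).
have [s sf] : exists s, permf s = f.
  by exists (perm fI); apply/ffunP => j; rewrite ffunE permE.
have sa : fixes_above k s.
  by apply/fixes_aboveP => j kj; rewrite -[RHS](fabove j kj) -sf ffunE.
have us : unperm f = s by rewrite -sf permK.
have -> : C f = (\prod_(j : 'I_n | (j < k)%N) h (f j) (Q j)) * minor k P f g.
  rewrite /C /isperm us sf eqxx sa /= mulrC; congr (_ * _).
  by rewrite -minor_perm //; apply: eq_minor => j _ //; rewrite -sf ffunE.
suff <- : e = (\sum_(j : 'I_n | (j < k)%N) W j)%N by [].
rewrite [RHS](reindex_inj (@perm_inj _ s)) /=; apply: eq_big => j.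
  by rewrite fixes_above_lt.
by rewrite -sf ffunE.
Qed.

End TopCoef.

Section BidetWeights.
Variables (K : closedFieldType) (n : nat) (n_gt0 : (0 < n)%N) (d m : nat).
Variable l : dom_weight n d.
Hypothesis dm : (d <= m)%N.
Local Notation G := (GL K n).
Local Notation weight := {ffun 'I_n -> 'I_d.+1}.
Local Notation A := (poly_coalg K n_gt0 d).
Local Notation V := (subsp A).
Local Notation S := (dualalg A).
Local Notation tableau := (tableau n m).
Local Notation tab0 := (tab0 n m).
Local Notation bidet := (@bidet K n d m l).
Local Notation bidetV := (@bidetV K n n_gt0 d m l dm).
Local Notation W := (fun i : 'I_n => (d.+2 ^ (n.-1 - i))%N).
Local Notation xi := (xi K n_gt0).
Local Notation eps := (eps n_gt0 d).

Lemma W_decr (i j : 'I_n) : (i < j)%N -> (W j < W i)%N.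
Proof.
clear n_gt0 dm; move=> ij; rewrite /= ltn_exp2l //; have := ltn_ord j; move: ij.
by move: (nat_of_ord i) (nat_of_ord j) => a b; lia.
Qed.

(** The substitution t i = X ^ W i separates weights, a weight k contributing
    X ^ (Omega k); the top weight of a bideterminant of shape l is l. *)
Lemma xi_bidet_coef X Y (g h : G) : exists p : {poly K},
  top_coef (Omega (dw_ffun l)) (bidet X tab0 g * bidet tab0 Y h) p /\
  forall k, (eps g * xi k * eps h : S) (bidetV X Y) = p`_(Omega k).
Proof.
pose gP : 'M[{poly K}]_n := map_mx polyC g; pose hP : 'M[{poly K}]_n := map_mx polyC h.
pose T : 'M[{poly K}]_n := diag_mx (\row_i 'X^(W i)).
pose p := \prod_(c < m) minor (column_height l c) (X c) (Y c) (gP *m (T *m hP)).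
exists p; split.
  have -> : Omega (dw_ffun l) =
      (\sum_(c < m) \sum_(j : 'I_n | (j < column_height l c)%N) W j)%N.
    rewrite sum_cells; apply: eq_bigr => i _.
    by rewrite -[in RHS](mul1n (W i)) -big_distrl /= (sum_lt_ord (dom_weight_le l dm i)).
  rewrite /bidet -big_split /=; apply: top_coef_prod => c _.
  have E (P : 'I_n -> 'I_n) x : minor (column_height l c) P (tab0 c) x
      = minor (column_height l c) P id x :> K.
    by apply: eq_minor => j _ //; rewrite !ffunE.
  have E' (Q : 'I_n -> 'I_n) x : minor (column_height l c) (tab0 c) Q x
      = minor (column_height l c) id Q x :> K.
    by apply: eq_minor => j _ //; rewrite !ffunE.
  rewrite E // E' //; exact: (minor_top _ _ _ _ _ W_decr).
move=> k; rewrite eps_xi_eps.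
set F := dual_act _ _.
have -> : p = \sum_k (xi k F : K) *: 'X^(Omega k).
  apply/eqP; rewrite -subr_eq0; apply/eqP.
  apply: (@poly_eq0_open K _ 'X); first by rewrite polyX_eq0.
  move=> z; rewrite hornerX => z0; apply/eqP.
  rewrite hornerD hornerN subr_eq0 horner_sum; apply/eqP.
  have t0 i : z ^+ W i != 0 by rewrite expf_neq0.
  transitivity (subsp_val F (torus t0)).
    rewrite two_sided_translate bidetVE /p horner_prod; apply: eq_bigr => c _.
    rewrite -horner_evalE minor_map; congr minor.
    rewrite -[GL_mx _]/((g : 'M_n) *m diag_mx (\row_i z ^+ W i) *m (h : 'M_n)).
    have evC (x : 'M[K]_n) : map_mx (horner_eval z) (map_mx polyC x) = x.
      by apply/matrixP => i j; rewrite !mxE /= horner_evalE hornerC.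
    have evT : map_mx (horner_eval z) T = diag_mx (\row_i z ^+ W i).
      by apply/matrixP => i j; rewrite !mxE /= horner_evalE hornerMn hornerXn.
    by rewrite !map_mxM /= -mulmxA !evC evT.
  rewrite xi_torus; apply: eq_bigr => k' _; rewrite hornerZ hornerXn; congr (_ * _).
  rewrite /Omega -prodrXr; apply: eq_bigr => i _.
  by rewrite -exprM mulnC.
rewrite coef_sum (bigD1 k) //= coefZ coefXn eqxx mulr1 big1 ?addr0 // => k' kk'.
by rewrite coefZ coefXn (inj_eq (@Omega_inj n d)) eq_sym (negPf kk') mulr0.
Qed.

Lemma pair_scale (x y z : S) (c : K) (f : V) :
  (x * (c *: y) * z : S) f = c * (x * y * z : S) f.
Proof.
have -> : x * (c *: y) * z = c *: (x * y * z : S).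
  transitivity ((c *: (x * y)) * z : S); last exact: esym (scalerAl c (x * y) z).
  by congr (_ * _); apply: esym (scalerAr c x y).
by [].
Qed.

Lemma bidet_killed X Y k : (Omega (dw_ffun l) < Omega k)%N -> killed (bidetV X Y) k.
Proof.
move=> lk; apply: killed_eps => g h.
have [p [[sp _] ->]] := xi_bidet_coef X Y g h.
by rewrite nth_default // (leq_trans sp).
Qed.

Lemma bidet_xi_top X Y (g h : G) :
  (eps g * xi (dw_ffun l) * eps h : S) (bidetV X Y) = bidet X tab0 g * bidet tab0 Y h.
Proof. by have [p [[_ <-] ->]] := xi_bidet_coef X Y g h. Qed.

(** If l is the highest weight of the bimodule generated by f, then the
    component (eps g * xi l * eps h) f lies in the induced module as a
    function of h, and in its transpose as a function of g. Both are spanned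
    by bideterminants, and the products of bideterminants obtained in this way
    are the top components of bideterminants. *)
Lemma subtract_top (f : V) :
  (forall k, (Omega (dw_ffun l) < Omega k)%N -> killed f k) ->
  exists c : tableau -> tableau -> K,
    killed (f - \sum_X \sum_Y c X Y *: bidetV X Y) (dw_ffun l).
Proof.
move=> fk; set lam := dw_ffun l in fk *.
have [x xE] := @bidet_coordinates K n n_gt0 d m l dm.
have left_ind (y : S) : is_induced l (right_act (y * xi lam) f).
  move=> b g tb.
  have ub : lower_tri b by move=> i j ij; move/is_trig_mxP: tb; apply.
  rewrite -[subsp_val _ (b * g)%g]/(eps (b * g)%g _) -[subsp_val _ g]/(eps g _).
  rewrite !right_actE -eps_mul.
  have -> : y * xi lam * (eps b * eps g) = \sum_k y * (xi lam * eps b * xi k) * eps g.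
    rewrite -mulr_suml -mulr_sumr -mulr_sumr sum_xi mulr1 !mulrA.
    by [].
  rewrite schur_sumE (bigD1 lam isT) [X in _ + X = _]big1 ?addr0 => [|k klam].
    by rewrite xi_tri_diag ?pair_scale //; right.
  (* A lower triangular b raises no weight, and weights above lam are killed. *)
  case: (ssrnat.ltngtP (Omega k) (Omega lam)) => [lt|lt|/Omega_inj E].
  - by rewrite xi_lower_eq0 // mulr0 mul0r.
  - by have := fk k lt (y * xi lam * eps b) (eps g); rewrite !mulrA.
  - by rewrite E eqxx in klam.
have right_ind (y : S) : is_induced l (polyA_transp (dual_act (xi lam * y) f)).
  move=> b g tb.
  pose bt := GL_tr b; pose gt := GL_tr g.
  have ub : upper_tri bt by move=> i j ji; rewrite /= mxE; move/is_trig_mxP: tb; apply.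
  rewrite -[LHS]/((eps (GL_tr (b * g)%g) * (xi lam * y) : S) f).
  rewrite -[subsp_val _ g]/((eps gt * (xi lam * y) : S) f) GL_trM -eps_mul.
  have -> : eps gt * eps bt * (xi lam * y) = \sum_k eps gt * (xi k * eps bt * xi lam) * y.
    by rewrite -mulr_suml -mulr_sumr -!mulr_suml sum_xi mul1r !mulrA.
  rewrite schur_sumE (bigD1 lam isT) [X in _ + X = _]big1 ?addr0 => [|k klam].
    rewrite xi_tri_diag ?pair_scale; last by left.
    rewrite mulrA; congr (_ * _).
    by apply: eq_bigr => i _; rewrite /= mxE.
  case: (ssrnat.ltngtP (Omega k) (Omega lam)) => [lt|lt|/Omega_inj E].
  - by rewrite xi_upper_eq0 // mulr0 mul0r.
  - by have := fk k lt (eps gt) (eps bt * xi lam * y); rewrite !mulrA.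
  - by rewrite E eqxx in klam.
pose c X Y : K := x X (polyA_transp (dual_act (xi lam * x Y) f)).
exists c; apply: killed_eps => g h.
have evV (z : S) (I : finType) (b : I -> K) (F : I -> V) :
    z (\sum_i b i *: F i) = \sum_i b i * z (F i).
  by rewrite linear_sum; apply: eq_bigr => i _; rewrite linearZ.
have E1 : (eps g * xi lam * eps h : S) f =
    \sum_Y (eps g * xi lam * x Y : S) f * bidet tab0 Y h.
  rewrite -right_actE {1}(xE _ (left_ind _)) evV; apply: eq_bigr => Y _.
  by rewrite right_actE epsE bidetVE.
have E2 Y : (eps g * xi lam * x Y : S) f = \sum_X c X Y * bidet X tab0 g.
  pose f' := polyA_transp (dual_act (xi lam * x Y) f).
  have -> : (eps g * xi lam * x Y : S) f = eps (GL_tr g) f'.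
    rewrite -mulrA -[LHS]/(subsp_val (dual_act (xi lam * x Y) f) g).
    have gg : GL_tr (GL_tr g) = g by apply: val_inj; rewrite /= trmxK.
    by rewrite -[RHS]/(subsp_val (dual_act (xi lam * x Y) f) (GL_tr (GL_tr g))) gg.
  rewrite [f'](xE _ (right_ind _)) evV; apply: eq_bigr => X _.
  by rewrite epsE bidetVE; congr (_ * _); apply: bidet_tr.
have zE (z : S) : z (f - \sum_X \sum_Y c X Y *: bidetV X Y)
    = z f - \sum_X \sum_Y c X Y * z (bidetV X Y).
  rewrite linearB linear_sum; congr (_ - _); apply: eq_bigr => X _; exact: evV.
rewrite zE; under eq_bigr do under eq_bigr do rewrite bidet_xi_top.
rewrite E1 exchange_big; apply/eqP; rewrite subr_eq0; apply/eqP.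
apply: eq_bigr => Y _; rewrite E2 mulr_suml; apply: eq_bigr => X _.
by rewrite mulrA.
Qed.

End BidetWeights.

(** * Multiples of a power of the determinant *)

Section RationalMinors.
Variables (K : closedFieldType) (n : nat).
Local Notation G := (GL K n).
Local Notation fct := (G -> K^o).

Lemma ratA_prod_cond (I : finType) (p : pred I) (F : I -> fct) (a b : I -> nat) :
  (forall i, p i -> ratA (a i) (b i) (F i)) ->
  ratA (\sum_(i | p i) a i) (\sum_(i | p i) b i) (\prod_(i | p i) F i).
Proof.
move=> AF; elim/big_rec3: _ => [|i f x y Pi Af]; first exact: ratA1.
exact: (ratA_mul (AF i Pi) Af).
Qed.

Lemma ratA_sum (I : finType) (p : pred I) (c : I -> K) (F : I -> fct) r s :
  (forall i, p i -> ratA r s (F i)) -> ratA r s (\sum_(i | p i) c i *: F i).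
Proof.
move=> AF; have [A0 AL] := ratA_subspace K n r s.
by elim/big_rec: _ => [|i f Pi Af]; [exact: A0 | apply: AL => //; apply: AF].
Qed.

Lemma ratA_scale r s (c : K) (f : fct) : ratA r s f -> ratA r s (c *: f).
Proof.
by move=> Af; have [A0 AL] := ratA_subspace K n r s; rewrite -[_ *: _]addr0; apply: AL.
Qed.

Lemma ratA_raise r s e (f : fct) : (0 < n)%N -> ratA r s f -> ratA (r + e) (s + e) f.
Proof.
move=> n0 Af; pose i0 := Ordinal n0.
have one : ratA 1 1 (1 : fct).
  have -> : (1 : fct) = \sum_j 1 *: (Defs.coord i0 j * coordV j i0).
    apply/funext => g; rewrite fct_sumE -[LHS]/(1 : K).
    transitivity (((g : 'M_n) *m invmx g) i0 i0).
      rewrite mulmxV; first by rewrite mxE eqxx.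
      exact: Defs.GL_unit.
    by rewrite mxE; apply: eq_bigr => j _; rewrite -[RHS]/(1 * _) mul1r.
  by apply: ratA_sum => j _; apply: (ratA_mul (ratA_coord K i0 j) (ratA_coordV K j i0)).
have := ratA_mul Af (ratA_exp e one); rewrite !mul1n expr1n mulr1.
by [].
Qed.

Lemma minor_ratA k (P Q : 'I_n -> 'I_n) : (k <= n)%N ->
  ratA k 0 ((fun g => minor k P Q (g : 'M_n)) : fct).
Proof.
move=> kn; have -> : ((fun g => minor k P Q (g : 'M_n)) : fct) =
    \sum_(s : 'S_n | fixes_above k s)
      (-1) ^+ s *: \prod_(j : 'I_n | (j < k)%N) Defs.coord (P (s j)) (Q j).
  apply/funext => g; rewrite fct_sumE; apply: eq_bigr => s _.
  by rewrite -[RHS]/(_ * (\prod_(j : 'I_n | (j < k)%N) _ : fct) g) fct_prodE.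
apply: ratA_sum => s _.
have := @ratA_prod_cond _ (fun j : 'I_n => j < k)%N
  (fun j => Defs.coord (P (s j)) (Q j)) (fun=> 1)%N (fun=> 0)%N.
rewrite sum_lt_ord // big1 //; apply=> j _; exact: ratA_coord.
Qed.

(** Jacobi's complementary minor identity, in the form needed: X is a matrix
    with columns of g and standard columns, whose determinant is the minor,
    and g^-1 X has standard columns and n - k columns of g^-1. *)
Lemma minor_over_det_ratA k (P Q : 'I_n -> 'I_n) : (k <= n)%N ->
  ratA 0 (n - k) ((fun g => (\det (g : 'M_n))^-1 * minor k P Q (g : 'M_n)) : fct).
Proof.
move=> kn; have [A0 _] := ratA_subspace K n 0 (n - k).
case: (boolP [forall i : 'I_n, forall j : 'I_n,
    [&& (i < k)%N, (j < k)%N & P i == P j] ==> (i == j)]); last first.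
  case/forallPn => i /forallPn[j]; rewrite negb_imply => /andP[/and3P[ik jk /eqP Pij] ij].
  rewrite (_ : (fun g => _) = (0 : fct)) //; apply/funext => g.
  by rewrite -minor_tr (minor_repeat _ _ ij ik jk Pij) mulr0.
move=> /forallP Hinj.
have [i j ik jk Pij|p pP] := @extend_to_perm n k P.
  by apply/eqP; move/forallP/(_ j): (Hinj i); rewrite ik jk Pij eqxx.
pose Y (g : G) : 'M[K]_n := \matrix_(i, j)
  if (j < k)%N then (i == Q j)%:R else invmx g i (p j).
have E (g : G) : (\det (g : 'M_n))^-1 * minor k P Q (g : 'M_n) = (-1) ^+ p * \det (Y g).
  rewrite (@eq_minor _ _ k P Q p Q) => [|j jk|//]; last by rewrite pP.
  rewrite minor_det.
  have -> : (\matrix_(i, j) if (j < k)%N then (g : 'M_n) (p i) (Q j) else (i == j)%:R)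
      = row_perm p ((g : 'M_n) *m Y g).
    apply/matrixP => i j; rewrite !mxE; case: ltnP => jk.
      rewrite (bigD1 (Q j)) //= mxE jk eqxx mulr1 big1 ?addr0 // => q qQ.
      by rewrite mxE jk (negPf qQ) mulr0.
    transitivity (((g : 'M_n) *m invmx g) (p i) (p j)).
      by rewrite mulmxV ?mxE ?(inj_eq (@perm_inj _ p)) //; apply: Defs.GL_unit.
    by rewrite mxE; apply: eq_bigr => q _; rewrite mxE ltnNge jk.
  rewrite row_permE !det_mulmx det_perm mulrCA mulKf //.
  by rewrite -unitfE -unitmxE; apply: Defs.GL_unit.
have -> : ((fun g => (\det (g : 'M_n))^-1 * minor k P Q (g : 'M_n)) : fct) =
    (-1) ^+ p *: \sum_(s : 'S_n) (-1) ^+ s *: \prod_(j : 'I_n)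
      (if (j < k)%N then (fun=> (s j == Q j)%:R) else coordV (s j) (p j)).
  apply/funext => g; rewrite E -det_tr.
  rewrite -[RHS]/((-1) ^+ p * (\sum_(s : 'S_n) _ : fct) g) fct_sumE; congr (_ * _).
  apply: eq_bigr => s _; rewrite -[RHS]/(_ * (\prod_j _ : fct) g) fct_prodE; congr (_ * _).
  by apply: eq_bigr => j _; rewrite !mxE; case: ifP.
apply: ratA_scale; apply: ratA_sum => s _.
have := @ratA_prod_cond _ xpredT
  (fun j : 'I_n => if (j < k)%N then (fun=> (s j == Q j)%:R) else coordV (s j) (p j))
  (fun=> 0)%N (fun j : 'I_n => (k <= j) : nat).
rewrite big1 // (_ : (\sum_(j < n) (k <= j))%N = (n - k)%N); last first.
  have := sum_lt_ord kn; rewrite big_mkcond /= => Ek.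
  apply/eqP; rewrite -(eqn_add2l k) subnKC // -{1}Ek -big_split /=.
  rewrite -[X in _ == X]card_ord -sum1_card; apply/eqP/eq_bigr => j _.
  by case: ltnP.
apply=> j _; case: ltnP => _; last exact: ratA_coordV.
rewrite (_ : (fun=> _) = ((s j == Q j)%:R : K) *: (1 : fct)).
  exact/ratA_scale/ratA1.
by apply/funext => g; rewrite -[RHS]/(_ * 1) mulr1.
Qed.

End RationalMinors.

Section RationalPart.
Variables (K : closedFieldType) (n : nat) (n_gt0 : (0 < n)%N) (r s : nat).
Local Notation d := (r + n.-1 * s)%N.
Local Notation G := (GL K n).
Local Notation fct := (G -> K^o).
Local Notation weight := {ffun 'I_n -> 'I_d.+1}.
Local Notation A := (poly_coalg K n_gt0 d).
Local Notation V := (subsp A).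
Local Notation S := (dualalg A).
Local Notation B := (rat_coalg K n_gt0 r s).
Local Notation xi := (xi K n_gt0).
Local Notation eps := (eps n_gt0 d).

(** For the weight k of a bideterminant, the number of cells in the columns
    beyond the s-th one. A weight is to be removed by the truncation when its
    excess is larger than r. *)
Definition excess (k : 'I_n -> nat) : nat := (\sum_i (k i - s))%N.

Definition det_multiple (f : V) : Prop := exists h : subsp B, f = mul_det h.

Lemma detf_Xn k (g : G) : (@detf K n ^+ k) g = \det (g : 'M_n) ^+ k.
Proof. by elim: k => [//|k IH]; rewrite !exprS -IH. Qed.

Lemma det_neq0 (g : G) : \det (g : 'M_n) != 0.
Proof. by rewrite -unitfE -unitmxE; apply: Defs.GL_unit. Qed.

Lemma minn_excess (k : 'I_n -> nat) :
  (\sum_i k i = \sum_i minn s (k i) + excess k)%N.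
Proof. by rewrite -big_split; apply: eq_bigr => i _ /=; lia. Qed.

(** Each of the first s minors is divided by the determinant, becoming a
    polynomial of degree n - (height) in the entries of the inverse; the later
    columns give degree (excess l) in the entries of the matrix. The bidegree
    so obtained differs from (r,s) by a multiple of (1,1), which is
    compensated by a power of 1 = sum of c_0j d_j0. *)
Lemma bidet_det_multiple (l : dom_weight n d) (dm : (d <= s + d)%N) X Y :
  (excess l <= r)%N -> det_multiple (@bidetV K n n_gt0 d (s + d) l dm X Y).
Proof.
move=> lr; pose ht := column_height l.
pose F1 (c : 'I_s) : fct := fun g => (\det (g : 'M_n))^-1
  * minor (ht c) (X (lshift d c)) (Y (lshift d c)) (g : 'M_n).
pose F2 (c : 'I_d) : fct := fun g =>
  minor (ht (s + c)%N) (X (rshift s c)) (Y (rshift s c)) (g : 'M_n).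
pose p := (\sum_(c < d) ht (s + c))%N; pose q := (\sum_(c < s) (n - ht c))%N.
have htn c : (ht c <= n)%N := column_height_le l c.
have AH : ratA p q (\prod_c F1 c * \prod_c F2 c).
  rewrite -[p]add0n -[q]addn0; apply: ratA_mul.
    have := @ratA_prod_cond K n _ xpredT F1 (fun=> 0)%N (fun c => n - ht c)%N.
    by rewrite big1 //; apply=> c _; apply: minor_over_det_ratA.
  have := @ratA_prod_cond K n _ xpredT F2 (fun c => ht (s + c))%N (fun=> 0)%N.
  by rewrite [X in ratA _ X]big1 //; apply=> c _; apply: minor_ratA.
have htE c : ht c = (\sum_(j < n | (c < l j)%N) 1)%N.
  rewrite -[LHS](sum_lt_ord (htn c)); apply: eq_bigl => j.
  by rewrite (column_heightP l c j).
have pE : p = excess l.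
  rewrite /p; under eq_bigr do rewrite htE.
  rewrite (exchange_big_dep xpredT) //=; apply: eq_bigr => j _.
  rewrite -[RHS](@sum_lt_ord d) => [|]; last first.
    by rewrite (leq_trans (leq_subr _ _)) // -ltnS ltn_ord.
  by apply: eq_bigl => c; rewrite ltn_subRL.
have qE : (q + \sum_i minn s (l i) = s * n)%N.
  have -> : (\sum_i minn s (l i) = \sum_(c < s) ht c)%N.
    under [RHS]eq_bigr do rewrite htE.
    rewrite [RHS](exchange_big_dep xpredT) //=; apply: eq_bigr => j _.
    case: (leqP s (l j)) => [sl|/ltnW ls]; last by rewrite sum_lt_ord.
    rewrite -[LHS]card_ord -sum1_card; apply: eq_bigl => c.
    by rewrite (leq_trans (ltn_ord c)).
  rewrite -big_split /= -[X in (X * _)%N]card_ord -sum_nat_const; apply: eq_bigr => c _.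
  by rewrite subnK.
have dE := dom_weight_sum l; rewrite (minn_excess l) -pE in dE.
(* As q + d - p = s n and d = r + (n-1) s, the defect r - p equals s - q. *)
have [re se] : r = (p + (r - p))%N /\ s = (q + (r - p))%N.
  move: lr dE qE; rewrite -pE; move: (bigop _ _ _) => x lr dE qE.
  have nn : n = n.-1.+1 by rewrite prednK.
  have sn : (s * n = s + n.-1 * s)%N by rewrite {1}nn mulnS mulnC.
  by split; [rewrite subnKC | lia].
have AH' : ratA r s (\prod_c F1 c * \prod_c F2 c).
  by have := ratA_raise (r - p) n_gt0 AH; rewrite -re -se.
exists (@in_subsp K _ B _ AH'); apply: subsp_eqP; apply/funext => g.
rewrite bidetVE mul_detE.
rewrite -[RHS]/((@detf K n ^+ s) g * ((\prod_c F1 c) g * (\prod_c F2 c) g)).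
rewrite detf_Xn !fct_prodE mulrA /bidet big_split_ord /=; congr (_ * _).
have -> : \det (g : 'M_n) ^+ s = \prod_(c < s) \det (g : 'M_n) by rewrite prodr_const card_ord.
rewrite -big_split /=; apply: eq_bigr => c _.
by rewrite mulVKf ?det_neq0.
Qed.

Lemma det_multiple_translate (f : V) (g h : G) :
  det_multiple f -> det_multiple (dual_act (eps h) (ltrans g f)).
Proof.
move=> [u ->].
have ev_lin : linear ((fun w => subsp_val w h) : subsp B -> K^o) by [].
pose ev : lin_dual (subsp B) := mk_dual ev_lin.
exists ((\det (g : 'M_n) ^+ s * \det (h : 'M_n) ^+ s : K) *: dual_act ev (ltrans g u)).
apply: subsp_eqP; apply/funext => x; rewrite two_sided_translate !mul_detE.
rewrite -[LHS]/((@detf K n ^+ s) (g * x * h)%g * subsp_val u (g * x * h)%g).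
rewrite -[RHS]/((@detf K n ^+ s) x * (\det (g : 'M_n) ^+ s * \det (h : 'M_n) ^+ s
   * subsp_val u (g * (x * h))%g)).
rewrite !detf_Xn mulgA -[GL_mx (g * x * h)%g]/((g : 'M_n) *m (x : 'M_n) *m (h : 'M_n)).
by rewrite !det_mulmx !exprMn; ring.
Qed.

Section TopExponent.
Variable e : 'I_n -> nat.
Variable E : nat.
Hypothesis eE : forall i, (e i <= E)%N.

(** The one-parameter subgroup z |-> diag(z ^ e i): an element of A(n,p,q)
    restricts to a Laurent polynomial with exponents between -qE and pE. *)
Lemma rat_laurent (p q : nat) (f : fct) : ratA p q f ->
  exists P : {poly K}, (size P <= ((p + q) * E).+1)%N /\
    forall z (t0 : forall i, z ^+ e i != 0), f (torus t0) * z ^+ (q * E) = P.[z].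
Proof.
move: p q f; apply: ratA_ind => [p q||p q p' q' f f'|i j|i j].
- split=> [|c u v [Pu [su Eu]] [Pv [sv Ev]]].
    by exists 0; split=> [|z t0]; rewrite ?size_poly0 // mul0r horner0.
  exists (c *: Pu + Pv); split.
    by rewrite (leq_trans (size_polyD _ _)) // geq_max sv (leq_trans (size_scale_leq _ _)).
  move=> z t0; rewrite hornerD hornerZ -Eu -Ev.
  by rewrite -[(c *: u + v) _]/(c * u (torus t0) + v (torus t0)) mulrDl mulrA.
- by exists 1; split=> [|z t0]; rewrite ?size_poly1 // hornerC mul1r.
- move=> [P [sP EP]] [P' [sP' EP']]; exists (P * P'); split.
    apply: leq_trans (size_polyMleq _ _) _; move: sP sP'.
    move: (size P) (size P') => a b sa sb.
    have -> : ((p + p' + (q + q')) * E = (p + q) * E + (p' + q') * E)%N by ring.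
    by move: sa sb; move: ((p + q) * E)%N ((p' + q') * E)%N => x y; lia.
  move=> z t0; rewrite hornerM -EP -EP' mulnDl exprD.
  by rewrite -[(f * f') _]/(f (torus t0) * f' (torus t0)) mulrACA.
- exists ((i == j)%:R *: 'X^(e i)); split.
    by rewrite (leq_trans (size_scale_leq _ _)) // size_polyXn ltnS addn0 mul1n.
  move=> z t0; rewrite mul0n mulr1 hornerZ hornerXn /Defs.coord !mxE.
  by case: (i == j); rewrite ?mul1r ?mul0r.
- exists ((i == j)%:R *: 'X^(E - e i)); split.
    by rewrite (leq_trans (size_scale_leq _ _)) // size_polyXn ltnS add0n mul1n leq_subr.
  move=> z t0; rewrite mul1n hornerZ hornerXn.
  have <- : z ^+ e i * coordV i j (torus t0) = (i == j)%:R.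
    transitivity (((torus t0 : 'M_n) *m invmx (torus t0 : 'M_n)) i j).
      by rewrite mul_diag_mx !mxE.
    by rewrite mulmxV ?mxE //; apply: Defs.GL_unit.
  by rewrite mulrAC -exprD subnKC // mulrC.
Qed.

End TopExponent.

Lemma exponent_bound w M R Q x y : (s * w + r * Q + 1 <= M)%N ->
  (M * (r.+1 + s * R) <= y)%N ->
  (s * (w + M * R) + ((r + s) * (Q + M)).+1 <= s * (Q + M) + (x + y))%N.
Proof. by nia. Qed.

(** Let R be the set of indices i with k i > s. On the torus elements with z ^ M
    at the indices of R, an element of A(n,r,s) has degree at most r in z ^ M
    and det ^ s has degree s #|R|, whereas the weight k would contribute the
    sum of the k i over R, which is the excess of k plus s #|R|. *)
Lemma xi_det_multiple (f : V) (k : weight) :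
  det_multiple f -> (r < excess (fun i => k i))%N -> xi k f = 0.
Proof.
move=> [u fu] rk; pose N := d.+2.
pose w := (\sum_(i < n) N ^ i)%N.
pose M := (N ^ n * (s * w + r + 1))%N.
pose big (i : 'I_n) := (s < k i)%N.
(* The perturbation N ^ i separates the weights, and M is large enough to
   dominate everything that the perturbation contributes. *)
pose e (i : 'I_n) := (N ^ i + M * big i)%N.
pose E := (N ^ n + M)%N.
have eE i : (e i <= E)%N.
  rewrite leq_add //; first by rewrite leq_pexp2l // ltnW.
  by case: (big i); rewrite ?muln1 ?muln0.
have [P [sP EP]] := rat_laurent eE (subspP u).
pose ex (k' : weight) := (\sum_i k' i * e i)%N.
have exE k' : ex k' = (\sum_i k' i * N ^ i + M * \sum_i k' i * big i)%N.
  rewrite big_distrr -big_split; apply: eq_bigr => i _ /=.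
  by rewrite mulnDr mulnCA.
have low (k' : weight) : (\sum_i k' i * N ^ i < N ^ n)%N.
  have := @low_digits_lt _ (@nat_of_ord n) N (@ord_inj n) isT n (expo_nat k')
    (expo_nat_lt k').
  by rewrite (eq_bigl xpredT) // => i; rewrite ltn_ord.
have ex_inj : injective ex.
  move=> k1 k2; rewrite !exE => ek.
  have : (\sum_i k1 i * N ^ i = \sum_i k2 i * N ^ i)%N.
    have := congr1 (fun x => x %% N ^ n)%N ek => /=.
    by rewrite /M -!mulnA ![(N ^ n * _)%N]mulnC ![(_ + _ * N ^ n)%N]addnC !modnMDl !modn_small.
  move=> E12; apply/ffunP => i; apply: val_inj.
  exact: (@digit_sum_inj _ (@nat_of_ord n) N (@ord_inj n) isT 0 (expo_nat k1)
    (expo_nat k2) (expo_nat_lt k1) (expo_nat_lt k2) E12 i isT).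
have t0 z (z0 : z != 0) i : z ^+ e i != 0 :> K by rewrite expf_neq0.
pose L := \sum_k' (xi k' f : K) *: 'X^(ex k').
have LE : 'X^(s * E) * L = 'X^(s * \sum_i e i) * P.
  apply/eqP; rewrite -subr_eq0; apply/eqP.
  apply: (@poly_eq0_open K _ 'X); first by rewrite polyX_eq0.
  move=> z; rewrite hornerX => z0; apply/eqP.
  rewrite hornerD hornerN subr_eq0 !hornerM !hornerXn -(EP z (t0 z z0)).
  have -> : L.[z] = subsp_val f (torus (t0 z z0)).
    rewrite xi_torus /pev horner_sum; apply: eq_bigr => k' _.
    rewrite hornerZ hornerXn; congr (_ * _); rewrite /ex -prodrXr.
    by apply: eq_bigr => i _; rewrite -exprM mulnC.
  rewrite fu mul_detE -[((_ ^+ s) * _) _]/((@detf K n ^+ s) (torus (t0 z z0))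
    * subsp_val u (torus (t0 z z0))).
  rewrite detf_Xn /= det_diag (eq_bigr (fun i => z ^+ e i)) => [|i _]; last by rewrite !mxE.
  by rewrite prodrXr -exprM [(_ * s)%N]mulnC mulrCA [X in _ * X]mulrC.
(* The right-hand side has degree less than s E + ex k. *)
have key : (s * \sum_i e i + (size P) <= s * E + ex k)%N.
  pose R := (\sum_i big i)%N.
  have eR : (\sum_i e i = w + M * R)%N.
    by rewrite big_split /= -big_distrr.
  have kR : (excess (fun i => k i) + s * R = \sum_i k i * big i)%N.
    rewrite big_distrr -big_split; apply: eq_bigr => i _ /=; rewrite /big.
    by case: ltnP => h /=; rewrite ?muln1 ?muln0 ?addn0; [rewrite subnK // ltnW | apply/eqP].
  rewrite exE eR -kR.
  apply: (@leq_trans (s * (w + M * R) + ((r + s) * E).+1)); first by rewrite leq_add2l.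
  have Mbig : (s * w + r * N ^ n + 1 <= M)%N.
    have N1 : (1 <= N ^ n)%N by rewrite expn_gt0.
    rewrite /M; move: (N ^ n)%N N1 => Q Q1; nia.
  have : (M * (r.+1 + s * R) <= M * (excess (fun i => k i) + s * R))%N.
    by rewrite leq_mul2l leq_add2r rk orbT.
  exact: exponent_bound Mbig.
have := congr1 (fun p : {poly K} => p`_(s * E + ex k)) LE.
rewrite coefXnM ltnNge leq_addr /= addKn coef_sum (bigD1 k) //= coefZ coefXn eqxx mulr1.
rewrite [X in _ + X = _]big1 ?addr0 => [->|k' kk']; last first.
  by rewrite coefZ coefXn (inj_eq ex_inj) eq_sym (negPf kk') mulr0.
rewrite coefXnM ltnNge (leq_trans (leq_addr _ _) key) /= nth_default //.
by rewrite leq_subRL // (leq_trans (leq_addr _ _) key).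
Qed.

Lemma det_multiple_killed (f : V) (k : weight) :
  det_multiple f -> (r < excess (fun i => k i))%N -> killed f k.
Proof.
move=> fr rk; apply: killed_eps => g h; rewrite eps_xi_eps.
by apply: xi_det_multiple => //; apply: det_multiple_translate.
Qed.

End RationalPart.

(** * Truncation to weights of small excess *)

Section SchurDuality.
Variables (K : closedFieldType) (n : nat) (n_gt0 : (0 < n)%N) (d : nat).
Local Notation G := (GL K n).
Local Notation weight := {ffun 'I_n -> 'I_d.+1}.
Local Notation A := (poly_coalg K n_gt0 d).
Local Notation V := (subsp A).
Local Notation S := (dualalg A).
Local Notation xi := (xi K n_gt0).
Local Notation eps := (eps n_gt0 d).

(** Duality in the finite-dimensional space A(n,d). *)
Lemma annihilator_span (I : finType) (y : I -> S) (x : S) :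
  (forall f : V, (forall i, y i f = 0) -> x f = 0) ->
  exists c : I -> K, x = \sum_i c i *: y i.
Proof.
move=> H; pose N := #|{: dexpo n d}|.
pose Y : 'M[K]_(#|{: I}|, N) := \matrix_(i, a) y (enum_val i) (monoV K n_gt0 (enum_val a)).
pose X : 'rV[K]_N := \row_a x (monoV K n_gt0 (enum_val a)).
have zE (z : S) (v : 'I_N -> K) :
    z (\sum_a v a *: monoV K n_gt0 (enum_val a)) = \sum_a v a * z (monoV K n_gt0 (enum_val a)).
  by rewrite linear_sum; apply: eq_bigr => a _; rewrite linearZ.
have : (X <= Y)%MS.
  rewrite submxE; apply/eqP/rowP => j; rewrite [RHS]mxE mxE.
  under eq_bigr do rewrite mxE mulrC.
  rewrite -(zE x (fun a => cokermx Y a j)); apply: H => i; rewrite zE.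
  have /matrixP/(_ (enum_rank i) j) := mulmx_coker Y; rewrite !mxE => CE; rewrite -[RHS]CE.
  by apply: eq_bigr => a _; rewrite [in RHS]mxE enum_rankK mulrC.
case/submxP => D XD; exists (fun i => D 0 (enum_rank i)).
apply: schur_ext => a; rewrite schur_sumE.
have /rowP/(_ (enum_rank a)) := XD; rewrite !mxE enum_rankK => ->.
rewrite [RHS](reindex_onto enum_val enum_rank) /= => [|i _]; last exact: enum_rankK.
apply: eq_big => [i|i _]; first by rewrite enum_valK eqxx.
by rewrite !mxE enum_valK enum_rankK.
Qed.

Lemma killed0 (f : V) : (forall k, killed f k) -> f = 0.
Proof.
move=> H; apply: V_ext => g; rewrite linear0 -[eps g]mulr1 -(sum_xi K n_gt0 d) mulr_sumr.
rewrite schur_sumE big1 // => k _.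
by have := H k (eps g) 1; rewrite mulr1.
Qed.

Lemma xi_deg0 (k : weight) : (\sum_i k i)%N <> d -> xi k = 0.
Proof.
move=> kd; apply: schur_ext => b; rewrite coef_mono; case: eqP => // E.
case: kd; rewrite -[RHS](dexpo_deg b) -E deg_sum; apply: eq_bigr => i _.
rewrite (bigD1 i) //= ffunE eqxx big1 ?addn0 // => j ji.
by rewrite ffunE /= eq_sym (negPf ji).
Qed.

(** Weights of a bimodule are permuted by permutation matrices. *)
Lemma killed_swap (f : V) (k : weight) (i j : 'I_n) :
  killed f [ffun q => k (tperm i j q)] -> killed f k.
Proof.
set k' := finfun _ => H.
have wu : (perm_mx (tperm i j) : 'M[K]_n) \in unitmx by apply: unitmx_perm.
pose w : G := MkGL wu.
have E : xi k = eps w * xi k' * eps w.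
  apply: dual_eqP => u; rewrite eps_xi_eps.
  rewrite [RHS](@xi_char _ _ _ _ _ _ (fun k => xi k u : K)
     (fun l => [ffun q => l (tperm i j q)] : weight)).
    rewrite (big_pred1 k) // => l; apply/eqP/eqP => [El|->].
      by apply/ffunP => q; have /ffunP/(_ (tperm i j q)) := El; rewrite !ffunE tpermK.
    by apply/ffunP => q; rewrite !ffunE.
  move=> t t0; rewrite two_sided_translate.
  have t0' q : t (tperm i j q) != 0 by [].
  have -> : (w * torus t0 * w)%g = torus t0'.
    apply: val_inj.
    rewrite -[LHS]/(perm_mx (tperm i j) *m diag_mx (\row_i t i) *m perm_mx (tperm i j)).
    rewrite -row_permE -[tperm i j in X in _ *m X]tpermV -col_permE.
    by apply/matrixP => a b; rewrite /= !mxE (inj_eq (@perm_inj _ (tperm i j))).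
  rewrite (xi_torus u t0'); apply: eq_bigr => l _; congr (_ * _).
  rewrite (reindex_inj (@perm_inj _ (tperm i j))) /=; apply: eq_bigr => q _.
  by rewrite tpermK ffunE.
by move=> x y; have := H (x * eps w) (eps w * y); rewrite E !mulrA.
Qed.

Lemma Omega_swap (k : weight) (i j : 'I_n) : (i < j)%N -> (k i < k j)%N ->
  (Omega k < Omega [ffun q => k (tperm i j q)])%N.
Proof.
move=> ij kij; have ji : j != i by rewrite -val_eqE /= gtn_eqF.
rewrite /Omega !(bigD1 i (P := xpredT)) //= !(bigD1 j (P := [pred q | q != i])) //=.
rewrite !ffunE tpermL tpermR !addnA [X in (_ < _ + X)%N](eq_bigr
  (fun q => k q * d.+2 ^ (n.-1 - q))%N); last first.
  by move=> q /andP[qi qj]; rewrite ffunE tpermD // eq_sym.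
rewrite ltn_add2r; have := W_decr d ij.
move: (d.+2 ^ _)%N (d.+2 ^ _)%N => a b ab; nia.
Qed.

End SchurDuality.

Section Truncation.
Variables (K : closedFieldType) (n : nat) (n_gt0 : (0 < n)%N) (r s : nat).
Local Notation d := (r + n.-1 * s)%N.
Local Notation G := (GL K n).
Local Notation weight := {ffun 'I_n -> 'I_d.+1}.
Local Notation A := (poly_coalg K n_gt0 d).
Local Notation V := (subsp A).
Local Notation S := (dualalg A).
Local Notation B := (rat_coalg K n_gt0 r s).
Local Notation xi := (xi K n_gt0).
Local Notation eps := (eps n_gt0 d).
Local Notation excess := (@excess n s).

Lemma det_multiple_lin (c : K) (f f' : V) :
  det_multiple f -> det_multiple f' -> @det_multiple K n n_gt0 r s (c *: f + f').
Proof. by move=> [h ->] [h' ->]; exists (c *: h + h'); rewrite mul_det_linear. Qed.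

Lemma det_multiple0 : @det_multiple K n n_gt0 r s 0.
Proof.
exists 0; apply: subsp_eqP; rewrite mul_detE.
by apply/funext => g; rewrite -[RHS]/((@detf K n ^+ s) g * 0) mulr0.
Qed.

Lemma det_multiple_sum (I : finType) (c : I -> K) (F : I -> V) :
  (forall i, det_multiple (F i)) -> @det_multiple K n n_gt0 r s (\sum_i c i *: F i).
Proof.
move=> HF; elim/big_rec: _ => [|i f _ Hf]; first exact: det_multiple0.
exact: det_multiple_lin.
Qed.

Lemma killed_sum (I : finType) (c : I -> K) (F : I -> V) k :
  (forall i, killed (F i) k) -> killed (\sum_i c i *: F i) k.
Proof.
move=> HF; elim/big_rec: _ => [|i f _ Hf]; last exact: killed_lin.
by move=> x y; rewrite linear0.
Qed.

(** The functions all of whose dominant weights have excess at most r, i.e.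
    the largest sub-bimodule of A(n,d) with such weights. *)
Definition truncated (f : V) : Prop :=
  forall k : weight, is_dominant k -> (r < excess (fun i => k i))%N -> killed f k.

Lemma det_multiple_truncated f : det_multiple f -> truncated f.
Proof. by move=> fr k _ rk; apply: det_multiple_killed. Qed.

Lemma d_le : (d <= s + d)%N. Proof. exact: leq_addl. Qed.

Lemma top_weight_dominant (f : V) (k : weight) :
  (forall k' : weight, (Omega k < Omega k')%N -> killed f k') -> ~ killed f k ->
  is_dominant k.
Proof.
move=> ktop knot; apply/andP; split; last first.
  apply/eqP; apply: contrapT => kd; apply: knot => x y.
  by rewrite (xi_deg0 K n_gt0 kd) mulr0 mul0r.
apply/forallP => i; apply/forallP => j; apply/implyP; rewrite leq_eqVlt.
case/orP => [/eqP/val_inj -> //|ij]; rewrite leqNgt; apply/negP => kij.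
by apply: knot; apply: (@killed_swap _ _ _ _ _ _ i j); apply/ktop/Omega_swap.
Qed.

(** Induction on the highest weight of f. It is dominant, hence of excess at
    most r, and the corresponding component is removed by subtracting
    bideterminants of that shape, all of which are multiples of det ^ s. *)
Lemma truncated_det_multiple (f : V) : truncated f -> det_multiple f.
Proof.
pose M := (\max_(k : weight) Omega k).+1.
suff H N : forall f : V, truncated f ->
    (forall k, (N <= Omega k)%N -> killed f k) -> det_multiple f.
  move=> ft; apply: (H M) => // k; rewrite leqNgt ltnS.
  by rewrite leq_bigmax.
elim: N => [|N IH] {}f ft fN.
  by rewrite (@killed0 _ _ _ _ f) => [|k]; [exact: det_multiple0 | exact: fN].
case: (pselect (exists2 k : weight, Omega k = N & ~ killed f k)) => [[k kN knot]|none]; last first.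
  apply: IH => // k; rewrite leq_eqVlt => /orP[/eqP kN|/fN //].
  by apply: contrapT => nk; apply: none; exists k.
have ktop k' : (Omega k < Omega k')%N -> killed f k' by rewrite kN; apply: fN.
have kdom := top_weight_dominant ktop knot.
pose l : dom_weight n d := DomWeight kdom.
have lr : (excess l <= r)%N by rewrite leqNgt; apply/negP => /(ft k kdom).
have [c cP] := @subtract_top K n n_gt0 d (s + d) l d_le f ktop.
pose BV X Y := @bidetV K n n_gt0 d (s + d) l d_le X Y.
have BVr X Y : @det_multiple K n n_gt0 r s (BV X Y) by apply: bidet_det_multiple.
pose b := \sum_X \sum_Y c X Y *: BV X Y.
have br : @det_multiple K n n_gt0 r s b.
  rewrite /b; under eq_bigr do rewrite -[\sum_Y _]scale1r.
  by apply: det_multiple_sum => X; apply: det_multiple_sum => Y.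
have bk k' : (Omega k < Omega k')%N -> killed b k'.
  move=> kk'; rewrite /b; under eq_bigr do rewrite -[\sum_Y _]scale1r.
  apply: killed_sum => X; apply: killed_sum => Y.
  exact: bidet_killed.
have -> : f = 1 *: b + (f - b) by rewrite scale1r addrC subrK.
apply: det_multiple_lin => //; have fbE : f - b = (-1) *: b + f by rewrite scaleN1r addrC.
apply: IH => [k' dk' rk'|k'].
  by rewrite fbE; apply: killed_lin; [exact: det_multiple_truncated | exact: ft].
rewrite leq_eqVlt => /orP[/eqP kk'|lt].
  have -> : k' = k by apply: (@Omega_inj n d); rewrite -kk' kN.
  exact: cP.
by rewrite fbE; apply: killed_lin; [apply: bk; rewrite kN | exact: fN].
Qed.

Lemma induced_det_multiple (l : dom_weight n d) (f : V) :
  (excess l <= r)%N -> is_induced l f -> det_multiple f.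
Proof.
move=> lr lf; have [c ->] := @induced_bidet_span K n n_gt0 d (s + d) l d_le f lf.
by apply: det_multiple_sum => Y; apply: bidet_det_multiple.
Qed.

Lemma truncated_act (z : S) f : truncated f -> truncated (dual_act z f).
Proof. by move=> ft k dk rk; apply/killed_act/ft. Qed.

Lemma truncated_ltrans g f : truncated f -> truncated (ltrans g f).
Proof.
move=> ft k dk rk x y; have H : (eps g * (x * xi k * y) : S) f = 0.
  by have := ft k dk rk (eps g * x) y; rewrite !mulrA.
exact: H.
Qed.

Lemma truncated_sum (I : finType) (c : I -> K) (F : I -> V) :
  (forall i, truncated (F i)) -> truncated (\sum_i c i *: F i).
Proof. by move=> HF k dk rk; apply: killed_sum => i; apply: HF. Qed.

Lemma excess_partial (k : 'I_n -> nat) (t : nat) :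
  (t <= n)%N -> (\sum_(i < n | (i < t)%N) k i <= excess k + t * s)%N.
Proof.
clear n_gt0; move=> tn; rewrite -{2}(sum_lt_ord tn) big_distrl /= [excess k](bigID (fun i : 'I_n => i < t)%N) /=.
rewrite addnAC -big_split /=; apply: leq_trans (leq_addr _ _).
by apply: leq_sum => i _; rewrite mul1n -leq_subLR; lia.
Qed.

(** The excess of l is attained by a partial sum of l, and partial sums grow
    in the dominance order. *)
Lemma excess_mono (k l : dom_weight n d) : (k <= l)%O -> (excess l <= excess k)%N.
Proof.
rewrite dom_weight_leE => /forallP kl.
pose t := column_height l s.
have tn : (t <= n)%N by apply: column_height_le.
have lt : (excess l + t * s = \sum_(i < n | (i < t)%N) l i)%N.
  rewrite -{1}(sum_lt_ord tn) big_distrl /= [excess l](bigID (fun i : 'I_n => i < t)%N) /=.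
  rewrite [X in (_ + X + _)%N]big1 ?addn0 => [|i]; last first.
    by rewrite -column_heightP -leqNgt => /eqP.
  rewrite -big_split /=; apply: eq_bigr => i; rewrite -column_heightP mul1n => h.
  by rewrite subnK // ltnW.
rewrite -(leq_add2r (t * s)) lt; apply: leq_trans (excess_partial k tn).
case: (posnP t) => [->|t0]; first by rewrite big_pred0.
have tn' : (t.-1 < n)%N by rewrite prednK.
have E (F : 'I_n -> nat) : (\sum_(i < n | (i <= t.-1)%N) F i = \sum_(i < n | (i < t)%N) F i)%N.
  by apply: eq_bigl => i; rewrite -[in RHS](prednK t0) ltnS.
by have := kl (Ordinal tn'); rewrite /= !E.
Qed.

Lemma excess_Rplus (mu : dom_weight n d) :
  ((\sum_(i in Rplus s mu) mu i > r + #|Rplus s mu| * s) = (r < excess mu))%N.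
Proof.
have -> : (\sum_(i in Rplus s mu) mu i = excess mu + #|Rplus s mu| * s)%N.
  rewrite -sum_nat_const [excess mu](bigID (fun i => i \in Rplus s mu)) /=.
  rewrite [X in (_ + X + _)%N]big1 ?addn0 => [|i]; last first.
    by rewrite inE -leqNgt => /eqP.
  rewrite -big_split /=; apply: eq_bigr => i; rewrite inE => h.
  by rewrite subnK // ltnW.
by rewrite ltn_add2r.
Qed.

End Truncation.

(** * Cells of large excess *)

Lemma porder_ind disp (L : finPOrderType disp) (Q : L -> Prop) :
  (forall x, (forall y, (y < x)%O -> Q y) -> Q x) -> forall x, Q x.
Proof.
move=> step x; have [N] := ubnP #|[pred y | (y < x)%O]|.
elim: N x => // N IH x xN; apply: step => y yx; apply: IH.
rewrite -ltnS (leq_trans _ xN) // ltnS; apply: proper_card; apply/fintype.properP; split.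
  by apply/fintype.subsetP => z; rewrite !inE => zy; apply: lt_trans yx.
by exists y; rewrite !inE ?ltxx.
Qed.

Section WeylGeneration.
Variables (K : closedFieldType) (n : nat) (n_gt0 : (0 < n)%N) (d : nat).
Local Notation G := (GL K n).
Local Notation A := (poly_coalg K n_gt0 d).
Local Notation V := (subsp A).
Local Notation S := (dualalg A).
Variable l : dom_weight n d.
Local Notation xi := (xi K n_gt0 (dw_ffun l)).

Lemma schur_transpK (x : S) : schur_transp (schur_transp x) = x.
Proof.
apply: dual_eqP => f; rewrite -[LHS]/(x (polyA_transp (polyA_transp f))); congr (x _).
apply: subsp_eqP; apply/funext => g; rewrite /=; congr (subsp_val f _).
by apply: val_inj; apply: trmxK.
Qed.

Fact ev1_linear : linear ((fun f => subsp_val (subsp_val f) 1%g) : nabla K n_gt0 l -> K^o).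
Proof. by move=> c u v; rewrite !subsp_valP. Qed.
(** Evaluation at 1 is the highest weight vector of the Weyl module. *)
Definition weyl_gen : weyl K n_gt0 l := mk_dual ev1_linear.

Lemma weyl_gen_act (x : S) (f : nabla K n_gt0 l) :
  weyl_act x weyl_gen f = schur_transp x (subsp_val f).
Proof.
rewrite -[LHS]/(schur_transp x (ltrans 1%g (subsp_val f))); congr (schur_transp x _).
apply: subsp_eqP; apply/funext => g; rewrite /= mul1g.
by [].
Qed.

(** Linear forms on the induced module extend to A(n,d), where they are
    elements of the Schur algebra. *)
Lemma weyl_generated (psi : weyl K n_gt0 l) : exists x : S, psi = weyl_act x weyl_gen.
Proof.
have [x xE] := @bidet_coordinates K n n_gt0 d d l (leqnn d).
pose q Y : V := bidetV K n_gt0 l (leqnn d) (tab0 n d) Y.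
have qI Y : is_induced l (q Y) by apply: bidetV_induced.
pose BV Y : nabla K n_gt0 l :=
  @in_subsp K _ (Subspace (@is_induced_subspace K n n_gt0 d l)) (q Y) (qI Y).
pose y : S := \sum_Y (psi (BV Y) : K) *: x Y.
exists (schur_transp y); apply: dual_eqP => f; rewrite weyl_gen_act schur_transpK.
have fE : f = \sum_Y (x Y (subsp_val f) : K) *: BV Y.
  apply: val_inj; rewrite raddf_sum /= [LHS](xE _ (subspP f)).
  by apply: eq_bigr.
rewrite [in LHS]fE linear_sum schur_sumE; apply: eq_bigr => Y _.
by rewrite linearZ; apply: mulrC.
Qed.

Lemma weyl_gen_weight : weyl_act xi weyl_gen = weyl_gen.
Proof.
apply: dual_eqP => f; rewrite weyl_gen_act transp_xi.
rewrite (@xi_char _ _ _ _ _ unit (fun=> weyl_gen f : K) (fun=> dw_ffun l)).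
  by rewrite (big_pred1 tt) //= => -[]; rewrite eqxx.
move=> t t0; rewrite (big_pred1 tt); last by case.
have trig : is_trig_mx (torus t0 : 'M_n).
  by apply/is_trig_mxP => i j ij; rewrite /= !mxE -val_eqE /= ltn_eqF.
have := subspP f (torus t0) 1%g trig; rewrite mulg1 => ->; rewrite mulrC; congr (_ * _).
by apply: eq_bigr => i _; rewrite /= !mxE eqxx.
Qed.

End WeylGeneration.

Section CellIdeal.
Variables (K : closedFieldType) (n : nat) (n_gt0 : (0 < n)%N) (r s : nat).
Local Notation d := (r + n.-1 * s)%N.
Local Notation G := (GL K n).
Local Notation weight := {ffun 'I_n -> 'I_d.+1}.
Local Notation A := (poly_coalg K n_gt0 d).
Local Notation V := (subsp A).
Local Notation S := (dualalg A).
Local Notation xi := (xi K n_gt0).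
Local Notation eps := (eps n_gt0 d).
Local Notation excess := (@excess n s).
Local Notation truncated := (@truncated K n n_gt0 r s).
Variable C : cellular_basis (dualalg A) (dom_weight n d).
Hypothesis cellC : forall l : dom_weight n d, cell_module_iso_weyl l C.

Lemma dual_act_linear_left (f : V) : linear ((fun x => dual_act x f) : S -> V).
Proof. by move=> c x y; apply: V_ext. Qed.

Lemma dual_act_sum_left (I : finType) (c : I -> K) (x : I -> S) (f : V) :
  dual_act (\sum_i c i *: x i : S) f = \sum_i c i *: dual_act (x i) f.
Proof.
by elim/big_rec2: _ => [|i f' y _ <-]; [apply: V_ext | rewrite dual_act_linear_left].
Qed.

(** If the cells above mu vanish on truncated functions, letting the elements
    C_(X,Y) with Y fixed act on f defines a homomorphism from the Weyl module
    to the truncated functions. The image of the generating vector has weight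
    mu, which does not occur there, so the homomorphism is zero. *)
Lemma cell_truncated (mu : dom_weight n d) : (r < excess mu)%N ->
  forall (X Y : cell_ix C mu) f, truncated f -> (cell_elt C X Y : S) f = 0.
Proof.
elim/porder_ind: mu => mu IH rmu X Y f ft.
have [phi [[phi' phiK phi'K] phiA]] := cellC mu.
(* The candidate homomorphism, seen on the cell module. *)
pose theta (w : cell_module C mu) : V :=
  \sum_X (w X : K) *: dual_act (cell_elt C X Y : S) f.
have higher (x : S) : lin_span [set x | exists k (U U' : cell_ix C k),
    (k < mu)%O /\ x = cell_elt C U U'] x -> dual_act x f = 0.
  move: x; apply: lin_span_min => [|_ [k [U [U' [kmu ->]]]]].
    split=> [|c x y /= x0 y0]; first by apply: V_ext.
    by rewrite /= dual_act_linear_left x0 y0 scaler0 addr0.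
  apply: V_ext => g; rewrite linear0 -[LHS]/((cell_elt C U U' : S) (ltrans g f)).
  apply: IH => //; last exact: truncated_ltrans.
  by apply: leq_trans rmu _; apply: excess_mono; apply: ltW.
have aC (a : S) U : dual_act a (dual_act (cell_elt C U Y : S) f)
    = \sum_U' (cell_coef C a U' U : K) *: dual_act (cell_elt C U' Y : S) f.
  rewrite -dual_act_mul -dual_act_sum_left; apply/eqP; rewrite -subr_eq0; apply/eqP.
  rewrite -(higher _ (@cell_mulP _ _ _ _ C a mu U Y)).
  by apply: V_ext.
have thetaA (a : S) w : theta (cell_act a w) = dual_act a (theta w).
  rewrite /theta; transitivity (\sum_U \sum_U' (cell_coef C a U' U * w U : K)
      *: dual_act (cell_elt C U' Y : S) f).
    rewrite exchange_big /=; apply: eq_bigr => U' _; rewrite ffunE scaler_suml.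
    by [].
  have lin : linear (dual_act a : V -> V) by exact: dual_act_linear.
  pose D : {linear V -> V} := HB.pack (dual_act a) (GRing.isLinear.Build K V V _ (dual_act a) lin).
  rewrite -[RHS]/(D _) linear_sum; apply: eq_bigr => U _.
  rewrite linearZ /= aC scaler_sumr; apply: eq_bigr => U' _.
  by rewrite scalerA mulrC.
have theta_trunc w : truncated (theta w).
  by apply: truncated_sum => U; apply: truncated_act.
have gen0 : theta (phi' (weyl_gen K n_gt0 mu)) = 0.
  set w0 := phi' _; have w0E : cell_act (xi (dw_ffun mu)) w0 = w0.
    by apply: (can_inj phiK); rewrite phiA phi'K weyl_gen_weight.
  rewrite -w0E thetaA; apply: V_ext => g; rewrite linear0.
  have := theta_trunc w0 (dw_ffun mu) (valP mu) rmu (eps g) 1; rewrite mulr1.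
  by [].
have theta0 w : theta w = 0.
  have [x xE] := weyl_generated (phi w).
  have -> : w = cell_act x (phi' (weyl_gen K n_gt0 mu)).
    by apply: (can_inj phiK); rewrite phiA phi'K.
  by rewrite thetaA gen0; apply: V_ext => g; rewrite epsE dual_actE !linear0.
have := theta0 [ffun U => (U == X)%:R]; rewrite /theta (bigD1 X) //= ffunE eqxx scale1r.
rewrite big1 ?addr0 => [H|U /negPf UX]; last by rewrite ffunE UX scale0r.
have := congr1 (fun u => subsp_val u 1%g) H; rewrite dual_actE eps1 mul1r.
by [].
Qed.

End CellIdeal.

Section LargeIdeal.
Variables (K : closedFieldType) (n : nat) (n_gt0 : (0 < n)%N) (r s : nat).
Local Notation d := (r + n.-1 * s)%N.
Local Notation G := (GL K n).
Local Notation weight := {ffun 'I_n -> 'I_d.+1}.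
Local Notation A := (poly_coalg K n_gt0 d).
Local Notation V := (subsp A).
Local Notation S := (dualalg A).
Local Notation xi := (xi K n_gt0).
Local Notation eps := (eps n_gt0 d).
Local Notation excess := (@excess n s).
Local Notation truncated := (@truncated K n n_gt0 r s).
Variable C : cellular_basis (dualalg A) (dom_weight n d).
Hypothesis cellC : forall l : dom_weight n d, cell_module_iso_weyl l C.

Definition large_cells : set S := [set x | exists (mu : dom_weight n d) (X Y : cell_ix C mu),
  (r < excess mu)%N /\ x = cell_elt C X Y].
Local Notation J := (lin_span large_cells).

Lemma J_sum (I : finType) (P : pred I) (c : I -> K) (F : I -> S) :
  (forall i, P i -> J (F i)) -> J (\sum_(i | P i) c i *: F i).
Proof.
move=> HF; have [J0 JL] := lin_span_subspace large_cells.
by elim/big_rec: _ => // i x Pi Jx; apply: JL => //; apply: HF.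
Qed.

(** Since the excess grows along the dominance order, the span of the large
    cells is closed under the corrections by higher cells. *)
Lemma J_left (a x : S) : J x -> J (a * x).
Proof.
have [J0 JL] := lin_span_subspace large_cells.
move: x; apply: lin_span_min => [|_ [mu [X [Y [rmu ->]]]]].
  split=> [|c x y /= Jx Jy]; first by rewrite /= mulr0.
  have -> : a * (c *: x + y) = c *: (a * x) + a * y.
    by rewrite mulrDr; congr (_ + _); apply: esym (scalerAr c a x).
  exact: JL.
have JD x y : J x -> J y -> J (x + y) by move=> Jx Jy; rewrite -[x]scale1r; apply: JL.
rewrite /= -[a * _](subrK (\sum_(X' : cell_ix C mu) cell_coef C a X' X *: cell_elt C X' Y)).
apply: JD; last first.
  by apply: J_sum => X' _; apply: lin_span_incl; exists mu, X', Y.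
apply: (lin_span_min (lin_span_subspace large_cells)) (@cell_mulP _ _ _ _ C a mu X Y).
move=> _ [k [U [U' [kmu ->]]]]; apply: lin_span_incl; exists k, U, U'; split=> //.
by apply: leq_trans rmu _; apply: excess_mono; apply: ltW.
Qed.

Lemma cell_expand (x : S) : exists c : {ffun {l : dom_weight n d & (cell_ix C l * cell_ix C l)%type} -> K},
  x = \sum_p c p *: cell_elt C (tagged p).1 (tagged p).2.
Proof. by have [c [xc _]] := @cell_basisP _ _ _ _ C x; exists c. Qed.

Lemma cell_starK (x : S) : cell_star C (cell_star C x) = x.
Proof.
have [c ->] := cell_expand x; rewrite !linear_sum; apply: eq_bigr => p _.
by rewrite !linearZ /= !cell_starE.
Qed.

Lemma J_star (x : S) : J x -> J (cell_star C x).
Proof.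
have [J0 JL] := lin_span_subspace large_cells.
move: x; apply: lin_span_min => [|_ [mu [X [Y [rmu ->]]]]].
  by split=> [|c x y /= Jx Jy]; rewrite /= ?linear0 // linearP; apply: JL.
by rewrite /= cell_starE; apply: lin_span_incl; exists mu, Y, X.
Qed.

Lemma J_right (a x : S) : J x -> J (x * a).
Proof.
move=> Jx; rewrite -[x * a]cell_starK cell_starM.
by apply/J_star/J_left/J_star.
Qed.

(** The weight k does not occur in the induced module, which consists of
    multiples of det ^ s. *)
Lemma xi_weyl0 (l : dom_weight n d) (k : weight) (psi : weyl K n_gt0 l) :
  (excess l <= r)%N -> (r < excess (fun i => k i))%N -> weyl_act (xi k) psi = 0.
Proof.
move=> lr rk; apply: dual_eqP => f; rewrite -[LHS]/(psi (nabla_act (schur_transp (xi k)) f)).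
rewrite transp_xi; suff -> : nabla_act (xi k) f = 0 by rewrite !linear0.
apply: subsp_eqP; apply: V_ext => g.
have fr := induced_det_multiple lr (subspP f).
have := det_multiple_killed fr rk (eps g) 1; rewrite mulr1 => H.
by rewrite [LHS]H linear0.
Qed.

(** For a cell l of excess at most r, xi k acts by zero on the cell module, hence
    sends the cell l into the span of the higher cells; being idempotent, it
    can be applied once more, and induction applies. *)
Lemma xi_cell_large (k : weight) : (r < excess (fun i => k i))%N ->
  forall (l : dom_weight n d) (X Y : cell_ix C l), J (xi k * cell_elt C X Y).
Proof.
move=> rk; elim/porder_ind => l IH X Y.
case: (ltnP r (excess l)) => [rl|lr].
  by apply: J_left; apply: lin_span_incl; exists l, X, Y.
have [phi [[phi' phiK phi'K] phiA]] := cellC l.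
have act0 w : cell_act (C := C) (l := l) (xi k) w = 0.
  by apply: (can_inj phiK); rewrite phiA xi_weyl0 // linear0.
have coef0 X' : cell_coef C (xi k) X' X = 0.
  have /ffunP/(_ X') := act0 [ffun U => (U == X)%:R]; rewrite !ffunE (bigD1 X) //= ffunE eqxx.
  by rewrite mulr1 big1 ?addr0 // => U /negPf UX; rewrite ffunE UX mulr0.
rewrite -(xi_idem K n_gt0 k) -mulrA.
have := @cell_mulP _ _ _ _ C (xi k) l X Y; rewrite [X in _ - X]big1 => [|X' _]; last first.
  by rewrite coef0 scale0r.
rewrite subr0; move: (xi k * cell_elt C X Y); apply: lin_span_min.
  have [J0 JL] := lin_span_subspace large_cells.
  split=> [|c x y /= Jx Jy]; first by rewrite /= mulr0.
  have -> : xi k * (c *: x + y) = c *: (xi k * x) + xi k * y.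
    by rewrite mulrDr; congr (_ + _); apply: esym (scalerAr c (xi k) x).
  exact: JL.
by move=> _ [k' [U [U' [kl ->]]]]; apply: IH.
Qed.

Lemma xi_large (k : weight) : (r < excess (fun i => k i))%N -> J (xi k).
Proof.
move=> rk; rewrite -[xi k]mulr1; have [c ->] := cell_expand 1.
have -> : xi k * (\sum_p c p *: cell_elt C (tagged p).1 (tagged p).2)
    = \sum_p c p *: (xi k * cell_elt C (tagged p).1 (tagged p).2).
  rewrite mulr_sumr; apply: eq_bigr => p _; exact: esym (scalerAr _ _ _).
by apply: J_sum => p _; apply: xi_cell_large.
Qed.

Lemma J_perp_truncated (f : V) : (forall x : S, J x -> x f = 0) -> truncated f.
Proof.
by move=> Jf k dk rk x y; apply: Jf; apply/J_right/J_left/xi_large.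
Qed.

Lemma mem_J (x : S) :
  (forall f : V, (forall y : S, J y -> y f = 0) -> x f = 0) -> J x.
Proof.
move=> H; pose I := {l : dom_weight n d & (cell_ix C l * cell_ix C l)%type}.
pose y (p : I) : S := if (r < excess (tag p))%N then cell_elt C (tagged p).1 (tagged p).2 else 0.
have [J0 _] := lin_span_subspace large_cells.
have [f yf|c ->] := @annihilator_span K n n_gt0 d I y x; last first.
  apply: J_sum => p _; rewrite /y; case: ifP => // rp.
  by apply: lin_span_incl; exists (tag p), (tagged p).1, (tagged p).2.
apply: H; apply: lin_span_min => [|_ [mu [X [Y [rmu ->]]]]].
  by split=> // c u v /= u0 v0; rewrite -[LHS]/(c * (u : S) f + (v : S) f) u0 v0 mulr0 addr0.
by have := yf (Tagged _ (X, Y)); rewrite /y /= rmu.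
Qed.

(** The kernel of the quotient map is the annihilator of the multiples of det
    ^ s, that is, of the truncated functions; and the span of the large cells
    has the truncated functions as its common zeros. *)
Lemma schur_quot_kernel (x : S) : schur_quot n_gt0 r s x = 0 <-> J x.
Proof.
split=> [x0|].
  apply: mem_J => f /J_perp_truncated/truncated_det_multiple [h ->].
  by rewrite -[LHS]/(schur_quot n_gt0 r s x h) x0.
move: x; apply: lin_span_min => [|_ [mu [X [Y [rmu ->]]]]].
  by split=> [|c x y /= x0 y0]; rewrite ?linear0 // linearP /= x0 y0 scaler0 addr0.
apply: dual_eqP => h; apply: (cell_truncated cellC rmu).
by apply: det_multiple_truncated; exists h.
Qed.

End LargeIdeal.

Local Open Scope classical_set_scope.

Theorem theorem3p1 (K : closedFieldType) (n : nat) (n_gt0 : (0 < n)%N)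
    (r s : nat)
    (C : cellular_basis (dualalg (poly_coalg K n_gt0 (r + n.-1 * s)))
                        (dom_weight n (r + n.-1 * s)))
    (cellC : forall l : dom_weight n (r + n.-1 * s),
       cell_module_iso_weyl l C) :
  [set x | schur_quot n_gt0 r s x = 0] =
  lin_span [set x | exists (mu : dom_weight n (r + n.-1 * s))
                           (S T : cell_ix C mu),
     (\sum_(i in Rplus s mu) mu i > r + #|Rplus s mu| * s)%N /\
     x = cell_elt C S T].
Proof.
have -> : [set x | exists (mu : dom_weight n (r + n.-1 * s)) (S T : cell_ix C mu),
    (\sum_(i in Rplus s mu) mu i > r + #|Rplus s mu| * s)%N /\ x = cell_elt C S T]
  = large_cells C.
  by apply/funext => x; apply/propext; split=> -[mu [S [T [h ->]]]]; exists mu, S, T;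
    split=> //; move: h; rewrite excess_Rplus.
apply/seteqP; split=> x; first by move/(schur_quot_kernel cellC).
by move=> Jx; apply/(schur_quot_kernel cellC).
Qed.
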